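(* Let $N\in(2,\infty)$ be an even integer, let $p_c=3N/2$, and fix either sign in the equation $$u_{tt}-\Delta u\pm|u|^Nu=0\ \text{ on }\mathbb R^{3+1},\qquad u(0)=u_0,\quad u_t(0)=u_1 .\qquad(\ast)$$ There is a constant $c>0$ such that for any $L>0$ there exist radial initial data $(u_0,u_1)$ such that $\|u_0\|_{L^{p_c}}\ge L$, the corresponding solution $u$ of $(\ast)$ is global, forward in time (defined on $\mathbb R^3\times[0,\infty)$), and $$\|u\|_{\langle x\rangle^{-1}L^\infty_{t,x}\,\cap\,\langle x\rangle^{-1}L^\infty_xL^1_t}<\infty,\qquad \sup_{t}u(x,t)\ \ge\ c\,L\,\langle x\rangle^{-1}\quad\text{for (almost) every }x\in\mathbb R^3 .$$
   Context: All functions are real-valued. $\langle x\rangle=(1+|x|^2)^{1/2}$. Time ranges over $[0,\infty)$: $\|f\|_{L^\infty_xL^1_t}=\operatorname{ess\,sup}_{x\in\mathbb R^3}\int_0^\infty|f(x,t)|\,dt$. Weighted spaces are defined by $w(x)X:=\{w(x)f:\ f\in X\}$ with $\|g\|_{w(x)X}=\|w(x)^{-1}g\|_X$; so the finiteness condition says that $\langle x\rangle u\in L^\infty_{t,x}$ and $\langle x\rangle u\in L^\infty_xL^1_t$. Solutions are understood as mild solutions, i.e. solutions of $$u(t)=\cos(t\sqrt{-\Delta})u_0+\frac{\sin(t\sqrt{-\Delta})}{\sqrt{-\Delta}}u_1\mp\int_0^t\frac{\sin((t-s)\sqrt{-\Delta})}{\sqrt{-\Delta}}|u(s)|^Nu(s)\,ds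 .$$ *)

(* Defs.v *)
From HB Require Import structures.
From mathcomp Require Import all_boot all_order all_algebra.
From mathcomp Require Import all_classical all_reals all_analysis.
Set Implicit Arguments.
Unset Strict Implicit.
Unset Printing Implicit Defensive.
Import Order.TTheory GRing.Theory Num.Theory.
Import numFieldNormedType.Exports.
Local Open Scope classical_set_scope.
Local Open Scope ring_scope.

Section euclidean_space.
Context {R : realType}.
Implicit Types x y : R * R * R.

Definition dot x y : R := x.1.1 * y.1.1 + x.1.2 * y.1.2 + x.2 * y.2.

(* The library norm on a product is the sup norm, not this one. *)
Definition enorm x : R := Num.sqrt (dot x x).

Definition japanese x : R := Num.sqrt (1 + enorm x ^+ 2).

Definition radial (f : R * R * R -> R) : Prop :=
  forall x y, enorm x = enorm y -> f x = f y.

End euclidean_space.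

Notation leb1 R := (@lebesgue_measure R) (only parsing).

Definition leb3 (R : realType) := ((leb1 R \x leb1 R) \x leb1 R)%E.
Arguments leb3 R : clear implicits.

Section spacetime.
Context (R : realType).

Lemma measurable_time : measurable (`[0, +oo[%classic : set R).
Proof. exact: measurable_itv. Qed.

Lemma measurable_spacetime :
  measurable ([set: R * R * R] `*` `[0, +oo[%classic : set (R * R * R * R)).
Proof. by apply: measurableX => //; exact: measurable_itv. Qed.

(* Lebesgue measure on [0, +oo[ and on R^3 x [0, +oo[. *)
Definition leb_time := mrestr (leb1 R) measurable_time.
Definition leb_spacetime := mrestr (leb3 R \x leb1 R)%E measurable_spacetime.

End spacetime.
Arguments leb_time R : clear implicits.
Arguments leb_spacetime R : clear implicits.

Section norms.
Context {R : realType}.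
Implicit Type u : R * R * R -> R -> R.

Definition norm_Linf_tx u : \bar R :=
  ('N[leb_spacetime R]_+oo [(fun z => (u z.1 z.2)%:E)])%E.

Definition norm_Linf_x_L1_t u : \bar R :=
  ('N[leb3 R]_+oo [(fun x => \int[leb1 R]_(t in `[0%R, +oo[) `|(u x t)%:E|)])%E.

Definition weighted_norm (w : R * R * R -> R)
    (normX : (R * R * R -> R -> R) -> \bar R) u : \bar R :=
  normX (fun x t => (w x)^-1 * u x t).

Definition norm_solution_space u : \bar R :=
  let w := fun x => (japanese x)^-1 in
  Order.max (weighted_norm w norm_Linf_tx u)
            (weighted_norm w norm_Linf_x_L1_t u).

End norms.

Section fourier_multipliers.
Context {R : realType}.
Implicit Types (phi f g : R * R * R -> R) (m : R -> R).

Fixpoint iter_derive (s : seq (R * R * R)) phi : R * R * R -> R :=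
  if s is v :: s' then fun x => 'D_v (iter_derive s' phi) x else phi.

Definition schwartz phi : Prop :=
  forall s : seq (R * R * R),
    [/\ continuous (iter_derive s phi),
        (forall x v, derivable (iter_derive s phi) x v) &
        forall k : nat, exists C : R,
          forall x, japanese x ^+ k * `|iter_derive s phi x| <= C].

(* Real and imaginary parts of \int e^(- i x . xi) phi(xi) dxi, which is the
   normalization under which - Delta has symbol |xi|^2. *)
Definition fourier_re phi (x : R * R * R) : R :=
  \int[leb3 R]_xi (cos (dot x xi) * phi xi).
Definition fourier_im phi (x : R * R * R) : R :=
  - \int[leb3 R]_xi (sin (dot x xi) * phi xi).

(* Sufficient for f to define a tempered distribution. *)
Definition tempered f : Prop :=
  measurable_fun setT f /\
  exists k : nat,
    (leb3 R).-integrable setT (fun x => ((japanese x ^+ k)^-1 * f x)%:E).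

(* g = m(sqrt(- Delta)) f, that is, \hat g = m(|xi|) \hat f in the sense of
   tempered distributions: <g, \hat phi> = <f, \hat (m(|.|) phi)>.  Here m is
   real-valued, so real test functions suffice and the identity splits into
   the real and imaginary parts of the Fourier transform. *)
Definition is_multiplier m f g : Prop :=
  [/\ tempered f, tempered g &
    forall phi, schwartz phi ->
      let mphi := fun xi => m (enorm xi) * phi xi in
      \int[leb3 R]_x (g x * fourier_re phi x) =
        \int[leb3 R]_x (f x * fourier_re mphi x) /\
      \int[leb3 R]_x (g x * fourier_im phi x) =
        \int[leb3 R]_x (f x * fourier_im mphi x)].

(* Symbols of cos(t sqrt(- Delta)) and sin(t sqrt(- Delta)) / sqrt(- Delta). *)
Definition cos_symbol (t r : R) : R := cos (t * r).
Definition sinc_symbol (t r : R) : R :=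
  if r == 0 then t else sin (t * r) / r.

End fourier_multipliers.

(* Global forward mild solution of u_tt - Delta u + sigma |u|^N u = 0 with data
   (u0, u1); only the values u x t with t >= 0 matter.  The functions a and b
   are the two free evolutions at time t, and d x s is the Duhamel integrand;
   its joint measurability is what makes the integral over s independent of
   the choice of representatives of the classes d(., s). *)
Definition mild_solution (R : realType) (N : nat) (sigma : R)
    (u0 u1 : R * R * R -> R) (u : R * R * R -> R -> R) : Prop :=
  measurable_fun [set z : R * R * R * R | 0 <= z.2] (fun z => u z.1 z.2) /\
  forall t : R, 0 <= t ->
    exists (a b : R * R * R -> R) (d : R * R * R -> R -> R),
    [/\ is_multiplier (cos_symbol t) u0 a,
        is_multiplier (sinc_symbol t) u1 b,
        measurable_fun [set z : R * R * R * R | 0 <= z.2 <= t]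
          (fun z => d z.1 z.2),
        (forall s : R, 0 <= s <= t ->
          is_multiplier (sinc_symbol (t - s))
            (fun x => `|u x s| ^+ N * u x s) (fun x => d x s)) &
        {ae leb3 R, forall x,
          (leb1 R).-integrable `[0, t] (fun s => (d x s)%:E) /\
          u x t = a x + b x - sigma * \int[leb1 R]_(s in `[0, t]) d x s}].

(* Main.v *)
(* Write r = |x| and N = 2M.  The data are an outgoing radial wave
   v = h(r - t) / r, where h is the sum of a tent of slope L centred at lam, with
   support [0, 2 lam], and of a tall bump of width 2 eps at the same point.
   The bump makes the L^{3N/2} norm of u0 = h(r) / r large, while
   int_0^oo y (h(y) / y)^p dy stays as small as one likes for p = N and
   p = N + 1, because 3N/2 > N + 1.  For a power p >= 3 of v, the Duhamel
   integral is bounded by min(r, 1) / (2 r) times this quantity: in the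
   coordinates (y, s) = (rho - s, s) the source is h(y)^p / (y + s)^p, which
   gains an integrable factor (1 + s)^-2 over its value at s = 0.
   So the nonlinear correction w = u - v is a fixed point of a
   contraction in the ball |w| <= smallness / (1 + |x|), and
   int |w(x, t)| dt <~ 1 / (1 + |x|) is preserved by the Picard iteration.  The
   lower bound for sup_t u is then that of v: it comes from the wide tent for
   r <= lam and from the bump for r > lam.
   On radial functions, the propagators are computed through the sine
   transform, which is reached from the Fourier transform on R^3 by
   integrating plane waves over spheres (Archimedes: the coordinate along a
   diameter is uniformly distributed on a sphere). *)
From HB Require Import structures.
From mathcomp Require Import all_boot all_order all_algebra.
From mathcomp Require Import all_classical all_reals all_analysis.
From mathcomp Require Import measurable_realfun ess_sup_inf ring lra.
Require Import Defs.
Import Order.TTheory GRing.Theory Num.Theory.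
Import numFieldNormedType.Exports.
Local Open Scope classical_set_scope.
Local Open Scope ring_scope.

Set Implicit Arguments.
Unset Strict Implicit.
Unset Printing Implicit Defensive.

(** * Measurability and change of variables on R *)

(** The parameters are governed by a count of powers. On the bump, h(y) / y has size B = 2K / lam,
    so the bump adds about B^p lam eps to [mass h p] and about lam^2 B^(3N/2) eps to the integral of
    |u0|^(3N/2). Taking eps proportional to B^-(N+1) keeps both masses small and leaves B^(N/2 - 1)
    in the critical integral; this is unbounded in B exactly because N > 2. The tent adds about L^p
    lam^2, which a small lam controls. The powers N and N + 1 come from the contraction: a
    difference of two sources costs v^N, and the source of the zero correction is v^(N+1). The wave
    is purely outgoing because u1 = - h'(r) / r makes the velocity term cancel the incoming half of
    d'Alembert's formula. As h is only Lipschitz, h' enters through its integrals alone. Duhamel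
    terms are estimated through nonnegative majorants in the extended reals, where Tonelli asks for
    no integrability; signed integrals are compared with these afterwards. In the multiplier
    identities Fubini moves the Fourier kernel from the Schwartz function to the radial factor, so
    only transforms of radial functions are ever computed. *)

Section measurable_lambda.
Context d (T : measurableType d) (R : realType) (D : set T).
Implicit Type f : T -> R.

Lemma measurable_fun_opp f : measurable_fun D f -> measurable_fun D (fun x => - f x).
Proof. exact: measurableT_comp. Qed.

Lemma measurable_fun_norm f : measurable_fun D f -> measurable_fun D (fun x => `|f x|).
Proof. exact: measurableT_comp. Qed.

Lemma measurable_fun_abse (f : T -> \bar R) :
  measurable_fun D f -> measurable_fun D (fun x => `|f x|%E).
Proof. exact: measurableT_comp. Qed.

Lemma measurable_fun_comp_continuous (g : R -> R) f : continuous g ->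
  measurable_fun D f -> measurable_fun D (fun x => g (f x)).
Proof. by move=> /continuous_measurable_fun; exact: measurableT_comp. Qed.

Lemma measurable_fun_inv f : measurable_fun D f -> measurable_fun D (fun x => (f x)^-1).
Proof.
apply: (@measurableT_comp _ _ _ _ _ _ (@GRing.inv R)) => //.
(* Inversion is discontinuous at 0, where its value is 0 by convention. With that point split off,
   it is continuous on an open set. *)
have -> : @GRing.inv R = fun x => if x == 0 then 0 else x^-1.
  by apply/funext => x; case: eqP => // ->; rewrite invr0.
apply: measurable_fun_if => //.
- exact: measurable_fun_eqr.
- rewrite setTI; apply: open_continuous_measurable_fun.
    rewrite (_ : _ @^-1` _ = ~` [set 0]); last first.
      by apply/seteqP; split=> x /=; [move=> /negbT/eqP|move=> /eqP/negbTE].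
    exact/closed_openC/closed_eq.
  move=> x; rewrite inE /= => /negbT x0; exact: inv_continuous.
Qed.

End measurable_lambda.

Ltac mfun := repeat first
  [ match goal with
    | |- measurable_fun _ (fun _ => ?c) => exact: measurable_cst
    | |- measurable_fun _ (fun x => x) => exact: measurable_id
    | |- measurable_fun _ (fun x => x.1) => exact: measurable_fst
    | |- measurable_fun _ (fun x => x.2) => exact: measurable_snd
    | H : measurable_fun [set: _] ?F |- measurable_fun _ (fun x => ?F (@?g x)) =>
        apply: (measurableT_comp H)
    | H : measurable_fun [set: _] ?F |- measurable_fun _ ?F => exact: H
    | |- measurable_fun _ (fun x => Num.sqrt (@?f x)) =>
      apply: (@measurable_fun_comp_continuous _ _ _ _ Num.sqrt f); first exact: sqrt_continuous
    | |- measurable_fun _ (fun x => (@?f x * @?g x)%E) => apply: (@emeasurable_funM _ _ _ _ f g)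
    | |- measurable_fun _ (fun x => (@?f x + @?g x)%E) => apply: (@emeasurable_funD _ _ _ _ f g)
    | |- measurable_fun _ (fun x => (@?f x)%:E) => apply/measurable_EFinP
    | |- measurable_fun _ (fun x => @?f x + @?g x) => apply: (@measurable_funD _ _ _ _ f g)
    | |- measurable_fun _ (fun x => - @?f x) => apply: (@measurable_fun_opp _ _ _ _ f)
    | |- measurable_fun _ (fun x => @?f x * @?g x) => apply: (@measurable_funM _ _ _ _ f g)
    | |- measurable_fun _ (fun x => @?f x ^+ ?n) => apply: (@measurable_funX _ _ _ _ f n)
    | |- measurable_fun _ (fun x => `|@?f x|) => apply: (@measurable_fun_norm _ _ _ _ f)
    | |- measurable_fun _ (Order.le ?c) =>
      apply: (@measurable_fun_ler _ _ _ _ (fun=> c) (fun x => x))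
    | |- measurable_fun _ (Order.lt ?c) =>
      apply: (@measurable_fun_ltr _ _ _ _ (fun=> c) (fun x => x))
    | |- measurable_fun _ (fun x => `|@?f x|%E) => apply: (@measurable_fun_abse _ _ _ _ f)
    | |- measurable_fun _ (fun x => (@?f x)^-1) => apply: (@measurable_fun_inv _ _ _ _ f)
    | |- measurable_fun _ (fun x => (@?f x, @?g x)) => apply: (@measurable_fun_pair _ _ _ _ _ _ f g)
    | |- measurable_fun _ (fun x => @?f x <= @?g x) => apply: (@measurable_fun_ler _ _ _ _ f g)
    | |- measurable_fun _ (fun x => @?f x < @?g x) => apply: (@measurable_fun_ltr _ _ _ _ f g)
    | |- measurable_fun _ (fun x => @?f x == @?g x) => apply: (@measurable_fun_eqr _ _ _ _ f g)
    | |- measurable_fun _ (fun x => @?f x && @?g x) => apply: (@measurable_and _ _ _ f g)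
    | |- measurable_fun _ (fun x => (@?f x).1) => apply: (@measurableT_comp _ _ _ _ _ _ fst _ f);
      first exact: measurable_fst
    | |- measurable_fun _ (fun x => (@?f x).2) => apply: (@measurableT_comp _ _ _ _ _ _ snd _ f);
      first exact: measurable_snd
    | |- measurable_fun _ (fun x => cos (@?f x)) =>
      apply: (@measurable_fun_comp_continuous _ _ _ _ cos f); first exact: continuous_cos
    | |- measurable_fun _ (fun x => sin (@?f x)) =>
      apply: (@measurable_fun_comp_continuous _ _ _ _ sin f); first exact: continuous_sin
    end
  | apply: measurable_fun_ifT
  | assumption | exact: measurable_cst | exact: measurable_id
  | exact: measurable_fst | exact: measurable_snd ].

Section caratheodory.
Context d (T : measurableType d) (R : realType).

Let grid (n : nat) (y : R) : R := (Num.floor (n.+1%:R * y))%:~R / n.+1%:R.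

Let measurable_grid n : measurable_fun setT (grid n).
Proof.
apply: nondecreasing_measurable => // x y xy.
rewrite ler_wpM2r// ler_int le_floor// ler_wpM2l//.
Qed.

Let cvg_grid y : grid ^~ y @ \oo --> y.
Proof.
apply/cvgrPdist_le => e e0.
near=> n.
have n0 : 0 < n.+1%:R :> R by [].
rewrite ger0_norm /grid.
  rewrite lerBlDr -lerBlDl ler_pdivlMr// mulrBl.
  have /andP[_ /ltW] := floor_itv (n.+1%:R * y).
  rewrite intrD mulr1z => H.
  have He : 1 <= e * n.+1%:R.
    rewrite -ler_pdivrMr// mul1r; apply: ltW.
    by near: n; exact: (near_infty_natSinv_lt (PosNum e0)).
  lra.
rewrite subr_ge0 ler_pdivrMr//.
have /andP[+ _] := floor_itv (n.+1%:R * y).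
by rewrite mulrC.
Unshelve. all: end_near. Qed.

(** By continuity in [y], [f] is the pointwise limit of the functions f (t, grid n y), where
    [grid n] rounds down to a multiple of 1 / (n + 1). Each of them takes only countably many values
    of the second argument, so its preimages are countable unions of measurable rectangles. *)
Lemma measurable_fun_caratheodory (f : T * R -> R) :
  (forall y, measurable_fun setT (fun t => f (t, y))) ->
  (forall t, continuous (fun y => f (t, y))) ->
  measurable_fun setT f.
Proof.
move=> mf cf.
apply: (measurable_fun_cvg (h := fun n z => f (z.1, grid n z.2))); last first.
  by move=> [t y] _; exact: (cvg_comp _ _ (@cvg_grid y) (cf t y)).
move=> n _ B mB; rewrite setTI.
(* An enumeration of the grid points, through the countability of the integers. *)
pose c (k : nat) : R := if unpickle k is Some j then (j : int)%:~R / n.+1%:R else 0.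
rewrite [X in measurable X](_ : _ = \bigcup_k
   ([set z | B (f (z.1, c k))] `&` (fun z => grid n z.2) @^-1` [set c k])).
  apply: bigcupT_measurable => k; apply: measurableI.
    rewrite -[X in measurable X]setTI.
    by apply: (measurableT_comp (mf (c k)) measurable_fst).
  rewrite -[X in measurable X]setTI.
  apply: (measurableT_comp (measurable_grid n) measurable_snd) => //.
apply/seteqP; split=> [z /= Bz|z [k _ /= []]]; last by move=> + ->.
exists (pickle (Num.floor (n.+1%:R * z.2))) => //=.
by rewrite /c pickleK.
Qed.

End caratheodory.

Section affine.
Context (R : realType).
Notation mu := (@lebesgue_measure R).

Let aff (a b : R) : R -> measurableTypeR R := fun x => a * x + b.

Let maff a b : measurable_fun setT (aff a b).
Proof. by rewrite /aff; mfun. Qed.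

(** The pushforward by the affine map, multiplied by [a], gives every half-open interval its length,
    and Lebesgue measure is determined by these values. *)
Let pre_affine (a b : R) (A : set R) : 0 < a -> measurable A ->
  mu (aff a b @^-1` A) = (a^-1%:E * mu A)%E.
Proof.
move=> a0 mA.
pose M : {measure set (measurableTypeR R) -> \bar R} :=
  mscale (NngNum (ltW a0)) (pushforward mu (aff a b)).
have -> : mu A = M (maff a b) A.
  refine (@lebesgue_measure_unique R (M (maff a b)) _ A mA).
  move=> _ [[c d] _ <-].
  transitivity (a%:E * mu (aff a b @^-1` `]c, d]))%E; last by [].
  have -> : aff a b @^-1` `]c, d]%classic = `](c - b) / a, (d - b) / a]%classic.
    apply/seteqP; split=> x /=; rewrite /aff !in_itv/= ltr_pdivrMr// ler_pdivlMr//;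
    move=> /andP[? ?]; apply/andP; split; lra.
  rewrite !lebesgue_measure_itv/= !lte_fin ltr_pM2r ?invr_gt0// ltrD2r.
  case: ifP => _; last by rewrite mule0.
  by rewrite -EFinD -EFinM; congr EFin; field; lra.
by rewrite {1}(_ : M _ A = a%:E * mu (aff a b @^-1` A))%E// muleA -EFinM mulVf ?mul1e// gt_eqF.
Qed.

Let ge0_integral_affine_gt0 (a b : R) (f : R -> \bar R) : 0 < a ->
  measurable_fun setT f -> (forall x, 0 <= f x)%E ->
  (\int[mu]_x f (a * x + b)%R = a^-1%:E * \int[mu]_x f x)%E.
Proof.
move=> a0 mf f0.
have ai : 0 <= a^-1 by rewrite invr_ge0 ltW.
transitivity (\int[mscale (NngNum ai) mu]_x f x)%E; last by rewrite ge0_integral_mscale.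
transitivity (\int[pushforward mu (aff a b)]_x f x)%E.
  by rewrite ge0_integral_pushforward//; exact: maff.
apply: eq_measure_integral => [|m A mA _]; first exact: maff.
exact: pre_affine.
Qed.

Let ge0_integral_opp (f : R -> \bar R) :
  measurable_fun setT f -> (forall x, 0 <= f x)%E ->
  (\int[mu]_x f (- x)%R = \int[mu]_x f x)%E.
Proof.
move=> mf f0.
transitivity (\int[pushforward mu (-%R : R -> measurableTypeR R)]_x f x)%E.
  by rewrite ge0_integral_pushforward.
by apply: eq_measure_integral => A mA _; exact: lebesgue_measureN.
Qed.

Lemma ge0_integral_affine (a b : R) (f : R -> \bar R) : a != 0 ->
  measurable_fun setT f -> (forall x, 0 <= f x)%E ->
  (\int[mu]_x f (a * x + b)%R = `|a|^-1%:E * \int[mu]_x f x)%E.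
Proof.
move=> a0 mf f0; have [a_gt0|a_le0] := ltP 0 a.
  by rewrite gtr0_norm// ge0_integral_affine_gt0.
have a_lt0 : a < 0 by rewrite lt_neqAle a0.
rewrite ltr0_norm// -(ge0_integral_opp mf f0).
rewrite -(ge0_integral_affine_gt0 (a := - a) (- b)) ?oppr_gt0//; last first.
  by apply: (measurableT_comp mf); exact: oppr_measurable.
by apply: eq_integral => x _; congr f; ring.
Qed.

(* No integrability is needed: the integrals of both parts are invariant. *)
Lemma Rintegral_affine (a b : R) (f : R -> R) : `|a| = 1 ->
  measurable_fun setT f ->
  \int[mu]_x f (a * x + b)%R = \int[mu]_x f x.
Proof.
move=> a1 mf.
have a0 : a != 0 by rewrite -normr_gt0 a1.
rewrite /Rintegral integralE [in RHS]integralE.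
have mEf : measurable_fun setT (EFin \o f) by exact/measurable_EFinP.
have := ge0_integral_affine b a0 (measurable_funepos mEf) (funepos_ge0 _).
have := ge0_integral_affine b a0 (measurable_funeneg mEf) (funeneg_ge0 _).
rewrite a1 invr1 !mul1e => E1 E2; rewrite -E1 -E2; congr (fine (_ - _)%E).
  by apply: eq_integral => x _; rewrite -[RHS]/((_ \o (fun x => a * x + b)) x) -funepos_comp.
by apply: eq_integral => x _; rewrite -[RHS]/((_ \o (fun x => a * x + b)) x) -funeneg_comp.
Qed.

End affine.

Section parametric.
Context d1 d2 (T1 : measurableType d1) (T2 : measurableType d2) (R : realType).
Variable m : {sigma_finite_measure set T2 -> \bar R}.

Lemma measurable_fun_Rintegral_snd (f : T1 -> T2 -> R) :
  measurable_fun setT (fun z : T1 * T2 => f z.1 z.2) ->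
  measurable_fun setT (fun x => \int[m]_y f x y).
Proof.
move=> mf.
apply: (measurableT_comp (fine_measurable measurableT)).
under eq_fun => x do rewrite integralE.
pose F (z : T1 * T2) := (f z.1 z.2)%:E.
have mF : measurable_fun setT F by exact/measurable_EFinP.
apply: emeasurable_funB.
  rewrite (_ : (fun x => _) = (fun x => \int[m]_y F^\+ (x, y)))%E; last first.
    by apply/funext => x; apply: eq_integral => y _; rewrite !funeposE.
  by apply: (measurable_fun_fubini_tonelli_F F^\+%E) => //; exact: measurable_funepos.
rewrite (_ : (fun x => _) = (fun x => \int[m]_y F^\- (x, y)))%E; last first.
  by apply/funext => x; apply: eq_integral => y _; rewrite !funenegE.
by apply: (measurable_fun_fubini_tonelli_F F^\-%E) => //; exact: measurable_funeneg.
Qed.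

End parametric.

Section parametric_lebesgue.
Context d (T : measurableType d) (R : realType).
Notation mu := (@lebesgue_measure R).

Lemma measurable_fun_ge0_integral (f : T -> R -> \bar R) :
  measurable_fun setT (fun z : T * R => f z.1 z.2) ->
  (forall x y, 0 <= f x y)%E ->
  measurable_fun setT (fun x => \int[mu]_y f x y)%E.
Proof.
by move=> mf f0; exact: (@measurable_fun_fubini_tonelli_F _ _ T (measurableTypeR R) R mu
  (fun z => f z.1 z.2)).
Qed.

Lemma measurable_fun_Rintegral (f : T -> R -> R) :
  measurable_fun setT (fun z : T * R => f z.1 z.2) ->
  measurable_fun setT (fun x => \int[mu]_y f x y).
Proof. exact: (@measurable_fun_Rintegral_snd _ _ T (measurableTypeR R) R mu). Qed.

End parametric_lebesgue.

(* The library has no canonical sigma-finite structure on a product of measures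
   that are not subprobabilities. *)
Section sigma_finite_products.
Context (R : realType).
Notation mu := (@lebesgue_measure R).

Let cube (n : nat) : set R := `[- n%:R, n%:R]%classic.

Let bigcup_cube (x : R) : exists n, forall m, (n <= m)%N -> cube m x.
Proof.
exists (Num.truncn `|x|).+1 => m nm; rewrite /cube/= in_itv/= -ler_norml.
apply: le_trans (ltW (truncnS_gt `|x|)) _.
by rewrite ler_nat.
Qed.

Let measurable_cube n : measurable (cube n).
Proof. exact: measurable_itv. Qed.

Let mu_cube n : (mu (cube n) < +oo)%E.
Proof. by rewrite lebesgue_measure_itv/=; case: ifP => _; rewrite ltry. Qed.

Definition leb2 : set (measurableTypeR R * measurableTypeR R) -> \bar R :=
  (mu \x mu)%E.
HB.instance Definition _ := Measure.on leb2.

Let leb2_cube n : (leb2 (cube n `*` cube n) < +oo)%E.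
Proof.
have := @product_measure1E _ _ _ _ R mu mu (cube n) (cube n) (measurable_cube n)
  (measurable_cube n).
rewrite /leb2 => ->; apply: lte_mul_pinfty; [exact: measure_ge0| |exact: mu_cube].
by rewrite ge0_fin_numE ?mu_cube.
Qed.

Let leb2_sigma_finite : sigma_finite setT leb2.
Proof.
exists (fun n => cube n `*` cube n).
  apply/esym/seteqP; split=> // -[x y] _.
  have [n xn] := bigcup_cube x; have [m ym] := bigcup_cube y.
  by exists (maxn n m) => //; split; [apply: xn|apply: ym]; rewrite ?leq_maxl ?leq_maxr.
by move=> n; split; [apply: measurableX; exact: measurable_cube|exact: leb2_cube].
Qed.

HB.instance Definition _ := Measure_isSigmaFinite.Build _ _ _ leb2 leb2_sigma_finite.

HB.instance Definition _ := Measure.copy (leb3 R) (leb2 \x mu)%E.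

Let leb3_sigma_finite : sigma_finite setT (leb3 R).
Proof.
exists (fun n => (cube n `*` cube n) `*` cube n).
  apply/esym/seteqP; split=> // -[[x y] z] _.
  have [n xn] := bigcup_cube x; have [m ym] := bigcup_cube y.
  have [k zk] := bigcup_cube z.
  exists (maxn (maxn n m) k) => //; do 2?split; [apply: xn|apply: ym|apply: zk];
  by rewrite ?(leq_maxl, leq_maxr, leq_max, leqnn, orbT).
move=> n.
have mcc : measurable (cube n `*` cube n) by apply: measurableX; exact: measurable_cube.
split; first by apply: measurableX => //; exact: measurable_cube.
have := @product_measure1E _ _ _ _ R leb2 mu _ (cube n) mcc (measurable_cube n).
move=> E; rewrite [X in (X < _)%E](_ : _ = (leb2 (cube n `*` cube n) * mu (cube n))%E)//.
by rewrite lte_mul_pinfty ?measure_ge0 ?ge0_fin_numE ?mu_cube ?leb2_cube.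
Qed.

HB.instance Definition _ :=
  Measure_isSigmaFinite.Build _ _ _ (leb3 R) leb3_sigma_finite.

End sigma_finite_products.
Arguments leb2 R : clear implicits.

Section iterated.
Context (R : realType).
Notation mu := (@lebesgue_measure R).

Lemma tonelli (f : R -> R -> \bar R) :
  measurable_fun setT (fun z : R * R => f z.1 z.2) ->
  (forall x y, 0 <= f x y)%E ->
  (\int[mu]_x \int[mu]_y f x y = \int[mu]_y \int[mu]_x f x y)%E.
Proof.
move=> mf f0.
exact: (@fubini_tonelli _ _ (measurableTypeR R) (measurableTypeR R) R mu mu (fun z => f z.1 z.2)).
Qed.

Lemma ge0_integral_leb3 (f : R * R * R -> \bar R) : measurable_fun setT f ->
  (forall x, 0 <= f x)%E ->
  (\int[leb3 R]_x f x = \int[mu]_x \int[mu]_y \int[mu]_z f (x, y, z))%E.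
Proof.
move=> mf f0.
have -> := @fubini_tonelli1 _ _ _ (measurableTypeR R) R (leb2 R) mu f mf f0.
have mF := @measurable_fun_fubini_tonelli_F _ _ _ (measurableTypeR R) R mu f mf f0.
by have -> := @fubini_tonelli1 _ _ (measurableTypeR R) (measurableTypeR R) R mu mu _ mF
  (fun p => integral_ge0 mu (fun z _ => f0 (p, z))).
Qed.

Lemma lebesgue_measure2 (P : R * R -> bool) : measurable_fun setT P ->
  (((mu \x mu) [set p | P p]) = \int[mu]_x \int[mu]_y (if P (x, y) then 1 else 0)%:E)%E.
Proof.
move=> mP.
have mS : measurable [set p | P p].
  by rewrite -[X in measurable X]setTI; exact: mP.
rewrite -[LHS]mul1e -integral_cst//.
transitivity (\int[(mu \x mu)%E]_p (if P p then 1 else 0)%:E)%E.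
  rewrite integral_mkcond; apply: eq_integral => p _; rewrite patchE.
  have [Pp|nPp] := boolP (P p); first by rewrite mem_set.
  by rewrite memNset//=; exact/negP.
have mf : measurable_fun setT (fun p : R * R => (if P p then 1 else 0)%:E : \bar R) by mfun.
have f0 (p : R * R) : (0%E <= (if P p then 1 else 0)%:E :> \bar R)%E by case: ifP; rewrite lee_fin.
by rewrite (@fubini_tonelli1 _ _ (measurableTypeR R) (measurableTypeR R) R mu mu _ mf f0).
Qed.

Lemma ge0_integral_cstM (c : R) (f : R -> \bar R) : 0 <= c ->
  measurable_fun setT f -> (forall x, 0 <= f x)%E ->
  (\int[mu]_x (c%:E * f x) = c%:E * \int[mu]_x f x)%E.
Proof. by move=> c0 mf f0; rewrite ge0_integralZl_EFin. Qed.

Lemma ge0_integral_lincomb (a b : R) (f g : R -> \bar R) : 0 <= a -> 0 <= b ->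
  measurable_fun setT f -> measurable_fun setT g ->
  (forall x, 0 <= f x)%E -> (forall x, 0 <= g x)%E ->
  (\int[mu]_x (a%:E * f x + b%:E * g x) = a%:E * \int[mu]_x f x + b%:E * \int[mu]_x g x)%E.
Proof.
move=> a0 b0 mf mg f0 g0; rewrite -!ge0_integral_cstM// ge0_integralD//.
- by move=> x _; rewrite mule_ge0.
- by apply: emeasurable_funM; mfun.
- by move=> x _; rewrite mule_ge0.
- by apply: emeasurable_funM; mfun.
Qed.

(** Turns a nonnegative value into an integral over levels [c], so that an equality of measures of
    sets can be lifted to an equality of integrals of functions. *)
Lemma layer_cake (e : R) : 0 <= e ->
  (\int[mu]_c (if (0 <= c) && (c < e) then 1 else 0)%:E = e%:E)%E.
Proof.
move=> e0.
transitivity (mu `[0, e[%classic); last first.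
  by rewrite lebesgue_measure_itv/= lte_fin oppr0 addr0; case: ltrP => // e1; congr EFin; lra.
rewrite -[RHS]mul1e -integral_cst// integral_mkcond/=.
apply: eq_integral => y _; rewrite /patch/= mem_setE in_itv/=.
by case: ifP.
Qed.

End iterated.

(** * Integrals over intervals of the line *)

Section ftc.
Context (R : realType).
Notation mu := (@lebesgue_measure R).

(** Interval integrals are mostly kept as integrals of an [if] over the whole line: the endpoints
    may then depend on other variables and Tonelli still applies. This lemma is the passage back. *)
Lemma integral_if_itv (a b : R) (f : R -> R) :
  (\int[mu]_x (if (a <= x) && (x <= b) then f x else 0)%:E =
   \int[mu]_(x in `[a, b]) (f x)%:E)%E.
Proof.
rewrite [RHS]integral_mkcond/=; apply: eq_integral => x _.
by rewrite /patch/= mem_setE in_itv/=; case: ifP.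
Qed.

Lemma integral_if_itvo (a b : R) (f : R -> R) : measurable_fun setT f ->
  (\int[mu]_x (if (a <= x) && (x < b) then f x else 0)%:E =
   \int[mu]_x (if (a <= x) && (x <= b) then f x else 0)%:E)%E.
Proof.
move=> mf; rewrite integral_if_itv -integral_itv_bndo_bndc; last first.
  exact/measurable_EFinP/measurable_funTS.
rewrite [RHS]integral_mkcond/=; apply: eq_integral => x _.
by rewrite /patch/= mem_setE in_itv/=; case: ifP.
Qed.

Lemma integral_FTC (f F : R -> R) (a b : R) : a <= b -> continuous f ->
  (forall x : R, is_derive x 1 F (f x)) ->
  (\int[mu]_x (if (a <= x) && (x <= b) then f x else 0)%:E = (F b - F a)%:E)%E.
Proof.
move=> ab cf dF; rewrite integral_if_itv.
have [ab'|ba] := ltP a b; last first.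
  have <- : a = b by lra.
  by rewrite subrr set_itv1 integral_set1.
have cF : continuous F.
  move=> x; apply: differentiable_continuous; apply/derivable1_diffP.
  by have [] := dF x.
rewrite EFinB; apply: continuous_FTC2 => //.
- exact: continuous_subspaceT.
- split=> //.
  + by apply: cvg_at_right_filter; exact: cF.
  + by apply: cvg_at_left_filter; exact: cF.
- by move=> x _; rewrite derive1E; apply: derive_val.
Qed.

End ftc.

(** * Integration of radial functions on R^3 *)

Section planar.
Context (R : realType).
Notation mu := (@lebesgue_measure R).

(** A rotation with [a] nonzero is a composition of two one-dimensional affine substitutions: u = a
    x - b y at fixed y, then w = (y + b u) / a at fixed u. Their Jacobian factors 1 / |a| and |a|
    cancel. *)
Lemma ge0_integral_rotation (a b : R) (Phi : R -> R -> R) :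
  a ^+ 2 + b ^+ 2 = 1 ->
  measurable_fun setT (fun z : R * R => Phi z.1 z.2) ->
  (forall x y, 0 <= Phi x y) ->
  (\int[mu]_x \int[mu]_y (Phi (a * x - b * y)%R (b * x + a * y)%R)%:E =
   \int[mu]_x \int[mu]_y (Phi x y)%:E)%E.
Proof.
move=> ab mPhi Phi0.
have mPhi2 (f g : R * R -> R) : measurable_fun setT f -> measurable_fun setT g ->
    measurable_fun setT (fun z => (Phi (f z) (g z))%:E).
  move=> mf mg; apply/measurable_EFinP.
  by apply: (measurableT_comp mPhi (g := fun z => (f z, g z))); exact: measurable_fun_pair.
have mPhi1 (f g : R -> R) : measurable_fun setT f -> measurable_fun setT g ->
    measurable_fun setT (fun z => (Phi (f z) (g z))%:E).
  move=> mf mg; apply/measurable_EFinP.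
  by apply: (measurableT_comp mPhi (g := fun z => (f z, g z))); exact: measurable_fun_pair.
have Phi0e x y : (0 <= (Phi x y)%:E)%E by rewrite lee_fin.
rewrite tonelli; [|by apply: mPhi2; mfun|by move=> x y; exact: Phi0e].
(* For a = 0 the rotation exchanges the axes up to sign, and dividing by [a] is impossible. *)
have [a0|a0] := eqVneq a 0.
  have b1 : `|b| = 1.
    apply/eqP; rewrite -(@pexpr_eq1 _ _ 2)//.
    by rewrite real_normK ?num_real// -ab a0 expr0n add0r.
  have b0 : b != 0 by rewrite -normr_gt0 b1.
  transitivity (\int[mu]_y \int[mu]_x (Phi (- b * y) x)%:E)%E.
    apply: eq_integral => y _.
    rewrite -[RHS]mul1e -[X in (X%:E * _)%E]invr1 -b1.
    rewrite -(ge0_integral_affine 0 b0 (f := fun x => (Phi (- b * y) x)%:E))//;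
      last by apply: mPhi1; mfun.
    by apply: eq_integral => x _; rewrite a0 !mul0r addr0 sub0r mulNr.
  have nb0 : - b != 0 by rewrite oppr_eq0.
  have := ge0_integral_affine 0 nb0 (f := fun y => \int[mu]_x (Phi y x)%:E)%E.
  rewrite normrN b1 invr1 mul1e => <-.
  - by apply: eq_integral => y _; rewrite addr0.
  - by apply: measurable_fun_ge0_integral => //; apply: mPhi2; mfun.
  - by move=> x; exact: integral_ge0.
have ai0 : a^-1 != 0 by rewrite invr_eq0.
transitivity (\int[mu]_y \int[mu]_u (`|a|^-1%:E * (Phi u (a^-1 * y + b * u / a)%R)%:E))%E.
  apply: eq_integral => y _.
  rewrite ge0_integral_cstM//; last by apply: mPhi1; mfun.
  rewrite -(ge0_integral_affine (- (b * y)) a0 (f := fun u => (Phi u (a^-1 * y + b * u / a))%:E))//;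
    last by apply: mPhi1; mfun.
  apply: eq_integral => x _; congr (Phi _ _)%:E.
  have -> : b * x + a * y = b * x + (a ^+ 2 / a) * y by congr (_ + _ * _); field.
  rewrite (_ : a ^+ 2 = 1 - b ^+ 2); last by rewrite -ab addrK.
  by field.
rewrite tonelli; last 2 first.
- by apply: emeasurable_funM; [exact: measurable_cst|apply: mPhi2; mfun].
- by move=> x y; rewrite mule_ge0// lee_fin.
apply: eq_integral => u _.
rewrite ge0_integral_cstM//; last by apply: mPhi1; mfun.
rewrite (ge0_integral_affine (b * u / a) ai0 (f := fun w => (Phi u w)%:E))//; last by apply: mPhi1;
  mfun.
by rewrite normfV invrK muleA -EFinM mulVf ?mul1e// normr_eq0.
Qed.

Let disc (s : R) : \bar R :=
  \int[mu]_x \int[mu]_y (if x ^+ 2 + y ^+ 2 < s then 1 else 0)%:E.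

Let if01_ge0 (b : bool) : (0 <= (if b then 1 else 0 : R)%:E)%E.
Proof. by case: b; rewrite lee_fin. Qed.

Let disc_scale (s : R) : 0 < s -> (disc s = s%:E * disc 1)%E.
Proof.
move=> s0; pose q := Num.sqrt s.
have q0 : 0 < q by rewrite sqrtr_gt0.
have qq : q ^+ 2 = s by rewrite sqr_sqrtr// ltW.
have -> : disc 1 = (q^-1%:E * (q^-1%:E * disc s))%E.
  have q0' : q != 0 by rewrite gt_eqF.
  have qn : `|q|^-1 = q^-1 by rewrite gtr0_norm.
  rewrite -ge0_integral_cstM ?invr_ge0 ?(ltW q0)//; last 2 first.
  - by apply: measurable_fun_ge0_integral => //; mfun.
  - by move=> x; exact: integral_ge0.
  rewrite -qn -(ge0_integral_affine 0 q0'
    (f := fun x => (`|q|^-1%:E * \int[mu]_y (if (x ^+ 2 + y ^+ 2 < s)%R then 1 else 0)%:E)%E));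
      last 2 first.
  - apply: emeasurable_funM; first exact: measurable_cst.
    by apply: measurable_fun_ge0_integral => //; mfun.
  - by move=> x; rewrite mule_ge0 ?integral_ge0// lee_fin.
  apply: eq_integral => x _.
  rewrite -(ge0_integral_affine 0 q0'
    (f := fun y => (if (q * x + 0) ^+ 2 + y ^+ 2 < s then 1 else 0)%:E))//; last by mfun.
  apply: eq_integral => y _; congr (EFin (if _ then _ else _)).
  rewrite !addr0 !exprMn qq -mulrDr.
  by rewrite -[X in _ = (_ < X)](mulr1 s) ltr_pM2l.
rewrite !muleA -!EFinM (_ : s * _ * _ = 1) ?mul1e// -qq; field.
by rewrite gt_eqF.
Qed.

Let square_integral (c : R) : 0 <= c ->
  (\int[mu]_x \int[mu]_y (if ((- c <= x) && (x <= c)) && ((- c <= y) && (y <= c)) then 1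
    else 0)%:E = (c *+ 2 * c *+ 2)%:E)%E.
Proof.
move=> c0.
have E := @lebesgue_measure2 R (fun p => ((- c <= p.1) && (p.1 <= c)) &&
  ((- c <= p.2) && (p.2 <= c))).
rewrite -E; last by mfun.
rewrite (_ : [set p | _] = `[-c, c]%classic `*` `[-c, c]%classic); last first.
  by apply/seteqP; split=> -[x y] /=; rewrite !in_itv/=; [move/andP|move=> [-> ->]].
have P := @product_measure1E _ _ _ _ R mu mu `[-c, c]%classic `[-c, c]%classic (measurable_itv _)
  (measurable_itv _).
have M : mu `[- c, c]%classic = (c *+ 2)%:E.
  rewrite lebesgue_measure_itv/= lte_fin; case: ltrP => cc.
    by rewrite -EFinD; congr EFin; ring.
  by have -> : c = 0; [lra|rewrite mul0rn].
transitivity ((c *+ 2)%:E * (c *+ 2)%:E)%E; first by rewrite -M; exact: P.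
by rewrite -EFinM; congr EFin; ring.
Qed.

Let disc1_fin : disc 1 \is a fin_num.
Proof.
rewrite ge0_fin_numE; last by apply: integral_ge0 => x _; exact: integral_ge0.
apply: (@le_lt_trans _ _ (1 *+ 2 * 1 *+ 2)%:E); last by rewrite ltry.
rewrite -(square_integral ler01); apply: ge0_le_integral => //.
- by move=> x _; exact: integral_ge0.
- by apply: measurable_fun_ge0_integral => //; mfun.
- by apply: measurable_fun_ge0_integral => //; mfun.
move=> x _; apply: ge0_le_integral => //; [mfun|mfun|].
move=> y _; rewrite lee_fin; case: ifPn => // xy1; last by case: ifP.
by rewrite ifT//; nra.
Qed.

(** This is pi, kept abstract. It is finite and positive by comparison with the squares of half-side
    1 and 1/2. *)
Definition unit_disc_area : R := fine (disc 1).

Lemma unit_disc_area_gt0 : 0 < unit_disc_area.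
Proof.
apply: (@lt_le_trans _ _ (2^-1 *+ 2 * 2^-1 *+ 2)); first lra.
rewrite -lee_fin /unit_disc_area fineK// -(square_integral (c := 2^-1)); last lra.
apply: ge0_le_integral => //.
- by move=> x _; exact: integral_ge0.
- by apply: measurable_fun_ge0_integral => //; mfun.
- by apply: measurable_fun_ge0_integral => //; mfun.
move=> x _; apply: ge0_le_integral => //; [mfun|mfun|].
move=> y _; rewrite lee_fin; case: ifPn => // xy1; last by case: ifP.
by rewrite ifT//; nra.
Qed.

Let discE s : (disc s = (unit_disc_area * Num.max s 0)%:E)%E.
Proof.
have [s0|s0] := ltP 0 s.
  by rewrite disc_scale// mulrC EFinM /unit_disc_area fineK.
rewrite mulr0 /disc; apply: integral0_eq => x _; apply: integral0_eq => y _.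
by rewrite ifF//; apply/negbTE; rewrite -leNgt; nra.
Qed.

Notation A := unit_disc_area.

Let shell (z : R) (p : R * R) : R := Num.sqrt (p.1 ^+ 2 + p.2 ^+ 2 + z ^+ 2).

Let measurable_shell z : measurable_fun setT (shell z).
Proof. by rewrite /shell; mfun. Qed.

Let proj1 (p : R * R) : R := p.1.

(** The region under the graph of r -> 2 A r over r >= |z|. Projecting planar measure restricted to
    it onto the first axis produces the measure 2 A r dr on [|z|, +oo[. *)
Let cyl (z : R) : set (R * R) :=
  [set p | (`|z| <= p.1) && ((0 <= p.2) && (p.2 < 2 * A * p.1))].

Let measurable_cyl z : measurable (cyl z).
Proof.
rewrite -[X in measurable X]setTI.
have : measurable_fun setT (fun p : R * R => (`|z| <= p.1) && ((0 <= p.2) && (p.2 < 2 * A * p.1)))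
  by mfun.
by apply.
Qed.

Let shell_measureE z (P : R -> bool) : measurable_fun setT P ->
  (pushforward (leb2 R) (shell z) [set r | P r] =
   \int[mu]_x \int[mu]_y (if P (Num.sqrt (x ^+ 2 + y ^+ 2 + z ^+ 2)) then 1 else 0)%:E)%E.
Proof.
move=> mP.
apply: etrans; last first.
  apply: (@lebesgue_measure2 R (fun p => P (shell z p))).
  exact: (measurableT_comp mP).
by [].
Qed.

Let cyl_measureE z (P : R -> bool) : measurable_fun setT P ->
  (pushforward (mrestr (leb2 R) (measurable_cyl z)) proj1 [set r | P r] =
   \int[mu]_r (if P r && (`|z| <= r) then 2 * A * r else 0)%:E)%E.
Proof.
move=> mP.
have mP1 : measurable_fun setT (fun p : R * R => P p.1) by mfun.
have mQ : measurable_fun setT (fun p : R * R => P p.1 &&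
  ((`|z| <= p.1) && ((0 <= p.2) && (p.2 < 2 * A * p.1)))) by mfun.
transitivity ((mu \x mu)%E [set p : R * R | P p.1 &&
  ((`|z| <= p.1) && ((0 <= p.2) && (p.2 < 2 * A * p.1)))]).
  rewrite /pushforward/= /mrestr.
  by congr (leb2 R _); apply/seteqP; split=> p /=; [move=> [-> ->]|move=> /andP[]].
rewrite (lebesgue_measure2 mQ); apply: eq_integral => r _.
case: ifPn => [/andP[Pr zr]|].
  rewrite -[RHS]layer_cake; last first.
    by rewrite mulr_ge0 ?(le_trans _ zr)// mulr_ge0// ltW// unit_disc_area_gt0.
  by apply: eq_integral => c _; rewrite /= Pr zr.
by move=> H; apply: integral0_eq => c _ /=; rewrite andbA (negbTE H).
Qed.

(** The half-lines r < a form a generating family stable under intersection, and both measures give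
    such a half-line the mass A (a^2 - z^2) if |z| < a and 0 otherwise: the area of a disc on one
    side, the integral of 2 A r on the other. *)
Let shell_cyl_measure z (B : set R) : measurable B ->
  pushforward (leb2 R) (shell z) B =
  pushforward (mrestr (leb2 R) (measurable_cyl z)) proj1 B.
Proof.
move=> mB.
pose M1 : {measure set R -> \bar R} := pushforward (leb2 R) (shell z).
pose M2 : {measure set R -> \bar R} := pushforward (mrestr (leb2 R) (measurable_cyl z)) proj1.
have mfst : measurable_fun setT proj1 by exact: measurable_fst.
have mlt (a : R) : measurable_fun setT (fun r : R => r < a) by mfun.
have M1E a : (M1 (measurable_shell z) `]-oo, a[%classic =
  (if `|z| < a then A * (a ^+ 2 - z ^+ 2) else 0)%:E)%E.
  rewrite set_itvNyo; apply: etrans; first exact: (shell_measureE z (mlt a)).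
  case: ifPn => za.
    have := discE (a ^+ 2 - z ^+ 2).
    have az : 0 < a ^+ 2 - z ^+ 2 by rewrite subr_gt0 -(real_normK
      (num_real z)) ltr_pXn2r// nnegrE// ltW// (le_lt_trans _ za).
    rewrite max_l ?ltW// => <-.
    apply: eq_integral => x _; apply: eq_integral => y _; congr (EFin (if _ then _ else _)).
    have a0 : 0 < a by exact: le_lt_trans za.
    by rewrite -[X in _ < X](ger0_norm (ltW a0)) -sqrtr_sqr ltr_sqrt ?exprn_gt0// ltrBrDr.
  apply: integral0_eq => x _; apply: integral0_eq => y _; rewrite ifF//.
  apply/negbTE; rewrite -leNgt; apply: le_trans (_ : `|z| <= _); first by rewrite leNgt.
  by rewrite -sqrtr_sqr ler_wsqrtr// lerDr addr_ge0// sqr_ge0.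
have M2E a : (M2 mfst `]-oo, a[%classic = (if `|z| < a then A * (a ^+ 2 - z ^+ 2) else 0)%:E)%E.
  rewrite set_itvNyo; apply: etrans; first exact: (cyl_measureE z (mlt a)).
  case: ifPn => za; last first.
    apply: integral0_eq => x _; rewrite ifF//; apply/negbTE.
    by apply: contra za => /andP[xa zx]; exact: le_lt_trans xa.
  transitivity (\int[mu]_r (if (`|z| <= r) && (r < a) then 2 * A * r else 0)%:E)%E.
    by apply: eq_integral => r _; rewrite andbC.
  rewrite integral_if_itvo; last by mfun.
  have cf : continuous (fun r : R => 2 * A * r).
    by move=> x; apply: cvgM; [exact: cvg_cst|exact: cvg_id].
  have dF (x : R) : is_derive x 1 (fun r : R => A * r ^+ 2) (2 * A * x).
    by apply: is_derive_eq; rewrite /GRing.scale/=; ring.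
  rewrite (integral_FTC (ltW za) cf dF).
  by rewrite real_normK ?num_real// mulrBr.
have -> : pushforward (leb2 R) (shell z) B = M1 (measurable_shell z) B by [].
have -> : pushforward (mrestr (leb2 R) (measurable_cyl z)) proj1 B = M2 mfst B by [].
apply: (measure_unique (@RGenInftyO.G R) (fun k => `]-oo, k%:R[%classic)) => //.
- exact: RGenInftyO.measurableE.
- move=> _ _ [a ->] [b ->]; exists (Num.min a b).
  by apply/seteqP; split=> x /=; rewrite !in_itv/= lt_min; [move=> [-> ->]|move=> /andP[]].
- by move=> k; exists k%:R.
- apply/seteqP; split=> // x _; exists (Num.truncn `|x|).+1 => //=.
  by rewrite in_itv/= (le_lt_trans (ler_norm x))// truncnS_gt.
- by move=> _ [a ->]; rewrite M1E M2E.
- by move=> k; rewrite M1E ltry.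
Qed.

(** By the layer-cake formula it is enough to treat indicators of the level sets of [Phi], where the
    identity is [shell_cyl_measure]. *)
Lemma ge0_integral_slice (z : R) (Phi : R -> R) :
  measurable_fun setT Phi -> (forall r, 0 <= Phi r) ->
  (\int[mu]_x \int[mu]_y (Phi (Num.sqrt (x ^+ 2 + y ^+ 2 + z ^+ 2)))%:E =
   \int[mu]_r (if `|z| <= r then 2 * A * r * Phi r else 0)%:E)%E.
Proof.
move=> mPhi Phi0.
pose P c r := (0 <= c) && (c < Phi r).
have mP c : measurable_fun setT (P c) by rewrite /P; mfun.
have PE c : (\int[mu]_x \int[mu]_y (if P c (Num.sqrt (x ^+ 2 + y ^+ 2 + z ^+ 2)) then 1 else 0)%:E =
    \int[mu]_r (if P c r && (`|z| <= r) then 2 * A * r else 0)%:E)%E.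
  rewrite -(shell_measureE z (mP c)) -(cyl_measureE z (mP c)) shell_cyl_measure//.
  by rewrite -[X in measurable X]setTI; exact: mP.
have mPf d (T : measurableType d) (f g : T -> R) : measurable_fun setT f -> measurable_fun setT g ->
    measurable_fun setT (fun x => P (f x) (g x)).
  by move=> mf mg; rewrite /P; mfun.
transitivity (\int[mu]_x \int[mu]_y \int[mu]_c
  (if P c (Num.sqrt (x ^+ 2 + y ^+ 2 + z ^+ 2)) then 1 else 0)%:E)%E.
  by apply: eq_integral => x _; apply: eq_integral => y _; rewrite layer_cake.
transitivity (\int[mu]_c \int[mu]_x \int[mu]_y
  (if P c (Num.sqrt (x ^+ 2 + y ^+ 2 + z ^+ 2)) then 1 else 0)%:E)%E.
  rewrite [RHS]tonelli; last 2 first.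
  - apply: (measurable_fun_ge0_integral
      (f := fun (p : R * R) y => (if P p.1 (Num.sqrt (p.2 ^+ 2 + y ^+ 2 + z ^+ 2)) then 1
        else 0)%:E)) => //.
    by mfun; apply: mPf; mfun.
  - by move=> c x; exact: integral_ge0.
  apply: eq_integral => x _; apply: tonelli => //.
  by mfun; apply: mPf; mfun.
under eq_integral do rewrite PE.
have c0 r : `|z| <= r -> 0 <= 2 * A * r.
  by move=> zr; rewrite mulr_ge0 ?(le_trans _ zr)// mulr_ge0// ltW// unit_disc_area_gt0.
rewrite tonelli; last 2 first.
- by mfun; apply: mPf; mfun.
- by move=> c r; rewrite lee_fin; case: ifP => // /andP[_ /c0].
apply: eq_integral => r _; case: ifPn => zr.
  rewrite [in RHS]EFinM -[X in (_ * X)%E]layer_cake// -ge0_integral_cstM//; last 2 first.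
  - exact: c0.
  - by mfun; apply: (@mPf _ R); mfun.
  apply: eq_integral => c _; rewrite andbT -/(P c r); case: ifP; by rewrite ?mule1 ?mule0.
by apply: integral0_eq => c _; rewrite andbF.
Qed.

Lemma polar2 (p q : R) : exists a b, [/\ a ^+ 2 + b ^+ 2 = 1,
  p = Num.sqrt (p ^+ 2 + q ^+ 2) * a & q = Num.sqrt (p ^+ 2 + q ^+ 2) * b].
Proof.
have [pq0|pq0] := eqVneq (p ^+ 2 + q ^+ 2) 0.
  by exists 1, 0; rewrite pq0 sqrtr0 !mul0r; split; nra.
have pq : 0 < p ^+ 2 + q ^+ 2 by rewrite lt_neqAle eq_sym pq0 addr_ge0 ?sqr_ge0.
set k := Num.sqrt _.
have k0 : k != 0 by rewrite gt_eqF// sqrtr_gt0.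
have kk : k ^+ 2 = p ^+ 2 + q ^+ 2 by rewrite sqr_sqrtr// ltW.
exists (p / k), (q / k); split; [|by field|by field].
by rewrite !expr_div_n -mulrDl -kk divff// expf_eq0.
Qed.

(** Two planar rotations bring [xi] to the first axis, after which the integrand depends on |x| and
    the first coordinate only. The resulting density 2 A r does not depend on the height [z]: this
    is the uniform distribution of a coordinate on the sphere. *)
Lemma ge0_integral_plane_wave (xi : R * R * R) (Phi : R -> R -> R) :
  measurable_fun setT (fun z : R * R => Phi z.1 z.2) ->
  (forall r s, 0 <= Phi r s) ->
  (\int[leb3 R]_x (Phi (enorm x) (dot x xi))%:E =
   \int[mu]_r \int[mu]_z (if `|z| <= r then 2 * A * r * Phi r (enorm xi * z)%R else 0)%:E)%E.
Proof.
move=> mPhi Phi0; case: xi => -[x1 x2] x3.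
have mPf d (T : measurableType d) (f g : T -> R) : measurable_fun setT f -> measurable_fun setT g ->
    measurable_fun setT (fun x => Phi (f x) (g x)).
  by move=> mf mg; apply: (measurableT_comp mPhi (g := fun z => (f z, g z)));
    exact: measurable_fun_pair.
have Phi0e r s : (0 <= (Phi r s)%:E)%E by rewrite lee_fin.
rewrite ge0_integral_leb3; last 2 first.
- by rewrite /enorm /dot; mfun; apply: mPf; mfun.
- by move=> x; exact: Phi0e.
rewrite /enorm /dot/=.
(* First rotation, in the plane of [y] and [z]: it removes the third component of [xi] and turns the
   second into k'. *)
have [a [b [ab ax bx]]] := polar2 x2 x3; set k' := Num.sqrt _ in ax bx.
transitivity (\int[mu]_x \int[mu]_y \int[mu]_z
  (Phi (Num.sqrt (x ^+ 2 + y ^+ 2 + z ^+ 2)) (x * x1 + y * k'))%:E)%E.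
  apply: eq_integral => x _.
  have abN : a ^+ 2 + (- b) ^+ 2 = 1 by rewrite sqrrN.
  rewrite -(ge0_integral_rotation (Phi := fun y z => Phi (Num.sqrt (x ^+ 2 + y ^+ 2 + z ^+ 2))
    (x * x1 + y * k')) abN); last 2 first.
  - by apply: mPf; mfun.
  - by move=> *; exact: Phi0.
  apply: eq_integral => y _; apply: eq_integral => z _; congr (Phi (Num.sqrt _) _)%:E.
    transitivity (x ^+ 2 + (a ^+ 2 + b ^+ 2) * y ^+ 2 + (a ^+ 2 + b ^+ 2) * z ^+ 2); last by ring.
    by rewrite ab; ring.
  by rewrite ax bx; ring.
have [c [d [cd cx dx]]] := polar2 x1 k'; set k := Num.sqrt _ in cx dx.
have kE : Num.sqrt (x1 * x1 + x2 * x2 + x3 * x3) = k.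
  by rewrite /k sqr_sqrtr ?addr_ge0 ?sqr_ge0//; congr Num.sqrt; ring.
have mI (w1 w2 : R) : measurable_fun setT
  (fun p : R * R => \int[mu]_y (Phi (Num.sqrt (p.2 ^+ 2 + y ^+ 2 + p.1 ^+ 2))
    (p.2 * w1 + y * w2))%:E)%E.
  apply: (measurable_fun_ge0_integral
    (f := fun (p : R * R) y => (Phi (Num.sqrt (p.2 ^+ 2 + y ^+ 2 + p.1 ^+ 2))
      (p.2 * w1 + y * w2))%:E)) => //.
  by mfun; apply: mPf; mfun.
have swap (w1 w2 : R) : (\int[mu]_x \int[mu]_y \int[mu]_z
  (Phi (Num.sqrt (x ^+ 2 + y ^+ 2 + z ^+ 2)) (x * w1 + y * w2))%:E =
   \int[mu]_z \int[mu]_x \int[mu]_y (Phi (Num.sqrt (x ^+ 2 + y ^+ 2 + z ^+ 2))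
     (x * w1 + y * w2))%:E)%E.
  rewrite [RHS]tonelli; last 2 first.
  - exact: mI.
  - by move=> z x; exact: integral_ge0.
  apply: eq_integral => x _; apply: tonelli => //.
  by mfun; apply: mPf; mfun.
(* A rotation acts on the two innermost integrals, so [z] is moved outside for the rotation in the
   plane of [x] and [y], and moved back inside after it. *)
rewrite swap.
transitivity (\int[mu]_z \int[mu]_x \int[mu]_y
  (Phi (Num.sqrt (x ^+ 2 + y ^+ 2 + z ^+ 2)) (x * k + y * 0))%:E)%E.
  apply: eq_integral => z _.
  have cdN : c ^+ 2 + (- d) ^+ 2 = 1 by rewrite sqrrN.
  rewrite -(ge0_integral_rotation (Phi := fun x y => Phi (Num.sqrt (x ^+ 2 + y ^+ 2 + z ^+ 2))
    (x * k + y * 0)) cdN); last 2 first.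
  - by apply: mPf; mfun.
  - by move=> *; exact: Phi0.
  apply: eq_integral => x _; apply: eq_integral => y _; congr (Phi (Num.sqrt _) _)%:E.
    transitivity ((c ^+ 2 + d ^+ 2) * x ^+ 2 + (c ^+ 2 + d ^+ 2) * y ^+ 2 + z ^+ 2); last by ring.
    by rewrite cd; ring.
  by rewrite {1}cx {1}dx; ring.
rewrite -swap kE.
have A0 := ltW unit_disc_area_gt0.
transitivity (\int[mu]_x \int[mu]_r (if `|x| <= r then 2 * A * r * Phi r (k * x)%R else 0)%:E)%E.
  apply: eq_integral => x _.
  rewrite -(ge0_integral_slice x (Phi := fun r => Phi r (k * x))); last 2 first.
  - by apply: mPf; mfun.
  - by move=> *; exact: Phi0.
  apply: eq_integral => y _; apply: eq_integral => z _; congr (Phi (Num.sqrt _) _)%:E; ring.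
apply: tonelli.
- by mfun; apply: mPf; mfun.
- move=> z r; rewrite lee_fin; case: ifP => // zr.
  by rewrite !mulr_ge0// (le_trans _ zr).
Qed.

End planar.

(** * Bounded supports and Fubini with a bounded kernel *)

Section integration.
Context (R : realType).
Notation mu := (@lebesgue_measure R).

Lemma EFin_Rintegral d (T : measurableType d) (m : {measure set T -> \bar R})
    (D : set T) (f : T -> R) : measurable D -> m.-integrable D (EFin \o f) ->
  (\int[m]_(x in D) (f x)%:E = (\int[m]_(x in D) f x)%:E)%E.
Proof. by move=> mD fi; rewrite /Rintegral fineK//; exact: integrable_fin_num. Qed.

Lemma integral_if_cst (a b c : R) : a <= b ->
  (\int[mu]_x (if (a <= x) && (x <= b) then c else 0)%:E = (c * (b - a))%:E)%E.
Proof.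
move=> ab; rewrite integral_if_itv integral_cst//= lebesgue_measure_itv/= lte_fin.
case: ltP => [_|ba]; first by rewrite -EFinD -EFinM.
have -> : b - a = 0 by lra.
by rewrite mule0 mulr0.
Qed.

Lemma integral_if_le (c d : R) (P : R -> bool) (ell : R) : 0 <= c ->
  measurable_fun setT P -> (forall x, P x -> (d <= x) && (x <= d + ell)) ->
  (\int[mu]_x (if P x then c else 0)%:E <= (c * Num.max ell 0)%:E)%E.
Proof.
move=> c0 mP Pd; have [l0|l0] := leP 0 ell; last first.
  rewrite mulr0 integral0_eq// => x _; case: ifPn => // /Pd/andP[? ?]; exfalso; lra.
have -> : (c * ell)%:E = (\int[mu]_x (if ((d <= x) && (x <= d + ell)) then c else 0)%:E)%E.
  rewrite integral_if_cst; last lra.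
  by congr EFin; ring.
apply: ge0_le_integral => //; [|mfun|mfun|].
- by move=> x _; rewrite lee_fin; case: ifP.
- move=> x _; rewrite lee_fin; case: ifPn => [/Pd ->//|_]; by case: ifP.
Qed.

Lemma integrable_bounded_support (a b M : R) (f : R -> R) :
  measurable_fun setT f -> (forall x, `|f x| <= M) ->
  (forall x, ~~ ((a <= x) && (x <= b)) -> f x = 0) ->
  mu.-integrable setT (EFin \o f).
Proof.
move=> mf fM f0; apply/integrableP; split; first exact/measurable_EFinP.
have M0 : 0 <= M by apply: le_trans (fM 0).
apply: (@le_lt_trans _ _ (M * Num.max (b - a) 0)%:E); last by rewrite ltry.
apply: le_trans (integral_if_le (P := fun x => (a <= x) && (x <= b)) (d := a)
  (ell := b - a) M0 _ _).
- apply: ge0_le_integral => //.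
  + by apply: measurableT_comp => //; exact/measurable_EFinP.
  + by mfun.
  + move=> x _; rewrite /= lee_fin; case: ifPn => // /f0 ->; by rewrite normr0.
- by mfun.
- by move=> x; rewrite addrC subrK.
Qed.

(** With [k] the cosine or sine of x . xi, this transfers the Fourier transform from one factor to
    the other. The integrand on the product is dominated by M |f| |g|. *)
Lemma Rintegral_Fubini d1 d2 (T1 : measurableType d1) (T2 : measurableType d2)
    (m1 : {sigma_finite_measure set T1 -> \bar R})
    (m2 : {sigma_finite_measure set T2 -> \bar R})
    (f : T1 -> R) (g : T2 -> R) (k : T1 * T2 -> R) (M : R) :
  m1.-integrable setT (EFin \o f) -> m2.-integrable setT (EFin \o g) ->
  measurable_fun setT k -> (forall z, `|k z| <= M) ->
  \int[m1]_x (f x * \int[m2]_y (k (x, y) * g y)) =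
  \int[m2]_y (g y * \int[m1]_x (k (x, y) * f x)).
Proof.
move=> fi gi mk kM.
have mf : measurable_fun setT f by apply/measurable_EFinP; exact: measurable_int fi.
have mg : measurable_fun setT g by apply/measurable_EFinP; exact: measurable_int gi.
have M0 : 0 <= M by apply: le_trans (kM point).
have ki1 x : m2.-integrable setT (EFin \o (fun y => k (x, y) * g y)).
  apply: (@le_integrable _ _ _ _ _ _ _ (fun y => (M * `|g y|)%:E)) => //.
  - apply/measurable_EFinP; apply: measurable_funM => //.
    exact: (measurableT_comp mk).
  - by move=> y _; rewrite /= !lee_fin !normrM normr_id (ger0_norm M0) ler_wpM2r.
  - have := @integrableZl _ _ _ m2 setT measurableT M _ (integrable_norm gi).
    by apply: eq_integrable => // y _; rewrite /= EFinM.
have ki2 y : m1.-integrable setT (EFin \o (fun x => k (x, y) * f x)).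
  apply: (@le_integrable _ _ _ _ _ _ _ (fun x => (M * `|f x|)%:E)) => //.
  - apply/measurable_EFinP; apply: measurable_funM => //.
    exact: (measurableT_comp mk).
  - by move=> x _; rewrite /= !lee_fin !normrM normr_id (ger0_norm M0) ler_wpM2r.
  - have := @integrableZl _ _ _ m1 setT measurableT M _ (integrable_norm fi).
    by apply: eq_integrable => // x _; rewrite /= EFinM.
pose F (z : T1 * T2) : \bar R := (f z.1 * (k z * g z.2))%:E.
have mF : measurable_fun setT F.
  apply/measurable_EFinP; apply: measurable_funM.
    exact: (measurableT_comp mf measurable_fst).
  by apply: measurable_funM => //; exact: (measurableT_comp mg measurable_snd).
have Fi : (m1 \x m2)%E.-integrable setT F.
  apply/(integrable12ltyP m1 m2 mF).
  have gfin : (\int[m2]_y `|(g y)%:E| \is a fin_num)%E.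
    rewrite ge0_fin_numE ?integral_ge0//.
    by have /integrableP[] := gi.
  apply: (@le_lt_trans _ _ (\int[m1]_x (M * `|f x| * fine (\int[m2]_y `|(g y)%:E|))%:E))%E.
    apply: ge0_le_integral => //.
    + by move=> x _; exact: integral_ge0.
    + apply: (@measurable_fun_fubini_tonelli_F _ _ _ _ _ m2 (fun z => `|F z|%E)) => //.
      exact: measurableT_comp.
    + by mfun.
    + move=> x _; rewrite EFinM fineK// -ge0_integralZl_EFin//; last 2 first.
      * by apply: measurableT_comp => //; exact/measurable_EFinP.
      * by rewrite mulr_ge0.
      apply: ge0_le_integral => //.
      * apply: measurableT_comp => //; apply/measurable_EFinP.
        apply: (@measurable_funM _ _ _ _ (fun=> f x)) => //=.
        by apply: (@measurable_funM _ _ _ _ (fun y => k (x, y))) => //;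
          exact: (measurableT_comp mk).
      * apply: emeasurable_funM => //.
        by apply: measurableT_comp => //; exact/measurable_EFinP.
      * move=> y _; rewrite /F/= -EFinM lee_fin !normrM.
        by rewrite mulrA ler_wpM2r// mulrC ler_wpM2r.
  under eq_integral do rewrite EFinM.
  rewrite ge0_integralZr//; last 3 first.
  - by mfun.
  - by move=> x _; rewrite lee_fin mulr_ge0.
  - by rewrite fineK// integral_ge0.
  rewrite fineK//.
  have fi' : (\int[m1]_x (M * `|f x|)%:E < +oo)%E.
    under eq_integral do rewrite EFinM.
    rewrite ge0_integralZl_EFin//; last by mfun.
    have /integrableP[_ fi''] := fi.
    by rewrite lte_mul_pinfty.
  rewrite lte_mul_pinfty//.
  - by apply: integral_ge0 => x _; rewrite lee_fin mulr_ge0.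
  - rewrite ge0_fin_numE//.
    by apply: integral_ge0 => x _; rewrite lee_fin mulr_ge0.
  - by rewrite -ge0_fin_numE// integral_ge0.
have := Fubini Fi.
rewrite /Rintegral => E; congr fine.
transitivity (\int[m1]_x \int[m2]_y F (x, y))%E.
  apply: eq_integral => x _.
  rewrite /F/= EFinM fineK; last exact: integrable_fin_num (ki1 x).
  rewrite -integralZl//; exact: ki1.
rewrite E; apply: eq_integral => y _.
rewrite EFinM fineK; last exact: integrable_fin_num (ki2 y).
rewrite -integralZl//; last exact: ki2.
by apply: eq_integral => x _; rewrite /F/= -EFinM; congr EFin; ring.
Qed.

End integration.

(** * Plane waves against radial functions *)

Section radial_fourier.
Context (R : realType).
Notation mu := (@lebesgue_measure R).
Notation A := (@unit_disc_area R).
Implicit Type F : R -> R.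

Lemma enorm_ge0 (x : R * R * R) : 0 <= enorm x.
Proof. exact: sqrtr_ge0. Qed.

Lemma measurable_enorm : measurable_fun setT (@enorm R).
Proof. by rewrite /enorm /dot; mfun. Qed.

Lemma measurable_dot : measurable_fun setT (fun z : (R * R * R) * (R * R * R) => dot z.1 z.2).
Proof. by rewrite /dot; mfun. Qed.

Definition radially_integrable F := measurable_fun setT F /\
  mu.-integrable setT (fun r => (if 0 <= r then r ^+ 2 * F r else 0)%:E).

Let A_ge0 : 0 <= A. Proof. exact/ltW/unit_disc_area_gt0. Qed.

Let integral_ball (c r : R) :
  (\int[mu]_z (if `|z| <= r then c else 0)%:E = (if 0 <= r then 2 * r * c else 0)%:E)%E.
Proof.
case: ifPn => [r0|]; last first.
  rewrite -ltNge => r0; apply: integral0_eq => z _.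
  by rewrite ifF//; apply/negbTE; rewrite -ltNge (lt_le_trans r0).
under eq_integral do rewrite ler_norml.
by rewrite integral_if_cst; [congr EFin; ring|lra].
Qed.

(** The plane-wave formula at xi = 0: the inner integral is the length 2 r of [- r, r]. *)
Lemma ge0_integral_radial F : measurable_fun setT F -> (forall r, 0 <= F r) ->
  (\int[leb3 R]_x (F (enorm x))%:E =
   \int[mu]_r (if 0 <= r then 4 * A * (r ^+ 2 * F r) else 0)%:E)%E.
Proof.
move=> mF F0.
rewrite (@ge0_integral_plane_wave R (0, 0, 0) (fun r _ => F r))//; last by mfun.
apply: eq_integral => r _; rewrite integral_ball.
by case: ifP => // r0; congr EFin; ring.
Qed.

Lemma radial_integrable F : radially_integrable F ->
  (leb3 R).-integrable setT (EFin \o (F \o @enorm R)).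
Proof.
move=> [mF Fi]; apply/integrableP; split.
  by apply/measurable_EFinP; apply: (measurableT_comp mF); exact: measurable_enorm.
have /= -> := @ge0_integral_radial (fun r => `|F r|) _ _ => //; last by mfun.
have /integrableP[_ {}Fi] := Fi.
have -> : (\int[mu]_r (if 0 <= r then 4 * A * (r ^+ 2 * `|F r|) else 0)%:E =
   (4 * A)%:E * \int[mu]_r `|(if 0 <= r then r ^+ 2 * F r else 0)%:E|)%E.
  rewrite -ge0_integralZl_EFin//; last 2 first.
  - by mfun.
  - by rewrite mulr_ge0.
  apply: eq_integral => r _; rewrite -EFinM; case: ifP => r0; rewrite ?normr0 ?mulr0//.
  by rewrite normrM ger0_norm// sqr_ge0.
by rewrite lte_mul_pinfty// lee_fin mulr_ge0.
Qed.

Let integrable_ball (c : R -> R) (r : R) : measurable_fun setT c ->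
  (forall z, `|c z| <= 1) ->
  mu.-integrable setT (EFin \o (fun z => if `|z| <= r then c z else 0)).
Proof.
move=> mc c1; apply: (@integrable_bounded_support R (- r) r 1) => //.
- by mfun.
- by move=> z; case: ifP => // _; rewrite normr0.
- by move=> z; rewrite -ler_norml => /negbTE ->.
Qed.

Let ball_le (c : R -> R) (r : R) : 0 <= r -> measurable_fun setT c ->
  (forall z, `|c z| <= 1) -> `|\int[mu]_z (if `|z| <= r then c z else 0)| <= 2 * r.
Proof.
move=> r0 mc c1.
apply: le_trans (le_normr_Rintegral _ (integrable_ball r mc c1)) _ => //.
rewrite -lee_fin -EFin_Rintegral//; last first.
  exact: (integrable_norm (integrable_ball r mc c1)).
have := integral_ball 1 r; rewrite r0 mulr1 => <-.
apply: ge0_le_integral => //.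
- by mfun.
- by mfun.
- by move=> z _; rewrite /= lee_fin; case: ifP => // _; rewrite normr0.
Qed.

(** The formula is known for nonnegative integrands. Since |c| <= 1, c F + |F| is nonnegative; the
    formula is applied to this sum, and the contribution of |F|, which is computed separately, is
    subtracted. *)
Lemma Rintegral_plane_wave F (c : R -> R) (xi : R * R * R) :
  radially_integrable F -> measurable_fun setT c -> (forall z, `|c z| <= 1) ->
  \int[leb3 R]_x (c (dot x xi) * F (enorm x)) =
  \int[mu]_r (if 0 <= r then 2 * A * r * F r *
     \int[mu]_z (if `|z| <= r then c (enorm xi * z) else 0) else 0).
Proof.
move=> Fr mc c1; have [mF Fi] := Fr; have Fi3 := radial_integrable Fr.
set k := enorm xi; pose ck z := c (k * z).
have mck : measurable_fun setT ck by rewrite /ck; mfun.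
have ck1 z : `|ck z| <= 1 by exact: c1.
pose S r := \int[mu]_z (if `|z| <= r then ck z else 0).
have mS : measurable_fun setT S by apply: measurable_fun_Rintegral; mfun.
have mcd : measurable_fun setT (fun x : R * R * R => c (dot x xi)).
  by apply: (measurableT_comp mc); rewrite /dot; mfun.
have mFe : measurable_fun setT (fun x : R * R * R => F (enorm x)).
  by apply: (measurableT_comp mF); exact: measurable_enorm.
have cFi : (leb3 R).-integrable setT (EFin \o (fun x => c (dot x xi) * F (enorm x))).
  apply: le_integrable Fi3 => //.
    by apply/measurable_EFinP; exact: measurable_funM.
  by move=> x _; rewrite /= lee_fin normrM ler_piMl.
have Ni3 := integrable_norm Fi3.
pose G1 r := if 0 <= r then 2 * A * r * F r * S r else 0.
pose G2 r := if 0 <= r then 4 * A * (r ^+ 2 * `|F r|) else 0.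
have G2i : mu.-integrable setT (EFin \o G2).
  have H := @integrableZl _ _ _ mu setT measurableT (4 * A) _ (integrable_norm Fi).
  apply: eq_integrable H => // r _; rewrite /G2/= -EFinM; case: ifP => r0;
    last by rewrite normr0 mulr0.
  by rewrite normrM (ger0_norm (sqr_ge0 r)).
have mG1 : measurable_fun setT G1 by rewrite /G1; mfun.
have G1i : mu.-integrable setT (EFin \o G1).
  apply: le_integrable G2i => //; first exact/measurable_EFinP.
  move=> r _; rewrite /G1 /G2/= lee_fin; case: ifPn => // r0.
  rewrite [leRHS]ger0_norm ?mulr_ge0 ?sqr_ge0// !normrM !(ger0_norm r0)
    (ger0_norm A_ge0) ger0_norm//.
  apply: le_trans (ler_wpM2l _ (ball_le r0 mck ck1)) _; first by rewrite !mulr_ge0.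
  by rewrite le_eqVlt; apply/orP; left; apply/eqP; ring.
have E : (\int[leb3 R]_x (c (dot x xi) * F (enorm x) + `|F (enorm x)|)%:E =
    \int[mu]_r (G1 r + G2 r)%:E)%E.
  rewrite (@ge0_integral_plane_wave R xi (fun r s => c s * F r + `|F r|)); last 2 first.
  - by mfun.
  - move=> r s; have := ler_norm (- (c s * F r)); rewrite normrN normrM.
    have : `|c s| * `|F r| <= `|F r| by rewrite ler_piMl.
    lra.
  apply: eq_integral => r _; rewrite /G1 /G2; case: ifPn => r0; last first.
    rewrite addr0; apply: integral0_eq => z _; rewrite ifF//; apply/negbTE.
    by rewrite -ltNge (lt_le_trans _ (normr_ge0 z))// ltNge.
  pose g (z : R) := if `|z| <= r then ck z else 0.
  pose o (z : R) : R := if `|z| <= r then 1 else 0.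
  have gi : mu.-integrable setT (EFin \o g) by exact: integrable_ball.
  have oi : mu.-integrable setT (EFin \o o)
    by apply: (@integrable_ball (cst 1)) => // z; rewrite normr1.
  transitivity (\int[mu]_z ((2 * A * r * F r * g z)%:E + (2 * A * r * `|F r| * o z)%:E))%E.
    apply: eq_integral => z _; rewrite -EFinD /g /o /ck; case: ifP => _;
      last by rewrite !mulr0 addr0.
    by congr EFin; ring.
  have ai := @integrableZl _ _ _ mu setT measurableT (2 * A * r * F r) _ gi.
  have bi := @integrableZl _ _ _ mu setT measurableT (2 * A * r * `|F r|) _ oi.
  rewrite (integralD measurableT ai bi) !integralZl// (EFin_Rintegral measurableT gi).
  rewrite -[X in (_ + _ * X)%E]/(\int[mu]_z (if `|z| <= r then 1 else 0)%:E)%E.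
  rewrite integral_ball r0 -!EFinM -EFinD; congr EFin.
  by rewrite -/(S r); ring.
have := EFin_Rintegral measurableT (integrableD measurableT cFi Ni3).
have := EFin_Rintegral measurableT (integrableD measurableT G1i G2i).
rewrite /= => E2 E1.
have : \int[leb3 R]_x (c (dot x xi) * F (enorm x) + `|F (enorm x)|) = \int[mu]_r (G1 r + G2 r).
  by apply: EFin_inj; rewrite -E1 -E2.
rewrite RintegralD// RintegralD//.
have -> : \int[leb3 R]_x `|F (enorm x)| = \int[mu]_r G2 r.
  rewrite /Rintegral (@ge0_integral_radial (fun r => `|F r|))//; by mfun.
by move/addIr => ->.
Qed.

End radial_fourier.

(** * Fourier multipliers on radial functions *)

Section weight.
Context (R : realType).
Notation mu := (@lebesgue_measure R).

(** A rational substitute for the inverse Japanese bracket, equivalent to it up to a factor 2. Its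
    square integrates to exactly 1 over the half-line, which keeps the later constants simple. *)
Definition weight (r : R) : R := (1 + `|r|)^-1.

Lemma weight_gt0 r : 0 < weight r.
Proof. by rewrite invr_gt0 ltr_pwDl. Qed.

Lemma weight_le1 r : weight r <= 1.
Proof. by rewrite invf_le1 ?ltr_pwDl// lerDl. Qed.

Lemma measurable_weight : measurable_fun setT weight.
Proof. by rewrite /weight; mfun. Qed.

Lemma integral_weight2 :
  (\int[mu]_s (if 0 <= s then weight s ^+ 2 else 0)%:E = 1)%E.
Proof.
have p1 (x : R) : 0 <= x -> 1 + x != 0 by move=> x0; rewrite gt_eqF// ltr_pwDl.
transitivity (\int[mu]_(s in `[0%R, +oo[) ((1 + s)^-1 * (1 + s)^-1)%:E)%E.
  rewrite [RHS]integral_mkcond/=; apply: eq_integral => x _.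
  rewrite /patch/= mem_setE in_itv/= andbT; case: ifP => // x0.
  by rewrite /weight ger0_norm// expr2.
have dF (x : R) : 0 <= x -> is_derive x 1 (fun s : R => - (1 + s)^-1) ((1 + x)^-1 * (1 + x)^-1).
  move=> x0; have xn := p1 _ x0.
  apply: is_derive_eq; rewrite /GRing.scale/= add0r mulr1 opprK.
  by rewrite expr2 invfM.
rewrite (@ge0_continuous_FTC2y _ _ (fun s => - (1 + s)^-1) 0 0).
- by rewrite addr0 invr1 sub0e EFinN oppeK.
- by move=> x x0; rewrite mulr_ge0 ?invr_ge0 ?addr_ge0.
- apply: continuous_in_subspaceT => x; rewrite inE/= in_itv/= andbT => x0.
  have cV : {for x, continuous (fun s : R => (1 + s)^-1)}.
    apply: continuousV; first exact: p1.
    by apply: cvgD; [exact: cvg_cst|exact: cvg_id].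
  exact: (continuousM cV cV).
- rewrite -[X in _ --> X]oppr0; apply: cvgN.
  apply/cvgrPdist_lt => e e0; near=> x.
  have x0 : 0 < x by near: x; exact: nbhs_pinfty_gt.
  rewrite sub0r normrN ger0_norm; last by rewrite invr_ge0 addr_ge0// ltW.
  rewrite invf_plt ?posrE ?addr_gt0//.
  have : e^-1 < x by near: x; apply: nbhs_pinfty_gt; rewrite num_real.
  lra.
- by move=> x x0; have [] := dF x (ltW x0).
- apply: cvg_at_right_filter; apply: cvgN; apply: cvgV; first by rewrite addr0 oner_eq0.
  by apply: cvgD; [exact: cvg_cst|exact: cvg_id].
- move=> x; rewrite in_itv/= andbT => x0; rewrite derive1E.
  by have H := dF x (ltW x0); apply: derive_val.
Unshelve. all: end_near. Qed.

Lemma integral_cst_weight2 (c : R) : 0 <= c ->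
  (\int[mu]_s (c%:E * (if (0 <= s)%R then weight s ^+ 2 else 0)%:E) = c%:E)%E.
Proof.
move=> c0; have mw := measurable_weight; rewrite ge0_integral_cstM ?integral_weight2 ?mule1//.
  by mfun.
by move=> s; rewrite lee_fin; case: ifP => // _; rewrite sqr_ge0.
Qed.

Lemma integral_weight2T : (\int[mu]_s (weight s ^+ 2)%:E < +oo)%E.
Proof.
have mw := measurable_weight.
pose f (s : R) := (if 0 <= s then weight s ^+ 2 else 0)%:E.
have f0 s : (0 <= f s)%E by rewrite lee_fin; case: ifP => // _; rewrite sqr_ge0.
have mf : measurable_fun setT f by rewrite /f; mfun.
have E : (\int[mu]_s f (-1 * s + 0)%R = 1)%E.
  rewrite ge0_integral_affine ?oppr_eq0 ?oner_eq0//.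
  by rewrite normrN1 invr1 mul1e integral_weight2.
apply: (@le_lt_trans _ _ (\int[mu]_s (f s + f (-1 * s + 0)%R))%E).
  apply: ge0_le_integral => //.
  - by move=> s _; rewrite lee_fin sqr_ge0.
  - by mfun.
  - apply: emeasurable_funD => //; apply: (measurableT_comp mf); mfun.
  - move=> s _; rewrite /f -EFinD lee_fin addr0 mulN1r oppr_ge0.
    rewrite [weight (- s)]/weight normrN -/(weight s).
    case: (leP 0 s) => [s0|s0]; last by rewrite add0r ifT// ltW.
    by rewrite lerDl; case: ifP => // _; rewrite sqr_ge0.
rewrite ge0_integralD//; last by apply: (measurableT_comp mf); mfun.
by rewrite E integral_weight2 -EFinD ltry.
Qed.

End weight.

Section schwartz_integrable.
Context (R : realType).
Notation mu := (@lebesgue_measure R).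

(** The sigma-algebra is the product one, so [measurable_fun_caratheodory] is applied one coordinate
    at a time. *)
Lemma continuous_measurable_fun3 (phi : R * R * R -> R) :
  continuous phi -> measurable_fun setT phi.
Proof.
move=> cphi.
have cp (h : R -> R * R * R) : continuous h -> continuous (fun y => phi (h y)).
  by move=> ch x; apply: continuous_comp; [exact: ch|exact: cphi].
have cpair (T U V : topologicalType) (g1 : T -> U) (g2 : T -> V) :
    continuous g1 -> continuous g2 -> continuous (fun y => (g1 y, g2 y)).
  by move=> c1 c2 x; apply: cvg_pair; [exact: c1|exact: c2].
have cid : continuous (fun y : R => y) by move=> y; exact: cvg_id.
have ccst (U : topologicalType) (u : U) : continuous (fun _ : R => u).
  exact: cst_continuous.
apply: (@measurable_fun_caratheodory _ (measurableTypeR R * measurableTypeR R)%type) => [z|[x y]];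
  last first.
  by apply: cp; apply: (cpair); [exact: ccst|exact: cid].
apply: (@measurable_fun_caratheodory _ (measurableTypeR R) R (fun t => phi (t, z))) => [y|x].
  apply: continuous_measurable_fun; apply: cp.
  by apply: (cpair); [apply: (cpair); [exact: cid|exact: ccst]|exact: ccst].
by apply: cp; apply: (cpair); [apply: (cpair); [exact: ccst|exact: cid]|exact: ccst].
Qed.

Lemma schwartz_integrable (phi : R * R * R -> R) : schwartz phi ->
  (leb3 R).-integrable setT (EFin \o phi).
Proof.
move=> /(_ [::])[/= cphi _ /(_ 6%N)[C phiC]].
have mphi := continuous_measurable_fun3 cphi.
have mw := @measurable_weight R.
apply/integrableP; split; first exact/measurable_EFinP.
pose w (x : R * R * R) := weight x.1.1 ^+ 2 * (weight x.1.2 ^+ 2 * weight x.2 ^+ 2).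
have C0 : 0 <= C by apply: le_trans (phiC 0); rewrite mulr_ge0// exprn_ge0// sqrtr_ge0.
(* The sixth power of the bracket is (1 + |x|^2)^3. Each (1 + |a|)^2 is at most 2 (1 + a^2), and
   each 1 + a^2 at most 1 + |x|^2; the three coordinates together give the factor 8. *)
have phiw x : `|phi x| <= 8 * C * w x.
  have := phiC x; rewrite (_ : japanese x ^+ 6 = (1 + dot x x) ^+ 3); last first.
    have d0 : 0 <= dot x x by rewrite /dot -!expr2 !addr_ge0 ?sqr_ge0.
    by rewrite (exprM _ 2 3) /japanese sqr_sqrtr ?addr_ge0 ?sqr_ge0// /enorm sqr_sqrtr.
  case: x => -[x y] z; rewrite /dot /w/= => H.
  have key (a : R) : (1 + `|a|) ^+ 2 <= 2 * (1 + a * a).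
    rewrite -expr2 -(real_normK (num_real a)).
    by have := sqr_ge0 (1 - `|a|); nra.
  have P (a : R) : 0 < (1 + `|a|) ^+ 2 by rewrite exprn_gt0// ltr_pwDl.
  rewrite /weight !exprVn -!invfM ler_pdivlMr ?mulr_gt0//.
  apply: le_trans (_ : `|phi (x, y, z)| * (8 * (1 + (x * x + y * y + z * z)) ^+ 3) <= _);
    last by lra.
  apply: ler_wpM2l => //.
  apply: le_trans (_ : (2 * (1 + x * x)) * ((2 * (1 + y * y)) * (2 * (1 + z * z))) <= _).
    apply: ler_pM; [exact/ltW|by apply: mulr_ge0; exact/ltW|exact: key|].
    by apply: ler_pM; [exact/ltW|exact/ltW|exact: key|exact: key].
  have x2 := sqr_ge0 x; have y2 := sqr_ge0 y; have z2 := sqr_ge0 z.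
  rewrite -!expr2; set a := x ^+ 2 in x2 *; set b := y ^+ 2 in y2 *; set c := z ^+ 2 in z2 *.
  rewrite (_ : 2 * (1 + a) * (2 * (1 + b) * (2 * (1 + c))) = 8 * ((1 + a) * ((1 + b) * (1 + c))));
    last by ring.
  rewrite ler_pM2l// exprS expr2.
  by do 2?[apply: ler_pM; rewrite ?mulr_ge0 ?addr_ge0//]; lra.
pose W := fine (\int[mu]_s (weight s ^+ 2)%:E).
have W0 : 0 <= W by rewrite fine_ge0// integral_ge0// => s _; rewrite lee_fin sqr_ge0.
have WE : (\int[mu]_s (weight s ^+ 2)%:E = W%:E)%E.
  rewrite fineK// ge0_fin_numE ?integral_weight2T// integral_ge0// => s _.
  by rewrite lee_fin sqr_ge0.
have WM (c : R) : 0 <= c -> (\int[mu]_s (c * weight s ^+ 2)%:E = (c * W)%:E)%E.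
  move=> c0; under eq_integral do rewrite EFinM.
  rewrite ge0_integral_cstM ?WE//; first by mfun.
  by move=> s; rewrite lee_fin sqr_ge0.
apply: (@le_lt_trans _ _ (\int[leb3 R]_x (8 * C * w x)%:E)%E).
  apply: ge0_le_integral => //.
  - by apply: measurableT_comp => //; exact/measurable_EFinP.
  - by rewrite /w; mfun.
  - by move=> x _; rewrite /= lee_fin phiw.
rewrite ge0_integral_leb3; last 2 first.
- by rewrite /w; mfun.
- move=> x; rewrite lee_fin /w; apply: mulr_ge0; first exact: mulr_ge0.
  by apply: mulr_ge0; [exact: sqr_ge0|apply: mulr_ge0; exact: sqr_ge0].
rewrite /w/=.
rewrite (_ : (\int[mu]_x \int[mu]_y \int[mu]_z _)%E = (8 * C * W * W * W)%:E) ?ltry//.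
have n1 : 0 <= 8 * C * W by rewrite !mulr_ge0.
have n2 x : 0 <= 8 * C * W * weight x ^+ 2 by apply: mulr_ge0 => //; exact: sqr_ge0.
have n3 x y : 0 <= 8 * C * weight x ^+ 2 * weight y ^+ 2.
  by apply: mulr_ge0; [apply: mulr_ge0; [exact: mulr_ge0|exact: sqr_ge0]|exact: sqr_ge0].
transitivity (\int[mu]_x (8 * C * W * W * weight x ^+ 2)%:E)%E; last by rewrite WM// mulr_ge0.
apply: eq_integral => x _.
transitivity (\int[mu]_y (8 * C * W * weight x ^+ 2 * weight y ^+ 2)%:E)%E; last first.
  by rewrite WM//; congr EFin; ring.
apply: eq_integral => y _.
transitivity (\int[mu]_z (8 * C * weight x ^+ 2 * weight y ^+ 2 * weight z ^+ 2)%:E)%E; last first.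
  by rewrite WM//; congr EFin; ring.
by apply: eq_integral => z _; congr EFin; ring.
Qed.

End schwartz_integrable.

Section radial_multiplier.
Context (R : realType).
Notation mu := (@lebesgue_measure R).
Notation A := (@unit_disc_area R).
Implicit Types F G m : R -> R.

Definition sine_transform F (k : R) : R :=
  \int[mu]_r (if 0 <= r then r * F r * sin (k * r) else 0).

Lemma Rintegral_sin_radial F (xi : R * R * R) : radially_integrable F ->
  \int[leb3 R]_x (sin (dot x xi) * F (enorm x)) = 0.
Proof.
move=> Fr; rewrite (Rintegral_plane_wave xi Fr); last 2 first.
- exact: continuous_measurable_fun (@continuous_sin R).
- by move=> z; rewrite ler_norml sin_geN1 sin_le1.
rewrite (_ : (fun r => _) = fun=> 0) ?Rintegral0//.
  by rewrite /Rintegral integral0.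
apply/funext => r; case: ifP => // _.
rewrite (_ : \int[mu]_z _ = 0) ?mulr0//.
set g := fun z : R => _.
have mg : measurable_fun setT g by rewrite /g; mfun.
have := @Rintegral_affine R (-1) 0 g; rewrite normrN1 => /(_ erefl mg).
rewrite (_ : (fun x => _) = fun x => -1 * g x); last first.
  by apply/funext => x; rewrite /g/= addr0 !mulN1r normrN mulrN sinN; case: ifP => // _;
    rewrite oppr0.
have gi : mu.-integrable setT (EFin \o g).
  apply: (@integrable_bounded_support R (- r) r 1) => //.
  - by move=> z; rewrite /g; case: ifP => _; rewrite ?normr0// ler_norml sin_geN1 sin_le1.
  - by move=> z; rewrite -ler_norml /g => /negbTE ->.
rewrite RintegralZl//; lra.
Qed.

Lemma norm_sin_le (x : R) : 0 <= x -> `|sin x| <= x.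
Proof.
move=> x0.
have [] := @MVT_segment R sin cos 0 x x0.
  by apply: continuous_subspaceT; exact: continuous_sin.
move=> c _; rewrite sin0 !subr0 => ->; rewrite normrM (ger0_norm x0).
by rewrite ler_piMl// ler_norml cos_geN1 cos_le1.
Qed.

(** The integral of cos (k z) over [- r, r] is 2 sin (k r) / k. Hence the Fourier transform of a
    radial function is, up to the factor 4 A / k, the sine transform of r F(r). *)
Lemma Rintegral_cos_radial F (xi : R * R * R) : radially_integrable F ->
  0 < enorm xi ->
  \int[leb3 R]_x (cos (dot x xi) * F (enorm x)) =
  4 * A / enorm xi * sine_transform F (enorm xi).
Proof.
move=> Fr k0; have [mF Fi] := Fr; set k := enorm xi in k0 *.
rewrite (Rintegral_plane_wave xi Fr); last 2 first.
- exact: continuous_measurable_fun (@continuous_cos R).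
- by move=> z; rewrite ler_norml cos_geN1 cos_le1.
have kn : k != 0 by rewrite gt_eqF.
pose g (r : R) := if 0 <= r then r * F r * sin (k * r) else 0.
have mg : measurable_fun setT g by rewrite /g; mfun.
have gi : mu.-integrable setT (EFin \o g).
  have := @integrableZl _ _ _ mu setT measurableT k _ Fi.
  apply: le_integrable => //; first exact/measurable_EFinP.
  move=> r _; rewrite /g/= lee_fin; case: ifP => r0; last by rewrite mulr0.
  rewrite !normrM (ger0_norm (ltW k0)) (ger0_norm r0).
  rewrite [leRHS](_ : _ = r * `|F r| * (k * r)); last by ring.
  rewrite ler_wpM2l ?mulr_ge0//.
  have kr : 0 <= k * r by rewrite mulr_ge0// ltW.
  exact: norm_sin_le.
rewrite /sine_transform -/g -RintegralZl//; apply: eq_Rintegral => r _.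
rewrite /g -/k; case: ifPn => r0; last by rewrite mulr0.
have -> : \int[mu]_z (if `|z| <= r then cos (k * z) else 0) = 2 * sin (k * r) / k.
  rewrite /Rintegral; under eq_integral do rewrite ler_norml.
  have cc : continuous (fun z => cos (k * z)).
    move=> z; apply: continuous_comp; last exact: continuous_cos.
    by apply: cvgM; [exact: cvg_cst|exact: cvg_id].
  have dF (z : R) : is_derive z 1 (fun z : R => k^-1 * sin (k * z)) (cos (k * z)).
    by apply: is_derive_eq; rewrite /GRing.scale/=; field.
  rewrite (integral_FTC _ cc dF)/=; last lra.
  by rewrite mulrN sinN; field.
by field.
Qed.

Lemma ae_enorm_gt0 : {ae leb3 R, forall x, 0 < enorm x}.
Proof.
(* The origin is enclosed in the plane where the third coordinate vanishes, a rectangle whose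
   measure is a product with a null factor. *)
have mS : measurable ([set: R * R] `*` [set 0 : R]).
  by apply: measurableX.
exists ([set: R * R] `*` [set 0]); split.
- exact: mS.
- have -> : leb3 R ([set: R * R] `*` [set 0]) = (leb2 R setT * mu [set (0%R : R)])%E.
    have := @product_measure1E _ _ _ _ R (leb2 R) mu setT [set 0] measurableT (measurable_set1 0).
    by move=> <-.
  by rewrite lebesgue_measure_set1 mule0.
- move=> [[x y] z] /= /negP; rewrite sqrtr_gt0 -leNgt /dot/= => H.
  by split=> //; have := sqr_ge0 x; have := sqr_ge0 y; nra.
Qed.

Lemma radially_integrable_tempered F : radially_integrable F ->
  tempered (fun x => F (enorm x)).
Proof.
move=> Fr; split.
  by apply: (measurableT_comp Fr.1); exact: measurable_enorm.
exists 0%N; apply: eq_integrable (radial_integrable Fr) => // x _ /=.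
by rewrite invr1 mul1r.
Qed.

(** This reduces every multiplier condition of the development to an identity between sine
    transforms at positive frequencies. Fubini puts the Fourier kernel on [F] and [G], whose
    transforms at [xi] are multiples of their sine transforms at |xi|. *)
Lemma is_multiplier_radial (m F G : R -> R) (M : R) :
  measurable_fun setT m -> (forall k, `|m k| <= M) ->
  radially_integrable F -> radially_integrable G ->
  (forall k, 0 < k -> sine_transform G k = m k * sine_transform F k) ->
  is_multiplier m (fun x => F (enorm x)) (fun x => G (enorm x)).
Proof.
move=> mm mM Fr Gr FG; split; [exact: radially_integrable_tempered..|].
move=> phi sphi /=.
have phii := schwartz_integrable sphi.
have mphi : measurable_fun setT phi by apply/measurable_EFinP; exact: measurable_int phii.
have mme : measurable_fun setT (fun xi : R * R * R => m (enorm xi)).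
  by apply: (measurableT_comp mm); exact: measurable_enorm.
have mphii : (leb3 R).-integrable setT (EFin \o (fun xi => m (enorm xi) * phi xi)).
  have := @integrableZl _ _ _ (leb3 R) setT measurableT M _ phii.
  apply: le_integrable => //; first by apply/measurable_EFinP; exact: measurable_funM.
  move=> xi _; rewrite /= lee_fin !normrM ler_wpM2r//.
  exact: le_trans (ler_norm M).
have Fi := radial_integrable Fr; have Gi := radial_integrable Gr.
have mc (c : R -> R) : measurable_fun setT c ->
    measurable_fun setT (fun z : (R * R * R) * (R * R * R) => c (dot z.1 z.2)).
  by move=> mc; apply: (measurableT_comp mc); exact: measurable_dot.
have mcos := mc _ (continuous_measurable_fun (@continuous_cos R)).
have msin := mc _ (continuous_measurable_fun (@continuous_sin R)).
have cos1 (z : R) : `|cos z| <= 1 by rewrite ler_norml cos_geN1 cos_le1.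
have sin1 (z : R) : `|sin z| <= 1 by rewrite ler_norml sin_geN1 sin_le1.
(* After Fubini the inner integral is that of an odd function of x, so both sides of the imaginary
   identity are 0. *)
have sin0 H psi : radially_integrable H -> (leb3 R).-integrable setT (EFin \o psi) ->
    \int[leb3 R]_x (H (enorm x) * fourier_im psi x) = 0.
  move=> Hr psii; rewrite /fourier_im.
  have npsii : (leb3 R).-integrable setT (EFin \o (fun y => -1 * psi y)).
    by have := @integrableZl _ _ _ (leb3 R) setT measurableT (-1) _ psii.
  have E := Rintegral_Fubini (radial_integrable Hr) npsii msin (fun z => sin1 _).
  apply: etrans; first apply: etrans; [|exact: E|].
    apply: eq_Rintegral => x _; congr (_ * _).
    have mpsi : measurable_fun setT psi by apply/measurable_EFinP; exact: measurable_int psii.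
    have si : (leb3 R).-integrable setT (EFin \o (fun y => sin (dot x y) * psi y)).
      apply: le_integrable psii; [exact: measurableT| |].
        apply/measurable_EFinP; apply: measurable_funM; last exact: mpsi.
        exact: (measurableT_comp msin (pair1_measurable x)).
      by move=> y _; rewrite /= lee_fin normrM ler_piMl.
    transitivity (-1 * \int[leb3 R]_y (sin (dot x y) * psi y)); first by rewrite mulN1r.
    apply: etrans; first by symmetry; exact: (RintegralZl (-1) measurableT si).
    by apply: eq_Rintegral => y _; rewrite mulrCA.
  rewrite (_ : (fun y => _) = fun=> 0); first by rewrite /Rintegral integral0.
  by apply/funext => y; rewrite Rintegral_sin_radial// mulr0.
split; last by rewrite !sin0.
have EG := Rintegral_Fubini Gi phii mcos (fun z => cos1 _).
have EF := Rintegral_Fubini Fi mphii mcos (fun z => cos1 _).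
apply: etrans; first exact: EG.
apply: etrans; last by symmetry; exact: EF.
have mI (H : R -> R) : measurable_fun setT H ->
    measurable_fun setT (fun y : R * R * R => \int[leb3 R]_x (cos (dot x y) * H (enorm x))).
  move=> mH; apply: measurable_fun_Rintegral_snd; apply: measurable_funM.
    exact: (measurableT_comp mcos (g := fun z => (z.2, z.1))
      (measurable_fun_pair measurable_snd measurable_fst)).
  have mHe : measurable_fun setT (H \o @enorm R) := measurableT_comp mH (@measurable_enorm R).
  exact: (measurableT_comp mHe measurable_snd).
rewrite /Rintegral; congr fine; apply: ae_eq_integral.
- exact: measurableT.
- by apply/measurable_EFinP; apply: measurable_funM; [exact: mphi|exact: mI Gr.1].
- apply/measurable_EFinP; apply: measurable_funM; last exact: mI Fr.1.
  by apply: measurable_funM; [exact: mme|exact: mphi].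
(* The formula for the cosine transform divides by |xi|, hence a comparison almost everywhere. *)
have [N [mN N0 subN]] := ae_enorm_gt0; exists N; split; [exact: mN|exact: N0|].
apply: subset_trans subN => xi /=; apply: contra_not => xi0 _; congr EFin.
have EF' := Rintegral_cos_radial Fr xi0; have EG' := Rintegral_cos_radial Gr xi0.
apply: etrans (congr1 (fun z => phi xi * z) EG') _.
apply: etrans _ (esym (congr1 (fun z => m (enorm xi) * phi xi * z) EF')).
by rewrite (FG _ xi0); ring.
Qed.

End radial_multiplier.

(** * The triangle condition and the radial propagators *)

Section triangle.
Context (R : realType).
Implicit Types r rho tau : R.

(** The three numbers are the sides of a possibly degenerate triangle: a sphere of radius [tau]
    centred at distance [r] from the origin meets the sphere of radius [rho] about the origin. The
    condition is symmetric, so the kernel may be integrated in whichever variable is convenient. *)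
Definition triangle (r rho tau : R) : bool :=
  (`|r - tau| <= rho) && (rho <= r + tau).

Lemma triangleC r rho tau : triangle r rho tau = triangle rho r tau.
Proof.
rewrite /triangle !ler_norml.
by apply/idP/idP => /andP[/andP[? ?] ?]; (apply/andP; split; [apply/andP; split|]); lra.
Qed.

Lemma triangleCA r rho tau : triangle r rho tau = triangle tau rho r.
Proof. by rewrite /triangle (distrC tau r) (addrC tau r). Qed.

Lemma triangle_ge0 r rho tau : triangle r rho tau -> [/\ 0 <= r, 0 <= rho & 0 <= tau].
Proof.
by rewrite /triangle ler_norml => /andP[/andP[? ?] ?]; split; lra.
Qed.

Lemma measurable_triangle d (T : measurableType d) (f g h : T -> R) :
  measurable_fun setT f -> measurable_fun setT g -> measurable_fun setT h ->
  measurable_fun setT (fun x => triangle (f x) (g x) (h x)).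
Proof. by move=> mf mg mh; rewrite /triangle; mfun. Qed.

End triangle.

Ltac mtriangle := apply: measurable_triangle; mfun.

Section propagators.
Context (R : realType).
Notation mu := (@lebesgue_measure R).

Lemma normr_Rintegral_le (f : R -> R) : measurable_fun setT f ->
  (`|\int[mu]_x f x|%:E <= \int[mu]_x `|f x|%:E)%E.
Proof.
move=> mf.
have mEf : measurable_fun setT (EFin \o f) by exact/measurable_EFinP.
apply: le_trans (le_abse_integral mu measurableT mEf).
(* An infinite integral is sent to 0 by [fine], so the inequality holds even without
   integrability. *)
rewrite /Rintegral /=; case: (\int[mu]_x _)%E => [r| |] //=.
- by rewrite normr0 leey.
- by rewrite normr0 leey.
Qed.

Lemma Rintegral_swap (K : R -> R -> R) :
  measurable_fun setT (fun z : R * R => K z.1 z.2) ->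
  (\int[mu]_y \int[mu]_x `|K x y|%:E < +oo)%E ->
  (forall x, mu.-integrable setT (EFin \o K x)) ->
  (forall y, mu.-integrable setT (EFin \o K ^~ y)) ->
  \int[mu]_x \int[mu]_y K x y = \int[mu]_y \int[mu]_x K x y.
Proof.
move=> mK Koo Kx Ky.
pose F (z : R * R) := (K z.1 z.2)%:E.
have mF : measurable_fun setT F by exact/measurable_EFinP.
have Fi : (mu \x mu)%E.-integrable setT F.
  by apply/(@integrable21ltyP _ _ (measurableTypeR R) (measurableTypeR R) R mu mu F mF).
have E := Fubini Fi.
rewrite /Rintegral; congr fine.
transitivity (\int[mu]_x \int[mu]_y F (x, y))%E.
  by apply: eq_integral => x _; rewrite fineK//; exact: integrable_fin_num (Kx x).
rewrite E; apply: eq_integral => y _.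
by rewrite fineK//; exact: integrable_fin_num (Ky y).
Qed.

(* The mean over the sphere of radius [tau] and centre x,
   [r = |x|], of a radial function, multiplied by [tau]. *)
Definition spherical_mean (tau : R) (F : R -> R) (r : R) : R :=
  (2 * r)^-1 * \int[mu]_rho (if triangle r rho tau then rho * F rho else 0).

Lemma measurable_spherical_mean tau F : measurable_fun setT F ->
  measurable_fun setT (spherical_mean tau F).
Proof.
move=> mF; rewrite /spherical_mean; mfun; apply: measurable_fun_Rintegral.
by mfun; mtriangle.
Qed.

Lemma triangle_integral_le (rho tau : R) :
  (\int[mu]_r (if triangle r rho tau then 1 else 0)%:E <= (2 * Num.max 0 (Num.min rho tau))%:E)%E.
Proof.
have mt : measurable_fun setT (fun r => triangle r rho tau) by mtriangle.
have [rt|tr] := leP rho tau.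
  apply: le_trans (integral_if_le (d := tau - rho) (ell := 2 * rho) ler01 mt _) _.
    by move=> r; rewrite /triangle ler_norml => /andP[/andP[? ?] ?]; apply/andP; split; lra.
  by rewrite lee_fin mul1r; case: (leP (2 * rho) 0) => ?; case: (leP 0 rho) => ?; lra.
apply: le_trans (integral_if_le (d := rho - tau) (ell := 2 * tau) ler01 mt _) _.
  by move=> r; rewrite /triangle ler_norml => /andP[/andP[? ?] ?]; apply/andP; split; lra.
by rewrite lee_fin mul1r; case: (leP (2 * tau) 0) => ?; case: (leP 0 tau) => ?; lra.
Qed.

(** The sign [e] covers two uses: e = -1 for integration in the source time, and e = 1 for
    integration in the observation time. In both, the third side runs through an interval of length
    2 min (r, rho). *)
Lemma triangle_time_integral_le (e t r rho c : R) : `|e| = 1 -> 0 <= r -> 0 <= rho -> 0 <= c ->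
  (\int[mu]_s (if triangle r rho (e * s + t) then c else 0)%:E <=
   (c * (2 * Num.min r rho))%:E)%E.
Proof.
move=> e1 r0 rho0 c0.
have e0 : e != 0 by rewrite -normr_gt0 e1.
have mt : measurable_fun setT (fun s => triangle s rho r) by mtriangle.
have := ge0_integral_affine t e0 (f := fun s => (if triangle s rho r then c else 0)%:E).
rewrite e1 invr1 mul1e => E.
apply: (@le_trans _ _ (\int[mu]_s (if triangle s rho r then c else 0)%:E)%E).
  rewrite -E; last 2 first.
  - by mfun.
  - by move=> s; rewrite lee_fin; case: ifP.
  by under eq_integral do rewrite triangleCA.
apply: (@le_trans _ _ (c%:E * \int[mu]_s (if triangle s rho r then 1 else 0)%:E)%E).
  rewrite -ge0_integral_cstM//; last 2 first.
  - by mfun.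
  - by move=> s; rewrite lee_fin; case: ifP.
  apply: ge0_le_integral => //.
  - by move=> s _; rewrite lee_fin; case: ifP.
  - by mfun.
  - by apply: emeasurable_funM; mfun.
  - by move=> s _; rewrite -EFinM lee_fin; case: ifP => _; rewrite ?mulr1 ?mulr0.
apply: le_trans (lee_wpmul2l _ (triangle_integral_le rho r)) _; first by rewrite lee_fin.
rewrite -EFinM lee_fin ler_wpM2l// ler_wpM2l//.
by case: (leP rho r) => ?; case: (leP 0 _) => ?; case: (leP r rho) => ?; lra.
Qed.

(** Tonelli puts the integral over [r] inside. There r <= rho + tau, the interval has length at most
    2 min (rho, tau), and (rho + tau) min (rho, tau) <= 2 tau rho bounds the result by 2 tau times
    the integral of rho^2 |F|. *)
Lemma radially_integrable_spherical_mean tau F : 0 <= tau ->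
  radially_integrable F -> radially_integrable (spherical_mean tau F).
Proof.
move=> tau0 [mF Fi]; have mS := measurable_spherical_mean tau mF.
split=> //; apply/integrableP; split; first by mfun.
have /integrableP[_ Fi'] := Fi.
have mT : measurable_fun setT (fun z : R * R => triangle z.1 z.2 tau) by mtriangle.
have mT' : measurable_fun setT (fun z : R * R => triangle z.2 z.1 tau) by mtriangle.
apply: (@le_lt_trans _ _ (\int[mu]_r \int[mu]_rho
  (if triangle r rho tau then 2^-1 * r * rho * `|F rho| else 0)%:E)%E).
  apply: ge0_le_integral => //.
  - by mfun.
  - apply: measurable_fun_ge0_integral; first by mfun.
    move=> r rho; rewrite lee_fin; case: ifP => // /triangle_ge0[r0 rho0 _].
    by rewrite !mulr_ge0.
  move=> r _ /=; case: ifPn => [r0|_]; last first.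
    rewrite normr0; apply: integral_ge0 => rho _; rewrite lee_fin.
    by case: ifP => // /triangle_ge0[r0 rho0 _]; rewrite !mulr_ge0.
  have mI : measurable_fun setT (fun rho => if triangle r rho tau then rho * F rho else 0).
    by mfun; mtriangle.
  apply: (@le_trans _ _ ((2^-1 * r)%:E * `|\int[mu]_rho
    (if triangle r rho tau then rho * F rho else 0)|%:E)%E).
    rewrite -EFinM lee_fin /spherical_mean mulrA normrM.
    rewrite ler_wpM2r//.
    have [->|rn] := eqVneq r 0; first by rewrite mulr0 expr0n mul0r normr0.
    rewrite (_ : r ^+ 2 / (2 * r) = 2^-1 * r); last by field.
    by rewrite ger0_norm// mulr_ge0.
  apply: le_trans (lee_wpmul2l _ (normr_Rintegral_le mI)) _.
    by rewrite lee_fin mulr_ge0.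
  rewrite -ge0_integral_cstM ?mulr_ge0//; last by mfun.
  apply: ge0_le_integral => //.
  - by move=> rho _; rewrite -EFinM lee_fin mulr_ge0// mulr_ge0.
  - by apply: emeasurable_funM; mfun.
  - by mfun; mtriangle.
  move=> rho _; rewrite -EFinM lee_fin; case: ifPn => [/triangle_ge0[_ rho0 _]|_];
    last by rewrite normr0 mulr0.
  by rewrite normrM (ger0_norm rho0) !mulrA.
rewrite tonelli; last 2 first.
- by mfun.
- move=> r rho; rewrite lee_fin; case: ifP => // /triangle_ge0[r0 rho0 _].
  by rewrite !mulr_ge0.
apply: (@le_lt_trans _ _ (\int[mu]_rho
  ((2 * tau)%:E * `|(if 0 <= rho then rho ^+ 2 * F rho else 0)%:E|))%E); last first.
  rewrite ge0_integral_cstM ?mulr_ge0//; last by mfun.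
  by rewrite lte_mul_pinfty// lee_fin mulr_ge0.
apply: ge0_le_integral => //.
- move=> rho _; apply: integral_ge0 => r _; rewrite lee_fin.
  by case: ifP => // /triangle_ge0[r0 rho0 _]; rewrite !mulr_ge0.
- apply: (measurable_fun_ge0_integral
    (f := fun rho r => (if triangle r rho tau then 2^-1 * r * rho * `|F rho| else 0)%:E));
      first by mfun.
  move=> rho r; rewrite lee_fin; case: ifP => // /triangle_ge0[r0 rho0 _].
  by rewrite !mulr_ge0.
- by apply: emeasurable_funM; mfun.
move=> rho _.
have [rho0|rho0] := leP 0 rho; last first.
  rewrite abse0 mule0 integral0_eq// => r _; rewrite ifF//.
  by apply/negP => /triangle_ge0[]; lra.
apply: (@le_trans _ _ (\int[mu]_r ((2^-1 * (rho + tau) * rho * `|F rho|)%:E *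
  (if triangle r rho tau then 1 else 0)%:E))%E).
  apply: ge0_le_integral => //.
  - by move=> r _; rewrite lee_fin; case: ifP => // /triangle_ge0[r0 _ _]; rewrite !mulr_ge0.
  - by mfun; mtriangle.
  - by apply: emeasurable_funM; mfun; mtriangle.
  move=> r _; rewrite -EFinM lee_fin; case: ifPn => [|_]; last by rewrite mulr0.
  rewrite triangleC => /andP[_ rrt]; rewrite mulr1.
  by rewrite !ler_wpM2r// ler_wpM2l//; lra.
have c0 : 0 <= 2^-1 * (rho + tau) * rho * `|F rho| by rewrite !mulr_ge0// addr_ge0.
rewrite ge0_integral_cstM//; last 2 first.
- by mfun; mtriangle.
- by move=> r; rewrite lee_fin; case: ifP.
apply: le_trans (lee_wpmul2l _ (triangle_integral_le rho tau)) _; first by rewrite lee_fin.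
rewrite -!EFinM lee_fin normrM (ger0_norm (sqr_ge0 rho)) max_r; last by rewrite le_min rho0 tau0.
rewrite (_ : 2^-1 * _ * _ * _ * _ = (rho + tau) * Num.min rho tau * (rho * `|F rho|));
  last by field.
rewrite (_ : 2 * tau * _ = (2 * tau * rho) * (rho * `|F rho|)); last by ring.
rewrite ler_wpM2r ?mulr_ge0//.
by case: (leP rho tau) => ?; nra.
Qed.

(** After the order of integration is exchanged, the inner integral of sin (k r) over
    [|rho - tau|, rho + tau] equals 2 sin (k rho) sin (k tau) / k. This factors into the transform
    kernel and the symbol. *)
Lemma sine_transform_spherical_mean (tau C k : R) F : 0 <= tau -> 0 < k ->
  radially_integrable F -> (forall rho, 0 <= rho -> `|rho * F rho| <= C) ->
  sine_transform (spherical_mean tau F) k = sinc_symbol tau k * sine_transform F k.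
Proof.
move=> tau0 k0 [mF Fi] FC.
have C0 : 0 <= C by apply: le_trans (FC 0 (lexx _)).
have kn : k != 0 by rewrite gt_eqF.
have mT : measurable_fun setT (fun z : R * R => triangle z.1 z.2 tau) by mtriangle.
have mT1 r : measurable_fun setT (fun rho => triangle r rho tau) by mtriangle.
have mT2 rho : measurable_fun setT (fun r => triangle r rho tau) by mtriangle.
pose K (r rho : R) := if triangle r rho tau then 2^-1 * (rho * F rho) * sin (k * r) else 0.
have sin1 (z : R) : `|sin z| <= 1 by rewrite ler_norml sin_geN1 sin_le1.
have KC r rho : `|K r rho| <= C.
  rewrite /K; case: ifPn => [/triangle_ge0[_ rho0 _]|_]; last by rewrite normr0.
  rewrite normrM normrM ger0_norm//.
  have := FC _ rho0; have := sin1 (k * r); have := normr_ge0 (rho * F rho);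
    have := normr_ge0 (sin (k * r)); nra.
have mK : measurable_fun setT (fun z : R * R => K z.1 z.2) by rewrite /K; mfun.
have Kx r : mu.-integrable setT (EFin \o K r).
  apply: (@integrable_bounded_support R 0 (r + tau) C) => //; first by rewrite /K; mfun.
  move=> rho; apply: contraNeq; rewrite /K; case: ifPn => [tr _|_]; last by rewrite eqxx.
  by have [_ -> _] := triangle_ge0 tr; case/andP: tr.
have Ky rho : mu.-integrable setT (EFin \o K ^~ rho).
  apply: (@integrable_bounded_support R 0 (rho + tau) C) => //; first by rewrite /K; mfun.
  move=> r; apply: contraNeq; rewrite /K; case: ifPn => [tr _|_]; last by rewrite eqxx.
  have [-> _ _] := triangle_ge0 tr; rewrite triangleC in tr; by case/andP: tr.
have Koo : (\int[mu]_rho \int[mu]_r `|K r rho|%:E < +oo)%E.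
  have /integrableP[_ Fi'] := Fi.
  apply: le_lt_trans Fi'; apply: ge0_le_integral => //.
  - by move=> rho _; exact: integral_ge0.
  - apply: (measurable_fun_ge0_integral (f := fun rho r => `|K r rho|%:E)) => //.
    by mfun; apply: (measurableT_comp mK (g := fun z => (z.2, z.1))); mfun.
  - by mfun.
  move=> rho _; have [rho0|rho0] := leP 0 rho; last first.
    rewrite integral0_eq// => r _; rewrite /K ifF ?normr0//.
    by apply/negP => /triangle_ge0[]; lra.
  apply: (@le_trans _ _ (\int[mu]_r ((2^-1 * (rho * `|F rho|))%:E *
    (if triangle r rho tau then 1 else 0)%:E))%E).
    apply: ge0_le_integral => //.
    - by rewrite /K; mfun.
    - by apply: emeasurable_funM; mfun.
    move=> r _; rewrite -EFinM lee_fin /K; case: ifP => _; last by rewrite normr0 mulr0.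
    by rewrite !normrM (ger0_norm rho0) [`|2^-1|]ger0_norm// mulr1 ler_piMr// mulr_ge0// mulr_ge0.
  rewrite ge0_integral_cstM; last 3 first.
  - by rewrite !mulr_ge0.
  - by mfun.
  - by move=> r; rewrite lee_fin; case: ifP.
  apply: le_trans (lee_wpmul2l _ (triangle_integral_le rho tau)) _;
    first by rewrite lee_fin !mulr_ge0.
  rewrite -!EFinM lee_fin normrM (ger0_norm (sqr_ge0 rho)) max_r; last by rewrite le_min rho0 tau0.
  rewrite (_ : 2^-1 * _ * _ = Num.min rho tau * (rho * `|F rho|)); last by field.
  rewrite (_ : rho ^+ 2 * _ = rho * (rho * `|F rho|)); last by ring.
  by rewrite ler_wpM2r ?mulr_ge0// ge_min lexx.
transitivity (\int[mu]_r \int[mu]_rho K r rho).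
  apply: eq_Rintegral => r _; case: ifPn => r0; last first.
    rewrite (_ : (fun rho => _) = fun=> 0); first by rewrite /Rintegral integral0.
    by apply/funext => rho; rewrite /K ifF//; apply/negP => /triangle_ge0[rr _ _]; rewrite rr in r0.
  (* At r = 0 the prefactor of the mean is an inverse of 0; both sides vanish there, the right one
     through sin (k r). *)
  have [->|rn] := eqVneq r 0.
    rewrite !mul0r (_ : (fun rho => _) = fun=> 0); first by rewrite /Rintegral integral0.
    by apply/funext => rho; rewrite /K mulr0 sin0 mulr0; case: ifP.
  have Ii : mu.-integrable setT (EFin \o
    (fun rho => if triangle r rho tau then rho * F rho else 0)).
    apply: (@integrable_bounded_support R 0 (r + tau) C).
    - by mfun.
    - by move=> rho; case: ifPn => [/triangle_ge0[_ /FC]|]; rewrite ?normr0.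
    - move=> rho; apply: contraNeq; case: ifPn => [tr _|_]; last by rewrite eqxx.
      by have [_ -> _] := triangle_ge0 tr; case/andP: tr.
  rewrite /spherical_mean.
  transitivity (2^-1 * sin (k * r) * \int[mu]_rho (if triangle r rho tau then rho * F rho else 0)).
    by field.
  rewrite -RintegralZl//; apply: eq_Rintegral => rho _; rewrite /K.
  by case: ifP => _; rewrite ?mulr0//; ring.
rewrite Rintegral_swap//.
pose g (r : R) := if 0 <= r then r * F r * sin (k * r) else 0.
have mg : measurable_fun setT g by rewrite /g; mfun.
have gi : mu.-integrable setT (EFin \o g).
  have := @integrableZl _ _ _ mu setT measurableT k _ Fi.
  apply: le_integrable => //; first exact/measurable_EFinP.
  move=> r _; rewrite /g/= lee_fin; case: ifP => r0; last by rewrite mulr0.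
  rewrite !normrM (ger0_norm (ltW k0)) (ger0_norm r0).
  rewrite [leRHS](_ : _ = r * `|F r| * (k * r)); last by ring.
  rewrite ler_wpM2l ?mulr_ge0//.
  by apply: norm_sin_le; rewrite mulr_ge0// ltW.
rewrite /sine_transform -/g -RintegralZl//; apply: eq_Rintegral => rho _.
rewrite /g /sinc_symbol (negbTE kn); case: ifPn => rho0; last first.
  rewrite mulr0 (_ : (fun r => _) = fun=> 0); first by rewrite /Rintegral integral0.
  by apply/funext => r; rewrite /K ifF//; apply/negP => /triangle_ge0[_ rr _]; rewrite rr in rho0.
have cs : continuous (fun z => sin (k * z)).
  move=> z; apply: continuous_comp; last exact: continuous_sin.
  by apply: cvgM; [exact: cvg_cst|exact: cvg_id].
have dF (z : R) : is_derive z 1 (fun z : R => - (k^-1 * cos (k * z))) (sin (k * z)).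
  by apply: is_derive_eq; rewrite /GRing.scale/=; field.
have I1 : \int[mu]_r (if (`|rho - tau| <= r) && (r <= rho + tau) then sin (k * r) else 0) =
  2 * sin (k * rho) * sin (k * tau) / k.
  rewrite /Rintegral (integral_FTC _ cs dF)/=; last by rewrite ler_norml; apply/andP; split; lra.
  have -> : cos (k * `|rho - tau|) = cos (k * rho - k * tau).
    by case: ler0P => _; rewrite -mulrBr// mulrN cosN.
  by rewrite mulrDr cosD cosB; field.
have Ii : mu.-integrable setT (EFin \o
  (fun r => if (`|rho - tau| <= r) && (r <= rho + tau) then sin (k * r) else 0)).
  apply: (@integrable_bounded_support R `|rho - tau| (rho + tau) 1).
  - by mfun.
  - by move=> r; case: ifP => _; rewrite ?normr0.
  - by move=> r /negbTE ->.
transitivity (2^-1 * (rho * F rho) * (2 * sin (k * rho) * sin (k * tau) / k)); last first.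
  by rewrite (mulrC tau); field.
rewrite -I1 -RintegralZl//; apply: eq_Rintegral => r _.
by rewrite /K triangleC /triangle; case: ifP => _; rewrite ?mulr0.
Qed.

Section cosine.
Variables (h : R -> R) (M b : R).
Hypothesis mh : measurable_fun setT h.
Hypothesis hM : forall y, `|h y| <= M.
Hypothesis h0 : forall y, ~~ ((0 <= y) && (y <= b)) -> h y = 0.

(* d'Alembert's formula for the odd extension of [h], which vanishes on the
   negative half-line. *)
Definition dalembert (t r : R) : R := (h (r + t) + h (r - t) - h (t - r)) / (2 * r).

Let M0 : 0 <= M. Proof. exact: le_trans (hM 0). Qed.

Lemma radially_integrable_quotient (p : R -> R) (P c : R) : measurable_fun setT p ->
  (forall r, 0 <= r -> `|p r| <= P) -> (forall r, c < r -> p r = 0) ->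
  radially_integrable (fun r => p r / r).
Proof.
move=> mp pP pc; split; first by mfun.
have P0 : 0 <= P by apply: le_trans (pP 0 (lexx _)).
pose c' := Num.max c 0.
have c0 : 0 <= c' by rewrite /c' le_max lexx orbT.
have cc' : c <= c' by rewrite /c' le_max lexx.
apply: (@integrable_bounded_support R 0 c' (c' * P)).
- by mfun.
- move=> r; case: ifPn => r0; last by rewrite normr0 mulr_ge0.
  have [->|rn] := eqVneq r 0; first by rewrite expr0n mul0r normr0 mulr_ge0.
  rewrite (_ : r ^+ 2 * _ = r * p r); last by field.
  have [rc|cr] := leP r c'; last by rewrite pc ?mulr0 ?normr0 ?mulr_ge0// (le_lt_trans cc').
  rewrite normrM ger0_norm//; apply: ler_pM => //; exact: pP.
- move=> r; case: ifP => //= r0; rewrite -ltNge => cr.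
  by rewrite pc ?mul0r ?mulr0// (le_lt_trans cc').
Qed.

Lemma radially_integrable_dalembert t : 0 <= t -> radially_integrable (dalembert t).
Proof.
move=> t0.
have -> : dalembert t = fun r => (2^-1 * (h (r + t) + h (r - t) - h (t - r))) / r.
  by apply/funext => r; rewrite /dalembert invfM; ring.
apply: (@radially_integrable_quotient _ (3 * M) (b + t + t)).
- have mh' (f : R -> R) : measurable_fun setT f -> measurable_fun setT (fun r => h (f r)).
    exact: measurableT_comp.
  by mfun; apply: mh'; mfun.
- move=> r _; rewrite normrM ger0_norm//.
  have := ler_normB (h (r + t) + h (r - t)) (h (t - r)).
  have := ler_normD (h (r + t)) (h (r - t)).
  have := hM (r + t); have := hM (r - t); have := hM (t - r); have := M0; lra.
- move=> r br; rewrite !h0 ?addr0 ?subr0 ?mulr0//; apply/negP => /andP[? ?]; lra.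
Qed.

(** Each translate is shifted back so that all three terms carry h(y). What remains is sin (k (y +
    t)) + sin (k (y - t)) = 2 sin (k y) cos (t k). *)
Lemma sine_transform_dalembert t k : 0 <= t ->
  sine_transform (dalembert t) k = cos_symbol t k * sine_transform (fun r => h r / r) k.
Proof.
move=> t0.
have mh' (f : R -> R) : measurable_fun setT f -> measurable_fun setT (fun r => h (f r)).
  exact: measurableT_comp.
have sin1 (z : R) : `|sin z| <= 1 by rewrite ler_norml sin_geN1 sin_le1.
pose f1 r := if 0 <= r then h (r + t) * sin (k * r) else 0.
pose f2 r := if 0 <= r then h (r - t) * sin (k * r) else 0.
pose f3 r := if 0 <= r then h (t - r) * sin (k * r) else 0.
have mf1 : measurable_fun setT f1 by rewrite /f1; mfun; apply: mh'; mfun.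
have mf2 : measurable_fun setT f2 by rewrite /f2; mfun; apply: mh'; mfun.
have mf3 : measurable_fun setT f3 by rewrite /f3; mfun; apply: mh'; mfun.
have hs (a s : R) : `|h a * sin s| <= M.
  rewrite normrM; have := hM a; have := sin1 s; have := normr_ge0 (h a); have := normr_ge0 (sin s);
    nra.
have if1 : mu.-integrable setT (EFin \o f1).
  apply: (@integrable_bounded_support R 0 b M) => //.
    by move=> r; rewrite /f1; case: ifP => _; rewrite ?normr0.
  move=> r /negP H; rewrite /f1; case: ifP => // r0; rewrite h0 ?mul0r//.
  by apply/negP => /andP[? ?]; apply: H; apply/andP; split; lra.
have if2 : mu.-integrable setT (EFin \o f2).
  apply: (@integrable_bounded_support R 0 (b + t) M) => //.
    by move=> r; rewrite /f2; case: ifP => _; rewrite ?normr0.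
  move=> r /negP H; rewrite /f2; case: ifP => // r0; rewrite h0 ?mul0r//.
  by apply/negP => /andP[? ?]; apply: H; apply/andP; split; lra.
have if3 : mu.-integrable setT (EFin \o f3).
  apply: (@integrable_bounded_support R 0 t M) => //.
    by move=> r; rewrite /f3; case: ifP => _; rewrite ?normr0.
  move=> r /negP H; rewrite /f3; case: ifP => // r0; rewrite h0 ?mul0r//.
  by apply/negP => /andP[? ?]; apply: H; apply/andP; split; lra.
pose g1 y := f1 (1 * y + - t); pose g2 y := f2 (1 * y + t); pose g3 y := f3 (-1 * y + t).
have shift (e c : R) f : `|e| = 1 -> measurable_fun setT f -> mu.-integrable setT (EFin \o f) ->
    mu.-integrable setT (EFin \o (fun y => f (e * y + c))).
  move=> e1 mf /integrableP[_ fi]; apply/integrableP; split.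
    by apply/measurable_EFinP; apply: (measurableT_comp mf); mfun.
  have e0 : e != 0 by rewrite -normr_gt0 e1.
  have := ge0_integral_affine c e0 (f := fun y => `|(f y)%:E|%E).
  by rewrite e1 invr1 mul1e /= => ->//; mfun.
have ig1 : mu.-integrable setT (EFin \o g1) by apply: shift; rewrite ?normr1.
have ig2 : mu.-integrable setT (EFin \o g2) by apply: shift; rewrite ?normr1.
have ig3 : mu.-integrable setT (EFin \o g3) by apply: shift; rewrite ?normrN1.
have if12 : mu.-integrable setT (EFin \o (fun r => f1 r + f2 r))
  by exact: (integrableD measurableT if1 if2).
have ig12 : mu.-integrable setT (EFin \o (fun r => g1 r + g2 r))
  by exact: (integrableD measurableT ig1 ig2).
have ifs : mu.-integrable setT (EFin \o (fun r => f1 r + f2 r - f3 r))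
  by exact: (integrableB measurableT if12 if3).
have igs : mu.-integrable setT (EFin \o (fun r => g1 r + g2 r - g3 r))
  by exact: (integrableB measurableT ig12 ig3).
transitivity (2^-1 * \int[mu]_r (f1 r + f2 r - f3 r)).
  rewrite -RintegralZl//; apply: eq_Rintegral => r _; rewrite /f1 /f2 /f3 /dalembert.
  case: ifPn => r0; last by rewrite addr0 subr0 mulr0.
  have [->|rn] := eqVneq r 0; last by field.
  by rewrite !mul0r mulr0 sin0 !mulr0 addr0 subr0 mulr0.
rewrite RintegralB// RintegralD//.
rewrite -(Rintegral_affine (- t) (normr1 R) mf1) -(Rintegral_affine t (normr1 R) mf2).
rewrite -(Rintegral_affine t (normrN1 R) mf3) -/g1 -/g2 -/g3.
rewrite -RintegralD// -RintegralB//.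
pose q y := if 0 <= y then y * (h y / y) * sin (k * y) else 0.
have iq : mu.-integrable setT (EFin \o q).
  apply: (@integrable_bounded_support R 0 b M) => //.
  - by rewrite /q; mfun.
  - move=> r; rewrite /q; case: ifP => r0; rewrite ?normr0//.
    have [->|rn] := eqVneq r 0; first by rewrite !mul0r normr0.
    by rewrite (_ : r * (h r / r) = h r)//; field.
  - by move=> r H; rewrite /q h0// !(mul0r, mulr0) if_same.
rewrite -RintegralZl// /sine_transform -/q -RintegralZl//.
apply: eq_Rintegral => y _; rewrite /g1 /g2 /g3 /f1 /f2 /f3 /q /cos_symbol.
rewrite !mul1r mulN1r subrK addrK.
have -> : t - (- y + t) = y by ring.
have [yb|yb] := boolP ((0 <= y) && (y <= b)); last first.
  by rewrite (h0 yb) !(mul0r, mulr0) !if_same addr0 subr0 !mulr0.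
have [y0 _] := andP yb.
have -> : y * (h y / y) * sin (k * y) = h y * sin (k * y).
  have [->|yn] := eqVneq y 0; last by field.
  by rewrite mulr0 sin0 !mulr0.
have yt0 : 0 <= y + t by rewrite addr_ge0.
rewrite y0 yt0.
have S1 : sin (k * (y + t)) = sin (k * y) * cos (t * k) + cos (k * y) * sin (t * k).
  by rewrite mulrDr sinD (mulrC t).
have S2 : sin (k * (y - t)) = sin (k * y) * cos (t * k) - cos (k * y) * sin (t * k).
  by rewrite mulrBr sinB (mulrC t).
have S3 : sin (k * (- y + t)) = - sin (k * (y - t)).
  by rewrite -sinN -mulrN opprB addrC.
(* The term sin (k (y - t)) comes from h (r + t) when y > t and from the reflected h (t - r) when y
   < t. At y = t both indicators hold, but both sines vanish. *)
rewrite S1 S3; case: (ltgtP y t) => yt.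
- have -> : (0 <= y - t) = false by apply/negbTE; rewrite -ltNge; lra.
  have -> : 0 <= - y + t by lra.
  by rewrite S2; field.
- have -> : 0 <= y - t by lra.
  have -> : (0 <= - y + t) = false by apply/negbTE; rewrite -ltNge; lra.
  by rewrite S2; field.
- have -> : 0 <= y - t by lra.
  have -> : 0 <= - y + t by lra.
  have E0 : sin (k * (y - t)) = 0 by rewrite yt subrr mulr0 sin0.
  have S2' : cos (k * y) * sin (t * k) = sin (k * y) * cos (t * k).
    by move: S2; rewrite E0; lra.
  by rewrite E0 S2'; field.
Qed.

End cosine.
End propagators.

(** * Weighted bounds for the Duhamel operator *)

Section duhamel_bounds.
Context (R : realType).
Notation mu := (@lebesgue_measure R).
Notation jointly_measurable F := (measurable_fun setT (fun z : R * R => F z.1 z.2)).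

(** [P] is meant as a majorant of the source. The values are extended reals, so that integrals of
    the kernel can be reordered by Tonelli before they are known to be finite. *)
Definition duhamel_kernel (P : R -> R -> R) (r t s rho : R) : \bar R :=
  (if (0 <= s) && triangle r rho (t - s) then (2 * r)^-1 * (rho * P rho s) else 0)%:E.

Lemma duhamel_kernel_ge0 P r t s rho : (forall rho s, 0 <= rho -> 0 <= s -> 0 <= P rho s) ->
  (0 <= duhamel_kernel P r t s rho)%E.
Proof.
move=> P0; rewrite lee_fin; case: ifP => // /andP[s0 /triangle_ge0[r0 rho0 _]].
by rewrite mulr_ge0 ?invr_ge0 ?mulr_ge0// P0.
Qed.

Lemma measurable_duhamel_kernel d (T : measurableType d) (P : R -> R -> R) r (f g k : T -> R) :
  jointly_measurable P -> measurable_fun setT f ->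
  measurable_fun setT g -> measurable_fun setT k ->
  measurable_fun setT (fun z => duhamel_kernel P r (f z) (g z) (k z)).
Proof.
move=> mP mf mg mk; rewrite /duhamel_kernel.
have mPf : measurable_fun setT (fun z => P (k z) (g z)).
  by apply: (measurableT_comp mP (g := fun z => (k z, g z))); exact: measurable_fun_pair.
have mT : measurable_fun setT (fun z => triangle r (k z) (f z - g z)).
  by mtriangle.
by mfun.
Qed.

Lemma measurable_duhamel_kernel_integral d (T : measurableType d) (P : R -> R -> R) r (f g : T ->
  R) :
  jointly_measurable P ->
  (forall rho s, 0 <= rho -> 0 <= s -> 0 <= P rho s) ->
  measurable_fun setT f -> measurable_fun setT g ->
  measurable_fun setT (fun z => \int[mu]_rho duhamel_kernel P r (f z) (g z) rho)%E.
Proof.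
move=> mP P0 mf mg.
apply: (measurable_fun_ge0_integral (f := fun z rho => duhamel_kernel P r (f z) (g z) rho)) =>
  [|z rho].
  by apply: measurable_duhamel_kernel; mfun.
exact: duhamel_kernel_ge0.
Qed.

Definition duhamel_abs (P : R -> R -> R) (r t : R) : \bar R :=
  \int[mu]_s \int[mu]_rho duhamel_kernel P r t s rho.

Lemma measurable_duhamel_abs (P : R -> R -> R) r : jointly_measurable P ->
  (forall rho s, 0 <= rho -> 0 <= s -> 0 <= P rho s) ->
  measurable_fun setT (duhamel_abs P r).
Proof.
move=> mP P0.
apply: (measurable_fun_ge0_integral
  (f := fun t s : R => \int[mu]_rho duhamel_kernel P r t s rho)%E) => [|t s].
  by apply: measurable_duhamel_kernel_integral; mfun.
by apply: integral_ge0 => rho _; exact: duhamel_kernel_ge0.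
Qed.

Definition decay (r : R) : R := Num.min r 1 / r.

Lemma decay_le (r : R) : 0 < r -> decay r <= 2 * weight r.
Proof.
move=> r0; rewrite /decay /weight gtr0_norm// ler_pdivrMr// mulrAC ler_pdivlMr ?addr_gt0//.
case: (leP r 1) => r1; last by lra.
have : 0 <= r * (1 - r) by rewrite mulr_ge0 ?subr_ge0// ltW.
by lra.
Qed.

Lemma duhamel_abs_lin (P Q : R -> R -> R) (a b r t : R) : 0 < r -> 0 <= a -> 0 <= b ->
  jointly_measurable P ->
  jointly_measurable Q ->
  (forall rho s, 0 <= P rho s) -> (forall rho s, 0 <= Q rho s) ->
  (duhamel_abs (fun rho s => (a * P rho s + b * Q rho s)%R) r t =
   a%:E * duhamel_abs P r t + b%:E * duhamel_abs Q r t)%E.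
Proof.
move=> r0 a0 b0 mP mQ P0 Q0.
have K0 F s rho : (forall rho s, 0 <= F rho s) -> (0 <= duhamel_kernel F r t s rho)%E.
  by move=> F0; apply: duhamel_kernel_ge0 => ? ? _ _.
have mI (F : R -> R -> R) : jointly_measurable F -> (forall rho s, 0 <= F rho s) ->
    measurable_fun setT (fun s => \int[mu]_rho duhamel_kernel F r t s rho)%E.
  by move=> mF F0; apply: measurable_duhamel_kernel_integral => // *; exact: F0.
have I0 F s : (forall rho s, 0 <= F rho s) -> (0 <= \int[mu]_rho duhamel_kernel F r t s rho)%E.
  by move=> F0; apply: integral_ge0 => rho _; exact: K0.
rewrite /duhamel_abs -ge0_integral_lincomb//; [|exact: mI|exact: mI|..].
- apply: eq_integral => s _.
  rewrite -ge0_integral_lincomb//; [|by apply: measurable_duhamel_kernel; mfun..| |].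
  + apply: eq_integral => rho _; rewrite /duhamel_kernel -!EFinM -EFinD.
    by case: ifP => _; [congr EFin; ring|rewrite !mulr0 addr0].
  + by move=> rho; exact: K0.
  + by move=> rho; exact: K0.
- by move=> s; exact: I0.
- by move=> s; exact: I0.
Qed.

(** Since rho weight(rho) <= 1, each factor [rho] absorbs one power of the weight. Depending on the
    regime, min (r, rho) is bounded by r or by rho, so at most two powers are absorbed; of the five,
    the integrable two always remain. *)
Lemma duhamel_kernel_decay (r rho : R) : 0 < r -> 0 <= rho ->
  r^-1 * Num.min r rho * (rho * weight rho ^+ 5) <= decay r * weight rho ^+ 2.
Proof.
move=> r0 rho0; rewrite /decay.
have w0 := weight_gt0 rho; have w1 := weight_le1 rho.
have rw : rho * weight rho <= 1 by rewrite /weight ger0_norm// ler_pdivrMr ?ltr_pwDl//; lra.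
have rw0 : 0 <= rho * weight rho by rewrite mulr_ge0// ltW.
set w := weight rho in w0 w1 rw rw0 *.
rewrite (_ : r^-1 * _ * _ = Num.min r rho * (rho * w ^+ 5) * r^-1); last by ring.
rewrite (_ : _ / r * _ = Num.min r 1 * w ^+ 2 * r^-1); last by ring.
rewrite ler_wpM2r ?invr_ge0 ?(ltW r0)//.
have H1 : rho * w ^+ 5 <= w ^+ 2.
  have -> : rho * w ^+ 5 = (rho * w) * w ^+ 2 * w ^+ 2 by ring.
  have w2 : w ^+ 2 <= 1 by rewrite expr_le1// ltW.
  have : 0 <= w ^+ 2 by rewrite sqr_ge0.
  have : (rho * w) * w ^+ 2 <= 1 by rewrite mulr_ile1// sqr_ge0.
  by nra.
have H2 : rho * (rho * w ^+ 5) <= w ^+ 2.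
  have -> : rho * (rho * w ^+ 5) = (rho * w) ^+ 2 * w * w ^+ 2 by ring.
  have : (rho * w) ^+ 2 <= 1 by rewrite expr_le1.
  have : 0 <= (rho * w) ^+ 2 by rewrite sqr_ge0.
  have : 0 <= w ^+ 2 by rewrite sqr_ge0.
  move=> ? ? ?; have : (rho * w) ^+ 2 * w <= 1 by rewrite mulr_ile1// ltW.
  by nra.
have p0 : 0 <= rho * w ^+ 5 by rewrite mulr_ge0// exprn_ge0// ltW.
have : 0 <= w ^+ 2 by rewrite sqr_ge0.
case: (leP r rho) => rrho; case: (leP r 1) => r1 ww.
- by rewrite ler_wpM2l// ltW.
- rewrite mul1r; apply: le_trans H2; by rewrite ler_wpM2r.
- apply: (@le_trans _ _ (r * (rho * w ^+ 5))); first by rewrite ler_wpM2r// ltW.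
  by rewrite ler_wpM2l// ltW.
- by rewrite mul1r.
Qed.

(** For fixed [rho] the source is constant in time, so integrating the triangle condition in [s]
    first gives 2 min (r, rho); the rest is the integral of weight^2. *)
Lemma duhamel_abs_weight (r t : R) : 0 < r ->
  (duhamel_abs (fun rho _ => (weight rho ^+ 5)%R) r t <= (decay r)%:E)%E.
Proof.
move=> r0; have mw := @measurable_weight R.
have r0' := ltW r0.
have k0 : 0 <= (2 * r)^-1 by rewrite invr_ge0 mulr_ge0.
have w50 (rho _s : R) : 0 <= weight rho ^+ 5 by rewrite exprn_ge0// ltW// weight_gt0.
have mw5 : measurable_fun setT (fun z : R * R => weight z.1 ^+ 5) by mfun.
have mT1 rho : measurable_fun setT (fun s : R => triangle r rho (-1 * s + t)).
  by mtriangle.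
have K0 s rho : (0 <= duhamel_kernel (fun rho _ => (weight rho ^+ 5)%R) r t s rho)%E.
  by apply: duhamel_kernel_ge0 => *; exact: w50.
rewrite /duhamel_abs tonelli; last 2 first.
- by apply: measurable_duhamel_kernel; mfun.
- exact: K0.
apply: (@le_trans _ _ (\int[mu]_rho
  ((decay r)%:E * (if 0 <= rho then weight rho ^+ 2 else 0)%:E))%E); last first.
  by rewrite integral_cst_weight2// divr_ge0// le_min r0' ler01.
apply: ge0_le_integral => //.
- by move=> rho _; exact: integral_ge0.
- apply: (measurable_fun_ge0_integral
    (f := fun rho s => duhamel_kernel (fun rho _ => (weight rho ^+ 5)%R) r t s rho)) => [|rho s];
      last exact: K0.
  by apply: measurable_duhamel_kernel; mfun.
- by apply: emeasurable_funM; mfun.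
move=> rho _; case: ifPn => rho0; last first.
  rewrite mule0 integral0_eq// => s _; rewrite /duhamel_kernel ifF//.
  by apply/negP => /andP[_ /triangle_ge0[_ rr _]]; rewrite rr in rho0.
have c0 : 0 <= (2 * r)^-1 * (rho * weight rho ^+ 5).
  by rewrite mulr_ge0// mulr_ge0// exprn_ge0// ltW// weight_gt0.
apply: (@le_trans _ _ (\int[mu]_s (if triangle r rho (-1 * s + t) then (2 * r)^-1 *
  (rho * weight rho ^+ 5) else 0)%:E)%E).
  apply: ge0_le_integral => //.
  - by apply: measurable_duhamel_kernel; mfun.
  - by mfun.
  move=> s _; rewrite lee_fin mulN1r (addrC _ t).
  by case: (0 <= s) => //=; case: ifP.
apply: le_trans (triangle_time_integral_le t (normrN1 R) r0' rho0 c0) _.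
rewrite -EFinM lee_fin; apply: le_trans (duhamel_kernel_decay r0 rho0).
by rewrite le_eqVlt; apply/orP; left; apply/eqP; field; rewrite gt_eqF.
Qed.

Section wave.
Variables (h : R -> R) (A : R).
Hypothesis mh : measurable_fun setT h.
Hypothesis h_ge0 : forall y, 0 <= h y.
Hypothesis h_le : forall y, 0 <= y -> h y <= A * y.
Hypothesis h_supp : forall y, ~~ ((0 <= y) && (y <= 1)) -> h y = 0.

Definition outgoing (r t : R) : R :=
  if (0 <= r) && (0 <= t) then h (r - t) / r else 0.

Lemma measurable_outgoing : jointly_measurable outgoing.
Proof. by rewrite /outgoing; mfun. Qed.

Lemma outgoing_ge0 r t : 0 <= outgoing r t.
Proof. by rewrite /outgoing; case: ifP => // /andP[r0 _]; rewrite divr_ge0. Qed.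

Let A_ge0 : 0 <= A.
Proof. by have := h_le ler01; have := h_ge0 1; lra. Qed.

Lemma outgoing_le r t : outgoing r t <= 2 * A * weight r.
Proof.
have w0 := weight_gt0 r.
have B0 : 0 <= 2 * A * weight r by rewrite !mulr_ge0// ltW.
rewrite /outgoing; case: ifP => // /andP[r0 t0].
have [->|rn] := eqVneq r 0; first by rewrite invr0 mulr0 !mulr_ge0// ltW// weight_gt0.
have rp : 0 < r by rewrite lt_neqAle eq_sym rn.
have [y01|/h_supp->] := boolP ((0 <= r - t) && (r - t <= 1)); last by rewrite mul0r.
have [y0 y1] := andP y01.
rewrite ler_pdivrMr// /weight ger0_norm// mulrAC ler_pdivlMr ?addr_gt0//.
apply: le_trans (ler_wpM2r _ (h_le y0)) _; first by rewrite addr_ge0.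
rewrite -mulrA [2 * A]mulrC -!mulrA ler_wpM2l//; nra.
Qed.

(** The integral of rho v(rho, 0)^p over the half-line: the quantity through which the smallness of
    [v] enters the contraction. *)
Definition mass (p : nat) : \bar R :=
  \int[mu]_y (if 0 <= y then y * (h y / y) ^+ p else 0)%:E.

Lemma duhamel_abs_outgoing (p : nat) (r t : R) : (3 <= p)%N -> 0 < r ->
  (duhamel_abs (fun rho s => (outgoing rho s ^+ p)%R) r t <= (2^-1 * decay r)%:E * mass p)%E.
Proof.
move=> p3 r0; have mw := @measurable_weight R; have mv := measurable_outgoing.
have r0' := ltW r0.
have k0 : 0 <= (2 * r)^-1 by rewrite invr_ge0 mulr_ge0.
have mO (f g : R * R -> R) : measurable_fun setT f -> measurable_fun setT g ->
  measurable_fun setT (fun z => outgoing (f z) (g z)).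
  by move=> mf mg; apply: (measurableT_comp mv (g := fun z => (f z, g z)));
    exact: measurable_fun_pair.
(* The kernel at rho = y + s. Along a fixed [y] the wave moves on an outgoing characteristic, where
   its profile value is the constant h(y). *)
pose G y s : R := if (0 <= s) && triangle r (y + s) (t - s) then (2 * r)^-1 *
  ((y + s) * outgoing (y + s) s ^+ p) else 0.
have mT : measurable_fun setT (fun z : R * R => triangle r (z.1 + z.2) (t - z.2)).
  by mtriangle.
have mO1 : measurable_fun setT (fun z : R * R => outgoing (z.1 + z.2) z.2) by apply: mO; mfun.
have mvp : measurable_fun setT (fun z : R * R => outgoing z.1 z.2 ^+ p) by mfun.
have v0 rho s : 0 <= outgoing rho s ^+ p by rewrite exprn_ge0// outgoing_ge0.
have K0 s rho : (0 <= duhamel_kernel (fun rho s => (outgoing rho s ^+ p)%R) r t s rho)%E.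
  by apply: duhamel_kernel_ge0 => *; exact: v0.
have G0 y s : (0 <= (G y s)%:E)%E by exact: K0.
have mG : measurable_fun setT (fun z : R * R => (G z.1 z.2)%:E) by rewrite /G; mfun.
have mG1 y : measurable_fun setT (fun s => (G y s)%:E).
  exact: (measurableT_comp mG (pair1_measurable y)).
have -> : duhamel_abs (fun rho s => (outgoing rho s ^+ p)%R) r t =
  (\int[mu]_y \int[mu]_s (G y s)%:E)%E.
  apply: etrans (esym (tonelli (f := fun y s => (G y s)%:E) mG G0)); apply: eq_integral => s _.
  have E := ge0_integral_affine s (oner_neq0 R)
    (f := duhamel_kernel (fun rho s => (outgoing rho s ^+ p)%R) r t s).
  rewrite normr1 invr1 mul1e in E; rewrite -E.
  - by apply: eq_integral => y _; rewrite /duhamel_kernel /G mul1r.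
  - by apply: measurable_duhamel_kernel; mfun.
  - by move=> rho; exact: K0.
have d0 : 0 <= decay r by rewrite divr_ge0// le_min r0' ler01.
have m0 y : (0 <= (if 0 <= y then y * (h y / y) ^+ p else 0)%:E)%E.
  by rewrite lee_fin; case: ifP => // y0; rewrite mulr_ge0// exprn_ge0// divr_ge0.
rewrite /mass -ge0_integral_cstM; [|by rewrite mulr_ge0|by mfun|exact: m0].
apply: ge0_le_integral => //.
- by move=> y _; exact: integral_ge0.
- exact: (measurable_fun_ge0_integral (f := fun y s => (G y s)%:E)).
- by apply: emeasurable_funM; mfun.
move=> y _.
have [y01|/h_supp y01] := boolP ((0 <= y) && (y <= 1)); last first.
  rewrite integral0_eq; first by rewrite mule_ge0// lee_fin mulr_ge0.
  move=> s _; rewrite /G /outgoing addrK y01 mul0r; case: ifP => // _; case: ifP => // _;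
  by rewrite expr0n; case: (p) p3 => //= *; rewrite !mulr0.
have [y0 y1] := andP y01; rewrite y0.
have [yz|yn] := eqVneq y 0.
  rewrite integral0_eq; first by rewrite yz mul0r mule0.
  have hz : h y = 0 by apply/le_anti; rewrite h_ge0 andbT (le_trans (h_le y0))// yz mulr0.
  move=> s _; rewrite /G /outgoing addrK hz mul0r; case: ifP => // _; case: ifP => // _;
  by rewrite expr0n; case: (p) p3 => //= *; rewrite !mulr0.
have yp : 0 < y by rewrite lt_neqAle eq_sym yn.
pose c := (2 * r)^-1 * (y * (h y / y) ^+ p).
have c0 : 0 <= c by rewrite mulr_ge0// mulr_ge0// exprn_ge0// divr_ge0.
pose W s := (0 <= s) && triangle r (y + s) (t - s).
have mW : measurable_fun setT W.
  by apply: (measurableT_comp (f := fun z : R * R => (0 <= z.2) && triangle r (z.1 + z.2)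
    (t - z.2)) _ (pair1_measurable y)); mfun.
have GW s : G y s <= c * (if W s then weight s ^+ 2 else 0).
  rewrite /G -/(W s); case: ifP => [/andP[s0 _]|_]; last by rewrite mulr0.
  have ys : 0 < y + s by rewrite ltr_pwDl.
  rewrite /outgoing (ltW ys) s0/= addrK /c -mulrA ler_wpM2l//.
  (* The decay of the wave along the characteristic from time 0 to time [s]. It is at most 1 / (1 +
     s) because y <= 1 on the support. *)
  pose th := y / (y + s).
  have th0 : 0 <= th by rewrite divr_ge0// ltW.
  have thw : th <= weight s.
    rewrite /th /weight ger0_norm// ler_pdivrMr// mulrC ler_pdivlMr ?ltr_pwDl//.
    have : 0 <= s * (1 - y) by rewrite mulr_ge0// subr_ge0.
    by lra.
  have th1 : th <= 1 by apply: le_trans thw (weight_le1 s).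
  have -> : h y / (y + s) = h y / y * th by rewrite /th mulrA divfK.
  have yE : (y + s) * th = y by rewrite /th mulrC divfK// gt_eqF.
  (* Of the p factors [th], one turns y + s back into y and two give weight(s)^2; the others are at
     most 1. This is where p >= 3 enters. *)
  case: (p) p3 => [|[|[|q]]]// _.
  have -> : (y + s) * (h y / y * th) ^+ q.+3 =
    ((y + s) * th) * (h y / y) ^+ q.+3 * (th ^+ q * th ^+ 2).
    by rewrite exprMn -(addn3 q) (exprD th); ring.
  rewrite yE; apply: ler_wpM2l.
    by apply: mulr_ge0 => //; apply: exprn_ge0; exact: divr_ge0.
  rewrite -[leRHS]mul1r; apply: ler_pM; [exact: exprn_ge0|exact: exprn_ge0|exact: exprn_ile1|].
  by rewrite ler_sqr// nnegrE// ltW// weight_gt0.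
apply: (@le_trans _ _ (\int[mu]_s (c%:E * (if W s then weight s ^+ 2 else 0)%:E))%E).
  apply: ge0_le_integral => //; [exact: mG1|apply: emeasurable_funM; mfun|by move=> s _;
    rewrite -EFinM lee_fin; exact: GW].
have W0 s : (0 <= (if W s then weight s ^+ 2 else 0)%:E)%E
  by rewrite lee_fin; case: ifP => // _; rewrite sqr_ge0.
rewrite ge0_integral_cstM; [|exact: c0|by mfun|exact: W0].
have le1 : (\int[mu]_s (if W s then weight s ^+ 2 else 0)%:E <= 1)%E.
  rewrite -(integral_weight2 R); apply: ge0_le_integral => //; [by mfun|by mfun|].
  by move=> s _; rewrite lee_fin /W; case: (0 <= s) => //=; case: ifP => // _; rewrite sqr_ge0.
(* The triangle condition confines [s] to an interval of length r centred at (t - y) / 2. With the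
   previous bound by 1 this yields the factor min (r, 1). *)
have ler' : (\int[mu]_s (if W s then weight s ^+ 2 else 0)%:E <= r%:E)%E.
  have := integral_if_le (c := 1) (d := (t - r - y) / 2) (P := W) (ell := r) ler01 mW.
  rewrite mul1r (max_idPl r0') => H; apply: le_trans (H _).
    apply: ge0_le_integral => //; [by mfun|by mfun|].
    move=> s _; rewrite lee_fin; case: ifP => // _.
    by rewrite exprn_ile1// ?weight_le1// ltW// weight_gt0.
  move=> s /andP[s0]; rewrite /triangle ler_norml => /andP[/andP[? ?] ?].
  by apply/andP; split; lra.
apply: (@le_trans _ _ (c%:E * (Num.min r 1)%:E)%E).
  by apply: lee_wpmul2l; rewrite ?lee_fin//; case: (leP r 1).
rewrite -!EFinM lee_fin /c /decay le_eqVlt; apply/orP; left; apply/eqP.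
by field; rewrite gt_eqF.
Qed.

End wave.

End duhamel_bounds.

(** * The signed Duhamel operator *)

Section duhamel.
Context (R : realType).
Notation mu := (@lebesgue_measure R).
Notation jointly_measurable F := (measurable_fun setT (fun z : R * R => F z.1 z.2)).
Implicit Types F G P : R -> R -> R.

(** The upper limit s = t is implicit: for s > t no triangle has the side t - s, so the spherical
    mean vanishes. *)
Definition duhamel F (r t : R) : R :=
  \int[mu]_s (if 0 <= s then spherical_mean (t - s) (F ^~ s) r else 0).

Lemma measurable_duhamel F : jointly_measurable F ->
  measurable_fun setT (fun z : R * R => duhamel F z.1 z.2).
Proof.
move=> mF; rewrite /duhamel.
apply: (measurable_fun_Rintegral (f := fun (z : R * R) s => if 0 <= s then spherical_mean (z.2 - s)
  (F ^~ s) z.1 else 0)).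
have mI : measurable_fun setT (fun y : R * R * R => \int[mu]_rho
  (if triangle y.1.1 rho (y.1.2 - y.2) then rho * F rho y.2 else 0)).
  apply: (measurable_fun_Rintegral (f := fun (y : R * R * R) rho => if triangle y.1.1 rho
    (y.1.2 - y.2) then rho * F rho y.2 else 0)).
  have mF' : measurable_fun setT (fun z : R * R * R * R => F z.2 z.1.2).
    by apply: (measurableT_comp mF (g := fun z => (z.2, z.1.2))); mfun.
  have mT : measurable_fun setT (fun z : R * R * R * R => triangle z.1.1.1 z.2 (z.1.1.2 - z.1.2)).
    by mtriangle.
  by mfun.
by rewrite /spherical_mean; mfun.
Qed.

Let le_abs_bound M F r t : (forall rho s, `|F rho s| <= M) -> forall s rho,
  `|if triangle r rho (t - s) then rho * F rho s else 0| <=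
    (r + (t - s)) * M * (triangle r rho (t - s))%:R.
Proof.
move=> FM s rho; have M0 : 0 <= M by apply: le_trans (FM 0 0).
case: ifPn => [tr|_]; last by rewrite normr0 mulr0.
have [r0 rho0 ts] := triangle_ge0 tr; have /andP[_ rt] := tr.
by rewrite mulr1 normrM ger0_norm// ler_pM.
Qed.

Lemma integrable_spherical_mean M F r t s : jointly_measurable F ->
  (forall rho s, `|F rho s| <= M) ->
  mu.-integrable setT (EFin \o (fun rho => if triangle r rho (t - s) then rho * F rho s else 0)).
Proof.
move=> mF FM.
have mF1 : measurable_fun setT (fun rho => F rho s)
  by exact: (measurableT_comp mF (pair2_measurable s)).
have mT : measurable_fun setT (fun rho => triangle r rho (t - s)) by mtriangle.
have M0 : 0 <= M by apply: le_trans (FM 0 0).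
apply: (@integrable_bounded_support R 0 (r + (t - s)) (`|r + (t - s)| * M)).
- by mfun.
- move=> rho; apply: le_trans (le_abs_bound r t FM s rho) _.
  case: triangle; last by rewrite mulr0 mulr_ge0.
  by rewrite mulr1; apply: ler_wpM2r => //; exact: ler_norm.
- move=> rho; case: ifPn => // tr; have [r0 rho0 ts] := triangle_ge0 tr; have /andP[_ rt] := tr.
  by rewrite rho0 rt.
Qed.

Lemma spherical_mean_le M F r t s : jointly_measurable F ->
  (forall rho s, `|F rho s| <= M) -> 0 <= r -> 0 <= t - s ->
  `|spherical_mean (t - s) (F ^~ s) r| <= (2 * r)^-1 * ((r + (t - s)) * M * (r + (t - s))).
Proof.
move=> mF FM r0 ts0.
have M0 : 0 <= M by apply: le_trans (FM 0 0).
have mF1 : measurable_fun setT (fun rho => F rho s)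
  by exact: (measurableT_comp mF (pair2_measurable s)).
have mT : measurable_fun setT (fun rho => triangle r rho (t - s)) by mtriangle.
have rt0 : 0 <= r + (t - s) by rewrite addr_ge0.
rewrite /spherical_mean normrM ger0_norm ?invr_ge0 ?mulr_ge0//.
apply: ler_wpM2l; first by rewrite invr_ge0 mulr_ge0.
rewrite -lee_fin; apply: le_trans (normr_Rintegral_le _) _; first by mfun.
have := integral_if_le (c := (r + (t - s)) * M) (d := 0) (P := fun rho => triangle r rho (t - s))
  (ell := r + (t - s)) (mulr_ge0 rt0 M0) mT.
rewrite (max_idPl rt0) => H; apply: le_trans (H _).
  apply: ge0_le_integral => //; [by mfun|by mfun|].
  move=> rho _; rewrite lee_fin; apply: le_trans (le_abs_bound r t FM s rho) _.
  by case: triangle; rewrite ?mulr1 ?mulr0.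
by move=> rho tr; have [_ rho0 _] := triangle_ge0 tr; have /andP[_ rt] := tr; rewrite rho0 add0r.
Qed.

Lemma spherical_mean_eq0 (f : R -> R) r tau : ~~ ((0 < r) && (0 <= tau)) ->
  spherical_mean tau f r = 0.
Proof.
move=> rt; rewrite /spherical_mean.
have [->|rn] := eqVneq r 0; first by rewrite mulr0 invr0 mul0r.
rewrite (_ : (fun rho => _) = fun=> 0); first by rewrite /Rintegral integral0 mulr0.
apply/funext => rho; case: ifPn => // /triangle_ge0[r0 _ t0].
by move: rt; rewrite lt_neqAle eq_sym rn r0 t0.
Qed.

Lemma measurable_spherical_mean_time F r t : jointly_measurable F ->
  measurable_fun setT (fun s : R => spherical_mean (t - s) (F ^~ s) r).
Proof.
move=> mF; rewrite /spherical_mean; mfun.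
apply: (measurable_fun_Rintegral (f := fun s rho : R => if triangle r rho (t - s) then rho * F rho s
  else 0)).
have mF' : measurable_fun setT (fun z : R * R => F z.2 z.1).
  by apply: (measurableT_comp mF (g := fun z => (z.2, z.1))); mfun.
have mT : measurable_fun setT (fun z : R * R => triangle r z.2 (t - z.1)).
  by mtriangle.
by mfun.
Qed.

Lemma integrable_duhamel M F r t : jointly_measurable F ->
  (forall rho s, `|F rho s| <= M) ->
  mu.-integrable setT (EFin \o (fun s => if 0 <= s then spherical_mean (t - s) (F ^~ s) r else 0)).
Proof.
move=> mF FM.
have M0 : 0 <= M by apply: le_trans (FM 0 0).
have mS := measurable_spherical_mean_time r t mF.
apply: (@integrable_bounded_support R 0 t (`|(2 * r)^-1| * ((`|r| + `|t|) * M * (`|r| + `|t|)))).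
- by mfun.
- move=> s; case: ifPn => s0; last by rewrite normr0 !mulr_ge0// addr_ge0.
  have [|rt] := boolP ((0 < r) && (0 <= t - s));
    last by rewrite spherical_mean_eq0// normr0 !mulr_ge0// addr_ge0.
  move=> /andP[/ltW r0 ts0]; apply: le_trans (spherical_mean_le mF FM r0 ts0) _.
  have rt : r + (t - s) <= `|r| + `|t|
    by apply: lerD; [exact: ler_norm|apply: le_trans (ler_norm t); lra].
  apply: ler_pM; [by rewrite invr_ge0 mulr_ge0|by rewrite !mulr_ge0// addr_ge0|exact: ler_norm|].
  have rt0 : 0 <= r + (t - s) by rewrite addr_ge0.
  apply: ler_pM; [by rewrite mulr_ge0|by []| |by []].
  exact: ler_wpM2r.
- move=> s sP; case: ifPn => // s0; apply: spherical_mean_eq0; move: sP; rewrite s0/= subr_ge0.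
  by move=> /negbTE->; rewrite andbF.
Qed.

Lemma duhamel_sub_le M F G P r t : 0 < r ->
  jointly_measurable F ->
  jointly_measurable G ->
  jointly_measurable P ->
  (forall rho s, `|F rho s| <= M) -> (forall rho s, `|G rho s| <= M) ->
  (forall rho s, 0 <= rho -> 0 <= s -> `|F rho s - G rho s| <= P rho s) ->
  (`|duhamel F r t - duhamel G r t|%:E <= duhamel_abs P r t)%E.
Proof.
move=> r0 mF mG mP FM GM FGP.
have mSF := measurable_spherical_mean_time r t mF.
have mSG := measurable_spherical_mean_time r t mG.
have P0 rho s : 0 <= rho -> 0 <= s -> 0 <= P rho s.
  by move=> rho0 s0; exact: le_trans (FGP _ _ rho0 s0).
have K0 s rho : (0 <= duhamel_kernel P r t s rho)%E by exact: duhamel_kernel_ge0.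
rewrite /duhamel -RintegralB//; [|exact: integrable_duhamel mF FM|exact: integrable_duhamel mG GM].
apply: le_trans (normr_Rintegral_le _) _; first by mfun.
rewrite /duhamel_abs; apply: ge0_le_integral => //; [by mfun| |].
  by apply: measurable_duhamel_kernel_integral; mfun.
move=> s _; case: ifPn => [s0|_]; last by rewrite subrr normr0; exact: integral_ge0.
rewrite /spherical_mean -mulrBr -RintegralB//;
  [|exact: integrable_spherical_mean mF FM|exact: integrable_spherical_mean mG GM].
have k0 : 0 <= (2 * r)^-1 by rewrite invr_ge0 mulr_ge0// ltW.
have mF1 : measurable_fun setT (fun rho => F rho s)
  by exact: (measurableT_comp mF (pair2_measurable s)).
have mG1 : measurable_fun setT (fun rho => G rho s)
  by exact: (measurableT_comp mG (pair2_measurable s)).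
have mT : measurable_fun setT (fun rho => triangle r rho (t - s)) by mtriangle.
rewrite normrM (ger0_norm k0) EFinM.
apply: (@le_trans _ _ ((2 * r)^-1%:E *
  \int[mu]_rho `|(if triangle r rho (t - s) then rho * F rho s else 0) -
    (if triangle r rho (t - s) then rho * G rho s else 0)|%:E)%E).
  by apply: lee_wpmul2l; [rewrite lee_fin|apply: normr_Rintegral_le; mfun].
rewrite -ge0_integral_cstM; [|exact: k0|by mfun|by move=> rho; rewrite lee_fin].
apply: ge0_le_integral => //.
- by move=> rho _; rewrite mule_ge0.
- by apply: emeasurable_funM; mfun.
- by have : measurable_fun setT (duhamel_kernel P r t s) by [apply: measurable_duhamel_kernel;
    mfun]; rewrite /duhamel_kernel s0.
move=> rho _; rewrite /duhamel_kernel s0 -EFinM lee_fin /=; case: ifPn => [tr|_];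
  last by rewrite subrr normr0 mulr0.
have [_ rho0 _] := triangle_ge0 tr.
apply: ler_wpM2l => //; rewrite -mulrBr normrM (ger0_norm rho0).
by apply: ler_wpM2l => //; exact: FGP.
Qed.

Lemma duhamel0 r t : duhamel (fun _ _ => 0) r t = 0.
Proof.
rewrite /duhamel (_ : (fun s => _) = fun=> 0); first by rewrite /Rintegral integral0.
apply/funext => s; case: ifP => // _; rewrite /spherical_mean.
rewrite (_ : (fun rho => _) = fun=> 0); first by rewrite /Rintegral integral0 mulr0.
by apply/funext => rho; rewrite mulr0 if_same.
Qed.

Lemma duhamel_le M F P r t : 0 < r ->
  jointly_measurable F ->
  jointly_measurable P ->
  (forall rho s, `|F rho s| <= M) ->
  (forall rho s, 0 <= rho -> 0 <= s -> `|F rho s| <= P rho s) ->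
  (`|duhamel F r t|%:E <= duhamel_abs P r t)%E.
Proof.
move=> r0 mF mP FM FP; have M0 : 0 <= M by apply: le_trans (FM 0 0).
rewrite -[duhamel F r t]subr0 -(duhamel0 r t).
apply: (@duhamel_sub_le M) => //; [by move=> *; rewrite normr0|].
by move=> rho s rho0 s0; rewrite subr0; exact: FP.
Qed.

Lemma duhamel_eq0 F r t : ~~ ((0 < r) && (0 <= t)) -> duhamel F r t = 0.
Proof.
move=> rt; rewrite /duhamel (_ : (fun s => _) = fun=> 0); first by rewrite /Rintegral integral0.
apply/funext => s; case: ifPn => // s0; apply: spherical_mean_eq0.
by apply: contra rt => /andP[->]/=; lra.
Qed.

(* Integrating the kernel in [t] first gives the same factor as integrating it
   in [s], which makes the bound independent of the length of the time interval. *)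
Lemma integral_duhamel_abs_le (P : R -> R -> R) (B r : R) : 0 < r -> 0 <= B ->
  jointly_measurable P ->
  (forall rho s, 0 <= P rho s) ->
  (forall rho : R, (0 <= rho)%R ->
    \int[mu]_s (if (0 <= s)%R then P rho s else 0)%:E <= (B * weight rho ^+ 5)%:E)%E ->
  (\int[mu]_t duhamel_abs P r t <= (B * decay r)%:E)%E.
Proof.
move=> r0 B0 mP P0 PB; have r0' := ltW r0; have mw := @measurable_weight R.
have k0 : 0 <= (2 * r)^-1 by rewrite invr_ge0 mulr_ge0.
have P0' rho s : 0 <= rho -> 0 <= s -> 0 <= P rho s by move=> *; exact: P0.
have K0 t s rho : (0 <= duhamel_kernel P r t s rho)%E by exact: duhamel_kernel_ge0.
have mKt d (T : measurableType d) (f g : T -> R) : measurable_fun setT f -> measurable_fun setT g ->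
   measurable_fun setT (fun z => \int[mu]_t duhamel_kernel P r t (f z) (g z))%E.
  move=> mf mg; apply: (measurable_fun_ge0_integral
    (f := fun z t => duhamel_kernel P r t (f z) (g z))) => //.
  by apply: measurable_duhamel_kernel; mfun.
have -> : (\int[mu]_t duhamel_abs P r t = \int[mu]_s \int[mu]_t
  \int[mu]_rho duhamel_kernel P r t s rho)%E.
  apply: (tonelli (f := fun t s => \int[mu]_rho duhamel_kernel P r t s rho)%E).
  - by apply: measurable_duhamel_kernel_integral; mfun.
  - by move=> t s; exact: integral_ge0.
have -> : (\int[mu]_s \int[mu]_t \int[mu]_rho duhamel_kernel P r t s rho =
    \int[mu]_s \int[mu]_rho \int[mu]_t duhamel_kernel P r t s rho)%E.
  apply: eq_integral => s _; apply: (tonelli (f := fun t rho => duhamel_kernel P r t s rho)) => //.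
  by apply: measurable_duhamel_kernel; mfun.
rewrite (tonelli (f := fun s rho => \int[mu]_t duhamel_kernel P r t s rho)%E); last 2 first.
- by apply: mKt; mfun.
- by move=> s rho; exact: integral_ge0.
apply: (@le_trans _ _ (\int[mu]_rho
  ((B * decay r)%:E * (if 0 <= rho then weight rho ^+ 2 else 0)%:E))%E); last first.
  by rewrite integral_cst_weight2// mulr_ge0// divr_ge0// le_min r0' ler01.
apply: ge0_le_integral => //.
- by move=> rho _; apply: integral_ge0 => s _; exact: integral_ge0.
- apply: (measurable_fun_ge0_integral
    (f := fun rho s => \int[mu]_t duhamel_kernel P r t s rho)%E) => [|rho s];
      last exact: integral_ge0.
  by apply: mKt; mfun.
- by apply: emeasurable_funM; mfun.
move=> rho _; case: ifPn => rho0; last first.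
  rewrite mule0 integral0_eq// => s _; apply: integral0_eq => t _; rewrite /duhamel_kernel ifF//.
  by apply/negP => /andP[_ /triangle_ge0[_ rr _]]; rewrite rr in rho0.
have m0 : 0 <= Num.min r rho by rewrite le_min r0'.
apply: (@le_trans _ _ (\int[mu]_s ((r^-1 * Num.min r rho * rho)%:E *
  (if 0 <= s then P rho s else 0)%:E))%E).
  have mP1 : measurable_fun setT (P rho) by exact: (measurableT_comp mP (pair1_measurable rho)).
  apply: ge0_le_integral => //.
  - by move=> s _; exact: integral_ge0.
  - by apply: mKt; mfun.
  - by apply: emeasurable_funM; mfun.
  move=> s _; case: ifPn => s0; last first.
    rewrite mule0 integral0_eq// => t _; rewrite /duhamel_kernel ifF//.
    by apply/negP => /andP[s0' _]; rewrite s0' in s0.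
  have c0 : 0 <= (2 * r)^-1 * (rho * P rho s) by rewrite mulr_ge0// mulr_ge0.
  have := triangle_time_integral_le (- s) (normr1 R) r0' rho0 c0.
  rewrite -EFinM (_ : _ * (2 * _) = r^-1 * Num.min r rho * rho * P rho s); last by field;
    rewrite gt_eqF.
  apply: le_trans; rewrite le_eqVlt; apply/orP; left; apply/eqP.
  by apply: eq_integral => t _; rewrite /duhamel_kernel s0 mul1r.
rewrite ge0_integral_cstM; last 3 first.
- by rewrite mulr_ge0// mulr_ge0// invr_ge0.
- have mP1 : measurable_fun setT (P rho) by exact: (measurableT_comp mP (pair1_measurable rho)).
  by mfun.
- by move=> s; rewrite lee_fin; case: ifP.
apply: le_trans (lee_wpmul2l _ (PB _ rho0)) _;
  first by rewrite lee_fin mulr_ge0// mulr_ge0// invr_ge0.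
rewrite -!EFinM lee_fin -mulrA mulrCA mulrA -[leRHS]mulrA -mulrA ler_wpM2l//.
by apply: le_trans (duhamel_kernel_decay r0 rho0); rewrite -!mulrA mulrCA.
Qed.

End duhamel.

(** * The nonlinear correction of an outgoing wave *)

Section elementary.
Context (R : realType).

Lemma expr_sub_le (a b c : R) (n : nat) : `|a| <= c -> `|b| <= c ->
  `|a ^+ n.+1 - b ^+ n.+1| <= n.+1%:R * c ^+ n * `|a - b|.
Proof.
move=> ac bc; have c0 : 0 <= c by apply: le_trans ac.
rewrite subrXX normrM mulrC ler_wpM2r//.
apply: le_trans (ler_norm_sum _ _ _) _.
rewrite mulr_natl -[n.+1 in leRHS]card_ord -sumr_const ler_sum// => i _.
rewrite normrM !normrX /= -[X in c ^+ X](subnK (leq_ord i)) exprD.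
by rewrite ler_pM ?exprn_ge0// lerXn2r// nnegrE.
Qed.

Lemma exprD_le (a b : R) (n : nat) : 0 <= a -> 0 <= b ->
  (a + b) ^+ n <= 2 ^+ n * (a ^+ n + b ^+ n).
Proof.
move=> a0 b0; wlog ab : a b a0 b0 / a <= b.
  by move=> H; have [/H|/ltW/H] := leP a b; [exact|rewrite [b + a]addrC [_ ^+ _ + _]addrC; exact].
have an : 0 <= a ^+ n by exact: exprn_ge0.
apply: (@le_trans _ _ ((2 * b) ^+ n)).
  by rewrite lerXn2r ?nnegrE ?addr_ge0 ?mulr_ge0//; lra.
by rewrite exprMn ler_wpM2l ?exprn_ge0// lerDr.
Qed.

(** The sequences x_n + C 2^-n and x_n - C 2^-n are monotone and squeeze x_n, which yields the limit
    together with the error bound. *)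
Lemma cvg_of_geometric_steps (x : R^nat) (C : R) :
  (forall n, `|x n.+1 - x n| <= C * 2^-1 ^+ n.+1) ->
  exists2 l, x @ \oo --> l & forall n, `|l - x n| <= C * 2^-1 ^+ n.
Proof.
move=> xC; have C0 : 0 <= C.
  by have := le_trans (normr_ge0 _) (xC 0%N); rewrite pmulr_lge0// exprn_gt0.
have h0 (n : nat) : 0 <= C * 2^-1 ^+ n by rewrite mulr_ge0// exprn_ge0.
have hS (n : nat) : C * 2^-1 ^+ n = C * 2^-1 ^+ n.+1 + C * 2^-1 ^+ n.+1.
  by rewrite exprS; field.
pose y n := x n + C * 2^-1 ^+ n; pose z n := x n - C * 2^-1 ^+ n.
have yS : {homo y : n m / (n <= m)%N >-> m <= n}.
  apply/nonincreasing_seqP => n; rewrite /y; have := hS n.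
  by have := xC n; rewrite ler_norml => /andP[_]; lra.
have zS : {homo z : n m / (n <= m)%N >-> n <= m}.
  apply/nondecreasing_seqP => n; rewrite /z; have := hS n.
  by have := xC n; rewrite ler_norml => /andP[]; lra.
have cy : cvgn y.
  apply: nonincreasing_is_cvgn => //; exists (z 0%N) => _ [n _ <-].
  by apply: le_trans (zS _ _ (leq0n n)) _; rewrite /z /y; have := h0 n; lra.
have cg : (fun n => C * 2^-1 ^+ n : R) @ \oo --> (0 : R).
  by apply: cvg_geometric; rewrite ger0_norm// invf_lt1// ltr1n.
have cx : x @ \oo --> limn y.
  rewrite (_ : x = fun n => y n - C * 2^-1 ^+ n); last by apply/funext => n; rewrite /y addrK.
  by rewrite -[limn y]subr0; exact: (cvgB cy cg).
have cz : z @ \oo --> limn y.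
  by rewrite -[limn y]subr0; exact: (cvgB cx cg).
exists (limn y) => // n; rewrite ler_norml.
have := nonincreasing_cvgn_ge yS cy n.
have := nondecreasing_cvgn_le zS (cvgP _ cz) n; rewrite (cvg_lim _ cz)//.
by rewrite /z /y => H1 H2; apply/andP; split; lra.
Qed.

Lemma geometric_le0 (x C : R) : (forall n, x <= C * 2^-1 ^+ n) -> x <= 0.
Proof.
move=> xC.
have cg : (fun n => C * 2^-1 ^+ n : R) @ \oo --> (0 : R).
  by apply: cvg_geometric; rewrite ger0_norm// invf_lt1// ltr1n.
rewrite -(cvg_lim _ cg)//; apply: limr_ge; first exact: cvgP cg.
exact: nearW.
Qed.

End elementary.

Section perturbation.
Context (R : realType).
Notation mu := (@lebesgue_measure R).
Notation jointly_measurable F := (measurable_fun setT (fun z : R * R => F z.1 z.2)).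
Variables (h : R -> R) (A sigma : R) (N : nat).
Hypothesis mh : measurable_fun setT h.
Hypothesis h_ge0 : forall y, 0 <= h y.
Hypothesis h_le : forall y, 0 <= y -> h y <= A * y.
Hypothesis h_supp : forall y, ~~ ((0 <= y) && (y <= 1)) -> h y = 0.
Hypothesis N4 : (4 <= N)%N.
Hypothesis sigma1 : `|sigma| = 1.

(** Both the radius of the ball for [w] and the bound on the masses. It satisfies (N + 1) 2^N
    smallness = 1/8, where N + 1 comes from differentiating the power N + 1 and 2^N from splitting
    (v + w)^N. *)
Definition smallness : R := (N.+1%:R * 2 ^+ (N + 3))^-1.
Hypothesis massN : (mass h N <= smallness%:E)%E.
Hypothesis massSN : (mass h N.+1 <= (smallness / 2)%:E)%E.

Notation v := (outgoing h).
Implicit Types w : R -> R -> R.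

(** For even N this is |u|^N u at u = v + w. *)
Definition source w rho s : R := (v rho s + w rho s) ^+ N.+1.
Definition response w r t : R := - sigma * duhamel (source w) r t.
Definition small w : Prop := jointly_measurable w /\
  forall r t, `|w r t| <= smallness * weight r.

Let A_ge0 : 0 <= A.
Proof. by have := h_le ler01; have := h_ge0 1; lra. Qed.

Let smallness_gt0 : 0 < smallness.
Proof. by rewrite invr_gt0 mulr_gt0// ?exprn_gt0// ltr0n. Qed.

Let smallness_eq : N.+1%:R * 2 ^+ N * smallness = 8^-1.
Proof.
rewrite /smallness exprD; field.
by rewrite nat1r pnatr_eq0 expf_neq0//.
Qed.

Let smallness_eq' : 2 ^+ N * smallness <= 8^-1.
Proof.
rewrite -smallness_eq -mulrA ler_peMl ?mulr_ge0 ?exprn_ge0 ?(ltW smallness_gt0)//.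
by rewrite ler1n.
Qed.

Let smallness_le1 : smallness <= 1.
Proof.
have : 1 * smallness <= 2 ^+ N * smallness
  by rewrite ler_wpM2r ?(ltW smallness_gt0)// exprn_ege1// ler1n.
by have := smallness_eq'; lra.
Qed.

Let smallness_N : smallness ^+ N <= smallness.
Proof.
by rewrite -[leRHS]expr1; apply: ler_wiXn2l; rewrite ?(ltW smallness_gt0)//; case: (N) N4.
Qed.

Let w_ge0 r : 0 <= weight r :> R. Proof. exact/ltW/weight_gt0. Qed.

Let mv : jointly_measurable v.
Proof. exact: measurable_outgoing. Qed.

Lemma measurable_source w : small w -> measurable_fun setT (fun z : R * R => source w z.1 z.2).
Proof. by move=> [mw _]; rewrite /source; mfun. Qed.

Lemma source_le w : small w -> forall rho s,
  `|source w rho s| <= ((2 * A + smallness) * weight rho) ^+ N.+1.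
Proof.
move=> [_ wle] rho s; rewrite normrX lerXn2r ?nnegrE ?mulr_ge0 ?addr_ge0 ?mulr_ge0 ?(ltW smallness_gt0)//.
apply: le_trans (ler_normD _ _) _; rewrite mulrDl lerD// ger0_norm; last exact: outgoing_ge0.
exact: outgoing_le.
Qed.

Lemma source_bounded w : small w -> forall rho s,
  `|source w rho s| <= (2 * A + smallness) ^+ N.+1.
Proof.
move=> sw rho s; apply: le_trans (source_le sw rho s) _.
have K0 : 0 <= 2 * A + smallness by rewrite addr_ge0 ?mulr_ge0 ?(ltW smallness_gt0).
by rewrite lerXn2r ?nnegrE ?mulr_ge0// ler_piMr// weight_le1.
Qed.

Let weight5 (rho : R) : weight rho ^+ N.+1 <= weight rho ^+ 5.
Proof. by apply: ler_wiXn2l => //; exact: weight_le1. Qed.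

(** The difference of sources is at most (N + 1) 2^N (v^N + smallness^N weight^N) c weight. The v^N
    part is controlled by [mass h N], the other by [duhamel_abs_weight]. Together they give (1/8)
    (3/2) c decay(r), hence at most 3/8 of c weight(r). *)
Lemma response_lipschitz (c : R) w w' : 0 <= c -> small w -> small w' ->
  (forall r t, `|w r t - w' r t| <= c * weight r) ->
  forall r t, `|response w r t - response w' r t| <= c / 2 * weight r.
Proof.
move=> c0 sw sw' ww' r t.
have cw0 : 0 <= c / 2 * weight r by rewrite !mulr_ge0// invr_ge0.
rewrite /response -mulrBr normrM normrN sigma1 mul1r.
have [r0|r0] := ltP 0 r; last first.
  by rewrite !duhamel_eq0 ?subr0 ?normr0//; apply/negP => /andP[]; rewrite ltNge r0.
pose k := N.+1%:R * 2 ^+ N * c.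
have k0 : 0 <= k by rewrite !mulr_ge0// exprn_ge0.
have mvN : measurable_fun setT (fun z : R * R => v z.1 z.2 ^+ N) by mfun.
have mw5 : measurable_fun setT (fun z : R * R => weight z.1 ^+ 5).
  by have mw := @measurable_weight R; mfun.
have vN0 rho s : 0 <= v rho s ^+ N by rewrite exprn_ge0// outgoing_ge0.
have w50 (rho _s : R) : 0 <= weight rho ^+ 5 by rewrite exprn_ge0.
have keta0 : 0 <= k * smallness ^+ N by rewrite mulr_ge0// exprn_ge0// ltW.
rewrite -lee_fin.
have main : (`|duhamel (source w) r t - duhamel (source w') r t|%:E <=
    duhamel_abs (fun rho s => (k * v rho s ^+ N + k * smallness ^+ N * weight rho ^+ 5)%R) r t)%E.
  apply: (@duhamel_sub_le _ ((2 * A + smallness) ^+ N.+1)) => //.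
  - exact: measurable_source.
  - exact: measurable_source.
  - by mfun.
  - exact: source_bounded.
  - exact: source_bounded.
  move=> rho s rho0 s0; rewrite /source.
  have v0 : 0 <= v rho s by exact: outgoing_ge0.
  have ew0 : 0 <= smallness * weight rho by rewrite mulr_ge0// ltW.
  apply: le_trans (@expr_sub_le _ _ _ (v rho s + smallness * weight rho) N _ _) _.
  - by apply: le_trans (ler_normD _ _) _; rewrite ger0_norm// lerD2l; exact: sw.2.
  - by apply: le_trans (ler_normD _ _) _; rewrite ger0_norm// lerD2l; exact: sw'.2.
  have -> : v rho s + w rho s - (v rho s + w' rho s) = w rho s - w' rho s by ring.
  apply: (@le_trans _ _ (N.+1%:R * (2 ^+ N * (v rho s ^+ N + (smallness * weight rho) ^+ N)) *
    (c * weight rho))).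
    by rewrite ler_pM ?mulr_ge0 ?exprn_ge0 ?addr_ge0// ler_wpM2l// exprD_le.
  have -> : N.+1%:R * (2 ^+ N * (v rho s ^+ N + (smallness * weight rho) ^+ N)) * (c * weight rho) =
     k * (v rho s ^+ N * weight rho) + k * smallness ^+ N * (weight rho ^+ N.+1).
    by rewrite /k exprMn exprSr; ring.
  apply: lerD; apply: ler_wpM2l => //.
  by rewrite ler_piMr// weight_le1.
apply: le_trans main _; rewrite duhamel_abs_lin//.
have d0 : 0 <= decay r by rewrite divr_ge0 ?(ltW r0)// le_min (ltW r0) ler01.
apply: (@le_trans _ _ (k%:E * ((2^-1 * decay r)%:E * smallness%:E) + (k * smallness ^+ N)%:E *
  (decay r)%:E)%E).
  apply: leeD; apply: lee_wpmul2l; rewrite ?lee_fin//; last exact: duhamel_abs_weight.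
  apply: le_trans (duhamel_abs_outgoing (A := A) _ _ _ _ _ _ _) _ => //;
    first by case: (N) N4 => [|[|[|]]].
  by apply: lee_wpmul2l => //; rewrite lee_fin mulr_ge0// invr_ge0.
rewrite -!EFinM -EFinD lee_fin.
apply: (@le_trans _ _ (k * smallness * (3 / 2) * decay r)).
  have : k * smallness ^+ N * decay r <= k * smallness * decay r by rewrite ler_wpM2r// ler_wpM2l.
  by lra.
have := decay_le r0; have := w_ge0 r; have := smallness_eq => e1 w0 dw.
have -> : k * smallness * (3 / 2) * decay r =
  (N.+1%:R * 2 ^+ N * smallness) * (c * (3 / 2 * decay r)) by rewrite /k; ring.
rewrite e1.
have : c * decay r <= c * (2 * weight r) by rewrite ler_wpM2l.
have : 0 <= c * weight r by rewrite mulr_ge0.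
by lra.
Qed.

Lemma small0 : small (fun _ _ => 0).
Proof. by split=> [|r t]; [mfun|rewrite normr0 mulr_ge0// ltW]. Qed.

Lemma response0_le r t : `|response (fun _ _ => 0) r t| <= smallness / 2 * weight r.
Proof.
have ew0 : 0 <= smallness / 2 * weight r by rewrite !mulr_ge0// ?invr_ge0// ltW.
rewrite /response normrM normrN sigma1 mul1r.
have [r0|r0] := ltP 0 r; last first.
  by rewrite !duhamel_eq0 ?normr0//; apply/negP => /andP[]; rewrite ltNge r0.
rewrite -lee_fin.
apply: (@le_trans _ _ (duhamel_abs (fun rho s => (v rho s ^+ N.+1)%R) r t)).
  apply: (@duhamel_le _ ((2 * A + smallness) ^+ N.+1)) => //.
  - exact: measurable_source small0.
  - by mfun.
  - exact: source_bounded small0.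
  move=> rho s rho0 s0; rewrite /source addr0 ger0_norm// exprn_ge0//; exact: outgoing_ge0.
have d0 : 0 <= decay r by rewrite divr_ge0 ?(ltW r0)// le_min (ltW r0) ler01.
apply: le_trans (duhamel_abs_outgoing (A := A) _ _ _ _ _ _ _) _ => //;
  first by case: (N) N4 => [|[|]].
apply: (@le_trans _ _ ((2^-1 * decay r)%:E * (smallness / 2)%:E)%E).
  by apply: lee_wpmul2l => //; rewrite lee_fin mulr_ge0// invr_ge0.
rewrite -EFinM lee_fin.
have := decay_le r0; have := smallness_gt0 => e0 dw.
have : smallness / 2 * decay r <= smallness / 2 * (2 * weight r)
  by rewrite ler_wpM2l// divr_ge0// ltW.
by lra.
Qed.

Definition picard (n : nat) : R -> R -> R := iter n response (fun _ _ => 0).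

Lemma measurable_response w : small w -> measurable_fun setT (fun z : R * R => response w z.1 z.2).
Proof.
move=> sw; rewrite /response; have := measurable_duhamel (measurable_source sw).
by move=> ?; mfun.
Qed.

Lemma picard_small n : small (picard n) /\
  (forall r t, `|picard n.+1 r t - picard n r t| <= smallness * 2^-1 ^+ n.+1 * weight r).
Proof.
(* The induction carries the sharper bound with 1 - 2^-n, the sum of the geometric steps taken so
   far; this keeps every iterate inside the ball. *)
suff H : (small (picard n) /\ forall r t, `|picard n r t| <= smallness *
  (1 - 2^-1 ^+ n) * weight r) /\
  (forall r t, `|picard n.+1 r t - picard n r t| <= smallness * 2^-1 ^+ n.+1 * weight r).
  by case: H => [[]].
elim: n => [|n [[sn bn] dn]].
  split; first by split=> [|r t]; [exact: small0|rewrite expr0 subrr mulr0 mul0r normr0].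
  by move=> r t; rewrite /picard/= subr0 expr1; exact: response0_le.
have hn : 0 <= 2^-1 ^+ n.+1 :> R by rewrite exprn_ge0.
have bn1 r t : `|picard n.+1 r t| <= smallness * (1 - 2^-1 ^+ n.+1) * weight r.
  rewrite -(subrK (picard n r t) (picard n.+1 r t)).
  apply: le_trans (ler_normD _ _) _; apply: le_trans (lerD (dn r t) (bn r t)) _.
  by rewrite -mulrDl ler_wpM2r// -mulrDr ler_wpM2l ?(ltW smallness_gt0)// !exprS; lra.
have sn1 : small (picard n.+1).
  split; first exact: measurable_response.
  move=> r t; apply: le_trans (bn1 r t) _; rewrite ler_wpM2r//.
  by rewrite ler_piMr ?(ltW smallness_gt0)//; lra.
split=> //; move=> r t; apply: le_trans (response_lipschitz _ sn1 sn dn r t) _.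
  by rewrite mulr_ge0// ltW.
by rewrite [2^-1 ^+ n.+2]exprSr mulrA.
Qed.

Definition time_const : R := 2 ^+ N.+2 * (2 * A) ^+ N.+1.

Lemma time_const_ge0 : 0 <= time_const.
Proof. by rewrite mulr_ge0 ?exprn_ge0// mulr_ge0. Qed.

(** At a fixed radius the wave is seen only for times in [rho - 1, rho], an interval of length 1,
    where it is at most 2 A weight(rho). *)
Lemma integral_outgoing_le (p : nat) (rho : R) : (0 < p)%N ->
  (\int[mu]_s (v rho s ^+ p)%:E <= ((2 * A * weight rho) ^+ p)%:E)%E.
Proof.
move=> p0; have mv1 : measurable_fun setT (v rho)
  by exact: (measurableT_comp mv (pair1_measurable rho)).
have c0 : 0 <= (2 * A * weight rho) ^+ p by rewrite exprn_ge0// mulr_ge0// mulr_ge0.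
have := integral_if_cst (a := rho - 1) (b := rho) ((2 * A * weight rho) ^+ p).
rewrite (_ : rho - (rho - 1) = 1); last by ring.
rewrite mulr1 => <-; last by rewrite gerBl.
apply: ge0_le_integral => //.
- by move=> s _; rewrite lee_fin exprn_ge0// outgoing_ge0.
- by mfun.
- by mfun.
move=> s _; rewrite lee_fin; case: ifPn => [_|sr].
  rewrite lerXn2r ?nnegrE ?mulr_ge0 ?outgoing_ge0//; exact: outgoing_le.
rewrite /outgoing h_supp; first by rewrite mul0r if_same expr0n; case: (p) p0.
by apply: contra sr => /andP[? ?]; apply/andP; split; lra.
Qed.

(** The source is at most 2^(N+1) (v^(N+1) + |w|^(N+1)), and N of the factors |w| are estimated
    pointwise by smallness times weight. The remaining one keeps the time integral linear in B, with
    coefficient 4 2^N smallness^N <= 1/2. *)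
Lemma integral_response_le (B : R) w : 0 <= B -> small w ->
  (forall r, \int[mu]_t `|w r t|%:E <= (B * weight r)%:E)%E ->
  forall r, (\int[mu]_t `|response w r t|%:E <= ((time_const + B / 2) * weight r)%:E)%E.
Proof.
move=> B0 sw wB r; have [mw wle] := sw.
have mwt := @measurable_weight R.
have b0 : 0 <= time_const + B / 2 by rewrite addr_ge0 ?time_const_ge0// divr_ge0.
have [r0|r0] := ltP 0 r; last first.
  rewrite integral0_eq ?lee_fin ?mulr_ge0// => t _; rewrite /response duhamel_eq0 ?mulr0 ?normr0//.
  by apply/negP => /andP[]; rewrite ltNge r0.
pose P rho s := 2 ^+ N.+1 * (v rho s ^+ N.+1 + smallness ^+ N * weight rho ^+ N * `|w rho s|).
have P0 rho s : 0 <= P rho s.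
  rewrite mulr_ge0 ?exprn_ge0// addr_ge0 ?exprn_ge0 ?outgoing_ge0//.
  by rewrite mulr_ge0// mulr_ge0// exprn_ge0// ltW.
have mP : jointly_measurable P by rewrite /P; mfun.
have le1 t : (`|response w r t|%:E <= duhamel_abs P r t)%E.
  rewrite /response normrM normrN sigma1 mul1r.
  apply: (@duhamel_le _ ((2 * A + smallness) ^+ N.+1)) => //.
  - exact: measurable_source.
  - exact: source_bounded.
  move=> rho s rho0 s0; rewrite /source normrX.
  have v0 : 0 <= v rho s by exact: outgoing_ge0.
  apply: (@le_trans _ _ ((v rho s + `|w rho s|) ^+ N.+1)).
    rewrite lerXn2r ?nnegrE ?addr_ge0//.
    by apply: le_trans (ler_normD _ _) _; rewrite ger0_norm.
  apply: le_trans (exprD_le _ _ _) _ => //.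
  rewrite /P ler_wpM2l ?exprn_ge0// lerD2l exprSr ler_wpM2r// -exprMn.
  by rewrite lerXn2r ?nnegrE ?mulr_ge0// ltW.
apply: (@le_trans _ _ (\int[mu]_t duhamel_abs P r t)%E).
  have mr := measurable_response sw.
  have mr1 : measurable_fun setT (response w r)
    by exact: (measurableT_comp mr (pair1_measurable r)).
  apply: ge0_le_integral => //; first by mfun.
  by apply: measurable_duhamel_abs => // *; exact: P0.
pose B' := 2 ^+ N.+1 * ((2 * A) ^+ N.+1 + smallness ^+ N * B).
have B'0 : 0 <= B'.
  by rewrite !mulr_ge0 ?exprn_ge0// addr_ge0 ?exprn_ge0 ?mulr_ge0 ?exprn_ge0// ltW.
apply: le_trans (integral_duhamel_abs_le (B := B') r0 B'0 mP P0 _) _.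
  move=> rho rho0.
  have mv1 : measurable_fun setT (v rho) by exact: (measurableT_comp mv (pair1_measurable rho)).
  have mw1 : measurable_fun setT (w rho) by exact: (measurableT_comp mw (pair1_measurable rho)).
  have e0 : 0 <= smallness ^+ N * weight rho ^+ N by rewrite mulr_ge0 ?exprn_ge0// ltW.
  pose e := 2 ^+ N.+1 * (smallness ^+ N * weight rho ^+ N).
  have e'0 : 0 <= e by rewrite mulr_ge0// exprn_ge0.
  have n0 : 0 <= 2 ^+ N.+1 :> R by rewrite exprn_ge0.
  apply: (@le_trans _ _ (\int[mu]_s ((2 ^+ N.+1)%:E *
    (v rho s ^+ N.+1)%:E + e%:E * `|w rho s|%:E))%E).
    apply: ge0_le_integral => //.
    - by move=> s _; rewrite lee_fin; case: ifP.
    - have mP1 : measurable_fun setT (P rho) by exact: (measurableT_comp mP (pair1_measurable rho)).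
      by mfun.
    - by apply: emeasurable_funD; apply: emeasurable_funM; mfun.
    move=> s _; apply: (@le_trans _ _ (P rho s)%:E); first by rewrite lee_fin; case: ifP.
    by rewrite -EFinM -EFinM -EFinD lee_fin /P mulrDr mulrA.
  rewrite ge0_integral_lincomb//; [|by mfun|by mfun|]; last first.
    by move=> s; rewrite lee_fin exprn_ge0// outgoing_ge0.
  apply: (@le_trans _ _ ((2 ^+ N.+1)%:E * ((2 * A * weight rho) ^+ N.+1)%:E + e%:E *
    (B * weight rho)%:E)%E).
    apply: leeD; first by apply: lee_wpmul2l; [rewrite lee_fin|exact: integral_outgoing_le].
    by apply: lee_wpmul2l; [rewrite lee_fin|exact: wB].
  rewrite -EFinM -EFinM -EFinD lee_fin.
  have -> : 2 ^+ N.+1 * (2 * A * weight rho) ^+ N.+1 + e * (B * weight rho) =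
    B' * weight rho ^+ N.+1.
    by rewrite /e /B' exprMn [weight rho ^+ N.+1]exprSr; ring.
  exact: ler_wpM2l.
rewrite lee_fin; apply: (@le_trans _ _ (B' * (2 * weight r)));
  first by rewrite ler_wpM2l// decay_le.
rewrite mulrA ler_wpM2r// /B' /time_const.
have : 2 ^+ N * smallness ^+ N * B <= 8^-1 * B.
  by rewrite ler_wpM2r//; apply: le_trans smallness_eq'; rewrite ler_wpM2l ?exprn_ge0.
by rewrite !(exprS 2); lra.
Qed.

(** The constant 2 [time_const] is the fixed point of B -> time_const + B / 2. *)
Lemma integral_picard_le n r : (\int[mu]_t `|picard n r t|%:E <= (2 * time_const * weight r)%:E)%E.
Proof.
have c0 := time_const_ge0.
elim: n r => [|n IH] r.
  rewrite integral0_eq; first by rewrite lee_fin mulr_ge0// mulr_ge0.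
  by move=> t _; rewrite /picard/= normr0.
apply: le_trans (integral_response_le _ (picard_small n).1 IH r) _; first by rewrite mulr_ge0.
by rewrite lee_fin ler_wpM2r//; lra.
Qed.

(** The iterates converge pointwise at a geometric rate uniform up to the weight, so the limit is
    measurable, lies in the ball, and satisfies the equation by [response_lipschitz]. *)
Lemma response_fixpoint : exists w, [/\ small w, forall r t, w r t = response w r t &
  forall r, (\int[mu]_t `|w r t|%:E <= (2 * time_const * weight r)%:E)%E].
Proof.
have step r t n : `|picard n.+1 r t - picard n r t| <= smallness * weight r * 2^-1 ^+ n.+1.
  by rewrite mulrAC; exact: (picard_small n).2.
have /choice[w wP] : forall z : R * R, exists l, picard ^~ z.1 ^~ z.2 @ \oo --> l /\
    forall n, `|l - picard n z.1 z.2| <= smallness * weight z.1 * 2^-1 ^+ n.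
  move=> z; have [l l1 l2] := cvg_of_geometric_steps (step z.1 z.2).
  by exists l.
have mp n := (picard_small n).1.1.
have mw : measurable_fun setT w.
  by apply: (measurable_fun_cvg (h := fun n z => picard n z.1 z.2)) => // z _; exact: (wP z).1.
pose W r t := w (r, t).
have sW : small W.
  split; first by rewrite /W; under eq_fun do rewrite -surjective_pairing.
  by move=> r t; have := (wP (r, t)).2 0%N; rewrite /picard/= subr0 expr0 mulr1.
exists W; split=> //.
  move=> r t; apply/eqP; rewrite -subr_eq0 -normr_le0.
  apply: (@geometric_le0 _ _ (smallness * weight r)) => n.
  rewrite -(subrKA (picard n.+1 r t)); apply: le_trans (ler_normD _ _) _.
  have h1 := (wP (r, t)).2 n.+1.
  have h2 : `|picard n.+1 r t - response W r t| <= smallness * 2^-1 ^+ n / 2 * weight r.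
    rewrite distrC; apply: response_lipschitz => //; [|exact: (picard_small n).1|].
      by rewrite mulr_ge0 ?exprn_ge0// ltW.
    by move=> r' t'; have := (wP (r', t')).2 n; rewrite mulrAC.
  apply: le_trans (lerD h1 h2) _; rewrite exprS /=.
  by rewrite le_eqVlt; apply/orP; left; apply/eqP; field.
move=> r.
have mp1 n : measurable_fun setT (fun t => `|picard n r t|%:E).
  have mp2 : measurable_fun setT (picard n r)
    by exact: (measurableT_comp (mp n) (pair1_measurable r)).
  by mfun.
(* Pointwise convergence alone does not pass to the time integral; Fatou's lemma carries over the
   bound, uniform in n. *)
have := @fatou _ _ _ mu setT measurableT (fun n t => `|picard n r t|%:E) mp1 (fun n t _ => _).
have -> : (\int[mu]_t limn_einf (fun n => `|picard n r t|%:E) = \int[mu]_t `|W r t|%:E)%E.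
  apply: eq_integral => t _; apply: (cvg_limn_einf_sup _).1.
  by apply: cvg_EFin; [exact: nearW|apply: cvg_norm; exact: (wP (r, t)).1].
move=> /(_ (fun n t => normr_ge0 _)) H; apply: le_trans H _.
rewrite limn_einf_lim; apply: lime_le; first exact: is_cvg_einfs.
apply: nearW => n; apply: le_trans (integral_picard_le n r).
by apply: ereal_inf_lbound; exists n => /=.
Qed.

End perturbation.

Section symbols.
Context (R : realType).

Lemma normr_sin_le (x : R) : `|sin x| <= `|x|.
Proof.
have [x0|x0] := leP 0 x; first by rewrite (ger0_norm x0) norm_sin_le.
by rewrite -normrN -sinN (ltr0_norm x0) norm_sin_le// oppr_ge0 ltW.
Qed.

Lemma sinc_symbol_le (tau k : R) : `|sinc_symbol tau k| <= `|tau|.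
Proof.
rewrite /sinc_symbol; case: eqVneq => // k0.
by rewrite normrM normfV ler_pdivrMr ?normr_gt0// -normrM normr_sin_le.
Qed.

Lemma measurable_sinc_symbol (tau : R) : measurable_fun setT (sinc_symbol tau).
Proof.
rewrite /sinc_symbol; apply: measurable_fun_if => //.
- by apply: measurable_fun_eqr; mfun.
- apply: measurable_funTS.
  have ms : measurable_fun setT (fun k : R => sin (tau * k)).
    by apply: measurable_fun_comp_continuous; [exact: continuous_sin|mfun].
  by mfun.
Qed.

Lemma measurable_cos_symbol (t : R) : measurable_fun setT (cos_symbol t).
Proof. by rewrite /cos_symbol; apply: measurable_fun_comp_continuous; [exact: continuous_cos|mfun].
Qed.

End symbols.

(** * The perturbed wave is a mild solution *)

Section mild.
Context (R : realType).
Notation mu := (@lebesgue_measure R).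
Variables (h g : R -> R) (A M sigma : R) (N : nat).
Hypothesis mh : measurable_fun setT h.
Hypothesis h_ge0 : forall y, 0 <= h y.
Hypothesis h_le : forall y, 0 <= y -> h y <= A * y.
Hypothesis h_supp : forall y, ~~ ((0 <= y) && (y <= 1)) -> h y = 0.
Hypothesis mg : measurable_fun setT g.
Hypothesis g_le : forall y, `|g y| <= M.
Hypothesis g_supp : forall y, ~~ ((0 < y) && (y <= 1)) -> g y = 0.
Hypothesis gh : forall a b, 0 <= a -> a <= b ->
  \int[mu]_y (if (a <= y) && (y <= b) then g y else 0) = h b - h a.
Hypothesis N4 : (4 <= N)%N.
Hypothesis N_even : ~~ odd N.
Variable w : R -> R -> R.
Hypothesis sw : small N w.
Hypothesis wE : forall r t, w r t = response h sigma N w r t.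

Let h_bound y : `|h y| <= A.
Proof.
have A0 : 0 <= A by have := h_le ler01; have := h_ge0 1; lra.
rewrite ger0_norm//; have [/andP[y0 y1]|/h_supp->//] := boolP ((0 <= y) && (y <= 1)).
by apply: le_trans (h_le y0) _; rewrite ler_piMr.
Qed.

Definition u0 (x : R * R * R) : R := h (enorm x) / enorm x.
Definition u1 (x : R * R * R) : R := - g (enorm x) / enorm x.
Definition solution (x : R * R * R) (t : R) : R :=
  outgoing h (enorm x) t + w (enorm x) t.

(** The velocity term contributes - (h (r + t) - h |r - t|) / (2 r). It cancels the incoming h (r +
    t), and h |r - t| = h (r - t) + h (t - r) since one of the two vanishes; what is left is 2 h (r
    - t) / (2 r). *)
Lemma free_evolution r t : 0 < r -> 0 <= t ->
  dalembert h t r + spherical_mean t (fun rho => - g rho / rho) r = outgoing h r t.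
Proof.
move=> r0 t0.
have h00 : h 0 = 0 by apply/le_anti; rewrite h_ge0 andbT (le_trans (h_le (lexx 0)))// mulr0.
have hneg y : y <= 0 -> h y = 0.
  rewrite le_eqVlt => /orP[/eqP->//|y0]; apply: h_supp.
  by rewrite (leNgt 0 y) y0.
rewrite /spherical_mean.
have -> : (fun rho => if triangle r rho t then rho * (- g rho / rho) else 0) =
    (fun rho => - (if (`|r - t| <= rho) && (rho <= r + t) then g rho else 0)).
  apply/funext => rho; rewrite /triangle; case: ifP => _; last by rewrite oppr0.
  (* The product rho (g(rho) / rho) is 0 at rho = 0, in agreement with g(0) = 0: the support
     condition on [g] excludes 0. *)
  have [->|rn] := eqVneq rho 0; last by field.
  by rewrite mul0r g_supp ?oppr0// ltxx.
have mgt : measurable_fun setT (fun rho => if (`|r - t| <= rho) && (rho <= r + t) then g rho else 0)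
  by mfun.
have -> : \int[mu]_rho - (if (`|r - t| <= rho) && (rho <= r + t) then g rho else 0) =
  - (h (r + t) - h `|r - t|).
  rewrite -gh//; last by rewrite ler_norml; apply/andP; split; lra.
  rewrite -[RHS]mulN1r -RintegralZl//.
    by apply: eq_Rintegral => rho _; rewrite mulN1r.
  apply: (@integrable_bounded_support R 0 1 M) => //.
    by move=> x; case: ifP => // _; rewrite normr0 (le_trans _ (g_le 0)).
  by move=> x x1; case: ifP => // _; apply: g_supp; apply: contra x1 => /andP[/ltW->].
have -> : h `|r - t| = h (r - t) + h (t - r).
  have [rt|tr] := leP t r.
    by rewrite ger0_norm ?subr_ge0// (hneg (t - r)) ?addr0// subr_le0.
  by rewrite ltr0_norm ?subr_lt0// opprB (hneg (r - t)) ?add0r// subr_le0 ltW.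
rewrite /dalembert /outgoing (ltW r0) t0/=; field; exact: lt0r_neq0.
Qed.

Let mv : measurable_fun setT (fun z : R * R => outgoing h z.1 z.2).
Proof. exact: measurable_outgoing. Qed.

Let mS := measurable_source mh sw.

Let K : R := (2 * A + @smallness R N) ^+ N.+1.

Let K_ge0 : 0 <= K.
Proof. by apply: le_trans (normr_ge0 _) (source_bounded h_ge0 h_le h_supp sw 0 0). Qed.

Let source_weight rho s : `|source h N w rho s| <= K * weight rho ^+ 5.
Proof.
apply: le_trans (source_le h_ge0 h_le h_supp sw rho s) _.
rewrite exprMn; apply: ler_wpM2l => //.
by apply: ler_wiXn2l; rewrite ?weight_le1 ?(ltW (weight_gt0 _)).
Qed.

Lemma weight_mul_le1 (rho : R) : 0 <= rho -> 0 <= rho * weight rho <= 1.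
Proof.
move=> rho0; rewrite mulr_ge0 ?(ltW (weight_gt0 _))//= /weight ger0_norm//.
by rewrite ler_pdivrMr ?ltr_pwDl//; lra.
Qed.

Lemma radially_integrable_source s : radially_integrable (source h N w ^~ s).
Proof.
have mw := @measurable_weight R.
have mS1 : measurable_fun setT (source h N w ^~ s)
  by exact: (measurableT_comp mS (pair2_measurable s)).
split; first exact: mS1.
apply/integrableP; split; first by mfun.
apply: (@le_lt_trans _ _ (\int[mu]_rho (K%:E * (if 0 <= rho then weight rho ^+ 2 else 0)%:E))%E);
  last first.
  by rewrite integral_cst_weight2// ltry.
apply: ge0_le_integral => //.
- by mfun.
- by apply: emeasurable_funM; mfun.
move=> rho _; rewrite -EFinM abse_EFin lee_fin; case: ifPn => rho0; last by rewrite normr0 mulr0.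
rewrite normrM ger0_norm ?sqr_ge0//.
apply: le_trans (ler_wpM2l (sqr_ge0 _) (source_weight rho s)) _.
rewrite mulrCA ler_wpM2l//.
have /andP[p0 p1] := weight_mul_le1 rho0.
have -> : rho ^+ 2 * weight rho ^+ 5 = (rho * weight rho) ^+ 2 * weight rho * weight rho ^+ 2
  by ring.
rewrite ler_piMl ?sqr_ge0// mulr_ile1 ?sqr_ge0 ?weight_le1 ?exprn_ile1// ltW// weight_gt0//.
Qed.

Lemma source_mul_le s rho : 0 <= rho -> `|rho * source h N w rho s| <= K.
Proof.
move=> rho0; rewrite normrM ger0_norm//.
apply: le_trans (ler_wpM2l rho0 (source_weight rho s)) _.
rewrite mulrCA ler_piMr//.
have /andP[p0 p1] := weight_mul_le1 rho0.
by rewrite exprS mulrA mulr_ile1// ?exprn_ge0 ?exprn_ile1 ?weight_le1 ?(ltW (weight_gt0 _)).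
Qed.

Lemma solution_source x s : `|solution x s| ^+ N * solution x s = source h N w (enorm x) s.
Proof.
rewrite /source -/(solution x s) exprSr; congr (_ * _).
have -> : N = (2 * N./2)%N by rewrite -[LHS]odd_double_half (negbTE N_even) add0n mul2n.
by rewrite !exprM real_normK// num_real.
Qed.

(** Through [is_multiplier_radial] the three multiplier conditions become the sine-transform
    identities for [dalembert] and [spherical_mean]. The Duhamel formula is [free_evolution]
    combined with the fixed-point equation. *)
Lemma mild_solution_radial : mild_solution N sigma u0 u1 solution.
Proof.
have me := @measurable_enorm R.
have h0r y : 1 < y -> h y = 0.
  by move=> y1; apply: h_supp; rewrite negb_and -!ltNge y1 orbT.
have g0r y : 1 < y -> g y = 0.
  by move=> y1; apply: g_supp; rewrite negb_and -!ltNge -leNgt y1 orbT.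
have ru0 : radially_integrable (fun r => h r / r).
  by apply: (@radially_integrable_quotient _ h A 1) => // r _; exact: h_bound.
have ru1 : radially_integrable (fun r => - g r / r).
  apply: (@radially_integrable_quotient _ (fun r => - g r) M 1).
  - by mfun.
  - by move=> r _; rewrite normrN.
  - by move=> r /g0r->; rewrite oppr0.
split.
  apply: measurable_funTS; rewrite /solution; apply: measurable_funD.
    apply: (measurableT_comp mv (g := fun z : R * R * R * R => (enorm z.1, z.2))).
    by apply: measurable_fun_pair; mfun.
  apply: (measurableT_comp sw.1 (g := fun z : R * R * R * R => (enorm z.1, z.2))).
  by apply: measurable_fun_pair; mfun.
move=> t t0.
exists (fun x => dalembert h t (enorm x)),
  (fun x => spherical_mean t (fun r => - g r / r) (enorm x)),
  (fun x s => spherical_mean (t - s) (source h N w ^~ s) (enorm x)).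
split.
- apply: (@is_multiplier_radial R (cos_symbol t) (fun r => h r / r) (dalembert h t) 1) => //.
  + exact: measurable_cos_symbol.
  + by move=> k; rewrite ler_norml cos_geN1 cos_le1.
  + exact: (@radially_integrable_dalembert R h A 1).
  + by move=> k _; exact: (@sine_transform_dalembert R h A 1).
- apply: (@is_multiplier_radial R (sinc_symbol t) (fun r => - g r / r)
    (spherical_mean t (fun r => - g r / r)) `|t|) => //.
  + exact: measurable_sinc_symbol.
  + exact: sinc_symbol_le.
  + exact: radially_integrable_spherical_mean.
  + move=> k k0; apply: (@sine_transform_spherical_mean R t M k) => // rho rho0.
    have [->|rn] := eqVneq rho 0; first by rewrite mul0r normr0 (le_trans _ (g_le 0)).
    by rewrite (_ : rho * _ = - g rho) ?normrN//; field.
- apply: measurable_funTS.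
  have mI : measurable_fun setT (fun y : R * R * R * R => \int[mu]_rho
    (if triangle (enorm y.1) rho (t - y.2) then rho * source h N w rho y.2 else 0)).
    apply: (measurable_fun_Rintegral (f := fun (y : R * R * R * R) rho => if triangle
      (enorm y.1) rho (t - y.2) then rho * source h N w rho y.2 else 0)).
    have mF' : measurable_fun setT (fun z : R * R * R * R * R => source h N w z.2 z.1.2).
      by apply: (measurableT_comp mS (g := fun z => (z.2, z.1.2))); mfun.
    have mT : measurable_fun setT (fun z : R * R * R * R * R => triangle (enorm z.1.1) z.2
      (t - z.1.2)).
      by mtriangle.
    by mfun.
  by rewrite /spherical_mean; mfun.
- move=> s /andP[s0 st]; have ts0 : 0 <= t - s by rewrite subr_ge0.
  have -> : (fun x => `|solution x s| ^+ N * solution x s) = (fun x => source h N w (enorm x) s).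
    by apply/funext => x; exact: solution_source.
  apply: (@is_multiplier_radial R (sinc_symbol (t - s)) (source h N w ^~ s)
    (spherical_mean (t - s) (source h N w ^~ s)) `|t - s|).
  + exact: measurable_sinc_symbol.
  + exact: sinc_symbol_le.
  + exact: radially_integrable_source.
  + by apply: radially_integrable_spherical_mean => //; exact: radially_integrable_source.
  + move=> k k0; apply: (@sine_transform_spherical_mean R (t - s) K k) => //.
      exact: radially_integrable_source.
    by move=> rho; exact: source_mul_le.
have [Z [mZ Z0 sub]] := ae_enorm_gt0 R.
exists Z; split=> // x /=; apply: contra_notP => xZ.
have r0 : 0 < enorm x by apply: contrapT => r0; apply: xZ; exact: sub.
(* Restricting to [0, t] or to s >= 0 gives the same function, since the mean vanishes for s > t. *)
have dE : (fun s => spherical_mean (t - s) (source h N w ^~ s) (enorm x)) \_ `[0, t] =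
    (fun s => if 0 <= s then spherical_mean (t - s) (source h N w ^~ s) (enorm x) else 0).
  apply/funext => s; rewrite /patch mem_setE in_itv/=; case: (0 <= s) => //=.
  case: ifPn => // st; rewrite spherical_mean_eq0// subr_ge0 (negbTE st) andbF//.
split.
  have := integrable_duhamel (enorm x) t mS (source_bounded h_ge0 h_le h_supp sw).
  rewrite -dE => H.
  have {}H : mu.-integrable `[0, t] (EFin \o
    ((fun s => spherical_mean (t - s) (source h N w ^~ s) (enorm x)) \_ `[0, t])).
    by apply: integrableS H => //; exact: measurable_itv.
  apply: eq_integrable H => //.
  move=> s; rewrite inE /= in_itv /= => st.
  by rewrite /patch mem_setE in_itv /= st.
rewrite Rintegral_mkcond dE -/(duhamel (source h N w) (enorm x) t) free_evolution//.
by rewrite /solution wE /response mulNr.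
Qed.

End mild.

(** * The initial data *)

Section profile.
Context (R : realType).
Notation mu := (@lebesgue_measure R).

Definition tent (c d y : R) : R := Num.max 0 (d - `|y - c|).

(* Half-open, so that [slope c c] vanishes at 0. *)
Definition step (p q y : R) : R := if (p < y) && (y <= q) then 1 else 0.

Definition slope (c d y : R) : R := step (c - d) c y - step c (c + d) y.

Lemma measurable_tent c d : measurable_fun setT (tent c d).
Proof. by rewrite /tent; mfun. Qed.

Lemma measurable_step p q : measurable_fun setT (step p q).
Proof. by rewrite /step; mfun. Qed.

Lemma measurable_slope c d : measurable_fun setT (slope c d).
Proof.
by rewrite /slope; apply: measurable_funB; exact: measurable_step.
Qed.

Lemma tent_ge0 c d y : 0 <= tent c d y.
Proof. by rewrite /tent le_max lexx. Qed.

Lemma normr_slope_le c d y : `|slope c d y| <= 1.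
Proof.
rewrite /slope /step; case: ifP => [/andP[? ?]|_]; case: ifP => [/andP[? ?]|_].
- by rewrite subrr normr0.
- by rewrite subr0 normr1.
- by rewrite sub0r normrN1.
- by rewrite subr0 normr0.
Qed.

Let integral_step_oc (p q : R) :
  (\int[mu]_y (step p q y)%:E = (Num.max 0 (q - p))%:E)%E.
Proof.
transitivity (\int[mu]_(y in `]p, q]) (cst 1 y))%E.
  rewrite [RHS]integral_mkcond; apply: eq_integral => y _.
  by rewrite /patch mem_setE in_itv/= /step; case: ifP.
rewrite integral_cst//= mul1e lebesgue_measure_itv/= lte_fin.
by case: ltP => pq; rewrite -?EFinD; congr EFin; case: leP => //; lra.
Qed.

(** The clamp y -> max p (min q y) is an antiderivative of the indicator of ]p, q]. *)
Let Rintegral_step (p q a b : R) : p <= q -> a <= b ->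
  \int[mu]_y (if (a <= y) && (y <= b) then step p q y else 0) =
  Num.max p (Num.min q b) - Num.max p (Num.min q a).
Proof.
move=> pq ab; rewrite /Rintegral.
have [pa|ap] := ltP p a; last first.
  have -> : (\int[mu]_y (if (a <= y) && (y <= b) then step p q y else 0)%:E)%E =
    (\int[mu]_y (step p (Num.min q b) y)%:E)%E.
    apply: eq_integral => y _; congr EFin; rewrite /step le_min.
    have [py|yp] /= := ltP p y; last by rewrite if_same.
    by rewrite (le_trans ap (ltW py))/= andbC; case: (y <= q); case: (y <= b).
  rewrite integral_step_oc /= (min_r (le_trans ap pq)) (max_l ap).
  case: (leP p (Num.min q b)) => pm; first by rewrite max_r// subr_ge0.
  by rewrite max_l ?subrr// subr_le0 ltW.
have [qb|bq] := leP a (Num.min q b); last first.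
  rewrite integral0_eq /=.
    have qa : q <= a by move: bq; rewrite gt_min => /orP[/ltW//|]; lra.
    by rewrite (min_l (le_trans qa ab)) (min_l qa) subrr.
  move=> y _; congr EFin; rewrite /step; case: ifP => // /andP[ay yb]; rewrite ifF//.
  by apply/negP => /andP[py yq]; move: bq; rewrite ltNge le_min (le_trans ay yq) (le_trans ay yb).
have -> : (\int[mu]_y (if (a <= y) && (y <= b) then step p q y else 0)%:E)%E =
    (\int[mu]_y (if (a <= y) && (y <= Num.min q b) then 1 else 0)%:E)%E.
  apply: eq_integral => y _; congr EFin; rewrite /step le_min.
  have [ay|//] /= := leP a y.
  by rewrite (lt_le_trans pa ay)/=; case: (y <= q); case: (y <= b).
rewrite integral_if_cst//= mul1r.
have aq : a <= q by move: qb; rewrite le_min => /andP[].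
by rewrite (min_r aq) (max_r (ltW pa)) (max_r (le_trans (ltW pa) qb)).
Qed.

Let integrable_step (p q a b : R) :
  mu.-integrable setT (EFin \o (fun y => if (a <= y) && (y <= b) then step p q y else 0)).
Proof.
have ms := measurable_step p q.
apply: (@integrable_bounded_support R a b 1); first by mfun.
- by move=> y; rewrite /step; case: ifP => _; [case: ifP => _|]; rewrite ?normr1 ?normr0.
- by move=> y /negbTE->.
Qed.

Lemma Rintegral_slope (c d a b : R) : 0 <= d -> a <= b ->
  \int[mu]_y (if (a <= y) && (y <= b) then slope c d y else 0) = tent c d b - tent c d a.
Proof.
move=> d0 ab.
have -> : (fun y => if (a <= y) && (y <= b) then slope c d y else 0) =
   (fun y => (if (a <= y) && (y <= b) then step (c - d) c y else 0) -
     (if (a <= y) && (y <= b) then step c (c + d) y else 0)).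
  by apply/funext => y; case: ifP => // _; rewrite subr0.
rewrite RintegralB//; try exact: integrable_step.
rewrite !Rintegral_step//; try lra.
(* A tent is, up to a constant, the difference of the two clamps to [c - d, c] and [c, c + d], which
   are the antiderivatives of the two steps of its slope. *)
have T y : tent c d y = Num.max (c - d) (Num.min c y) - Num.max c (Num.min (c + d) y) + d.
  rewrite /tent; case: (leP c y) => cy.
    rewrite ger0_norm ?subr_ge0// (max_r (_ : c - d <= c)); last by lra.
    case: (leP (c + d) y) => dy; first by rewrite max_l ?(max_r (_ : c <= c + d)); lra.
    by rewrite max_r ?(max_r cy); lra.
  rewrite ltr0_norm ?subr_lt0// (max_l (_ : Num.min (c + d) y <= c));
    last by rewrite ge_min (ltW cy) orbT.
  case: (leP (c - d) y) => dy; first by rewrite max_r; lra.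
  by rewrite max_l; lra.
by rewrite !T; ring.
Qed.

Lemma tent_le1 c d y : tent c d y <= (if (c - d <= y) && (y <= c + d) then d else 0).
Proof.
rewrite /tent; have := normr_ge0 (y - c) => n0.
case: (leP 0 (d - `|y - c|)); last by move=> _; case: ifPn => // /andP[? ?]; lra.
rewrite subr_ge0 ler_norml => /andP[? ?]; rewrite ifT; first by lra.
by apply/andP; split; lra.
Qed.

Variables (L K lam eps : R).
Hypothesis L_gt0 : 0 < L.
Hypothesis K_gt0 : 0 < K.
Hypothesis lam_gt0 : 0 < lam.
Hypothesis lam_le : lam <= 2^-1.
Hypothesis eps_gt0 : 0 < eps.
Hypothesis eps_le : eps <= lam / 2.

Definition profile (y : R) : R := L * tent lam lam y + K / eps * tent lam eps y.

Definition profile_slope (y : R) : R := L * slope lam lam y + K / eps * slope lam eps y.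

(** Bounds bump(y) / y: the bump has height K, and its support lies in y >= lam / 2 because eps <=
    lam / 2. *)
Let B : R := 2 * K / lam.

Let params : [/\ 0 < lam, lam <= 2^-1, 0 < eps & eps <= lam / 2]. Proof. by []. Qed.

Let Ke_ge0 : 0 <= K / eps. Proof. by rewrite divr_ge0// ltW. Qed.

Let B_ge0 : 0 <= B. Proof. by rewrite !mulr_ge0 ?invr_ge0// ltW. Qed.

Lemma measurable_profile : measurable_fun setT profile.
Proof.
have m1 := measurable_tent lam lam; have m2 := measurable_tent lam eps.
by rewrite /profile; mfun.
Qed.

Lemma measurable_profile_slope : measurable_fun setT profile_slope.
Proof.
have m1 := measurable_slope lam lam; have m2 := measurable_slope lam eps.
by rewrite /profile_slope; mfun.
Qed.

Lemma profile_ge0 y : 0 <= profile y.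
Proof. by rewrite addr_ge0// mulr_ge0 ?tent_ge0// ltW. Qed.

Lemma tent_le2 y : tent lam lam y <= (if (0 <= y) && (y <= 2 * lam) then y else 0).
Proof.
rewrite /tent; case: ifPn => [/andP[y0 y2]|yc].
  rewrite ge_max y0/=; have := ler_norm (lam - y); rewrite distrC; lra.
rewrite ge_max lexx/=; case/nandP: yc; rewrite -ltNge => yl.
  have := ler_norm (lam - y); rewrite distrC; lra.
have := ler_norm (y - lam); lra.
Qed.

Lemma bump_le y : K / eps * tent lam eps y <=
  (if (lam - eps <= y) && (y <= lam + eps) then B * y else 0).
Proof.
apply: le_trans (ler_wpM2l Ke_ge0 (tent_le1 lam eps y)) _.
case: ifPn => [/andP[y1 y2]|_]; last by rewrite mulr0.
have [? ? ? ?] := params.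
rewrite divfK ?gt_eqF// /B mulrAC ler_pdivlMr//.
have : K * (lam / 2) <= K * y by rewrite ler_wpM2l ?(ltW K_gt0)//; lra.
by lra.
Qed.

Lemma profile_le y : 0 <= y -> profile y <= (L + B) * y.
Proof.
move=> y0; rewrite mulrDl lerD//.
  by apply: ler_wpM2l; rewrite ?(ltW L_gt0)//; apply: le_trans (tent_le2 y) _; case: ifP.
by apply: le_trans (bump_le y) _; case: ifP => // _; rewrite mulr_ge0.
Qed.

Lemma profile_supp y : ~~ ((0 <= y) && (y <= 1)) -> profile y = 0.
Proof.
move=> y01; apply/le_anti; rewrite profile_ge0 andbT /profile; have [? ? ? ?] := params.
have t1 : tent lam lam y <= 0.
  apply: le_trans (tent_le2 y) _; case: ifP => // /andP[y0 y1].
  by case/negP: y01; apply/andP; split; lra.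
have t2 : tent lam eps y <= 0.
  apply: le_trans (tent_le1 lam eps y) _; case: ifP => // /andP[y0 y1].
  by case/negP: y01; apply/andP; split; lra.
have := mulr_ge0_le0 (ltW L_gt0) t1; have := mulr_ge0_le0 Ke_ge0 t2; lra.
Qed.

Lemma profile_slope_supp y : ~~ ((0 < y) && (y <= 1)) -> profile_slope y = 0.
Proof.
move=> y01.
have [? ? ? ?] := params.
have s d : 0 < d -> d <= lam -> slope lam d y = 0.
  move=> d0 dl; rewrite /slope /step !ifF ?subrr//; apply/negP => /andP[y0 y1];
  by case/negP: y01; apply/andP; split; lra.
by rewrite /profile_slope !s ?mulr0 ?addr0//; lra.
Qed.

Lemma profile_slope_le y : `|profile_slope y| <= L + K / eps.
Proof.
apply: le_trans (ler_normD _ _) _.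
rewrite (normrM L) (normrM (K / eps)) (gtr0_norm L_gt0) (ger0_norm Ke_ge0).
by rewrite lerD// ler_piMr ?normr_slope_le// ltW.
Qed.

Lemma Rintegral_profile_slope a b : 0 <= a -> a <= b ->
  \int[mu]_y (if (a <= y) && (y <= b) then profile_slope y else 0) = profile b - profile a.
Proof.
move=> a0 ab.
have i d : mu.-integrable setT (EFin \o
  (fun y => if (a <= y) && (y <= b) then slope lam d y else 0)).
  have ms := measurable_slope lam d.
  apply: (@integrable_bounded_support R a b 1); first by mfun.
  - by move=> y; case: ifP => _; rewrite ?normr_slope_le ?normr0.
  - by move=> y /negbTE->.
have -> : (fun y => if (a <= y) && (y <= b) then profile_slope y else 0) =
  (fun y => L * (if (a <= y) && (y <= b) then slope lam lam y else 0) + K / eps *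
    (if (a <= y) && (y <= b) then slope lam eps y else 0)).
  by apply/funext => y; case: ifP => // _; rewrite !mulr0 addr0.
have iZ d c : mu.-integrable setT (EFin \o
  (fun y => c * (if (a <= y) && (y <= b) then slope lam d y else 0))).
  by apply: eq_integrable (integrableZl measurableT c (i d)).
rewrite RintegralD// !RintegralZl// !Rintegral_slope//; try exact: ltW.
by rewrite /profile; ring.
Qed.

(** The factor 2^p separates tent and bump. On their supports, of lengths 2 lam and 2 eps, the
    quotients by y are at most L and B, and the weight y is at most 2 lam. *)
Lemma mass_profile_le (p : nat) : (0 < p)%N ->
  (mass profile p <= (2 ^+ p * (4 * L ^+ p * lam ^+ 2 + 4 * B ^+ p * lam * eps))%:E)%E.
Proof.
move=> p0; have mp := measurable_profile.
have c1 : 0 <= 2 ^+ p * (L ^+ p * (2 * lam)).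
  by rewrite !mulr_ge0 ?exprn_ge0// ltW.
have c2 : 0 <= 2 ^+ p * (B ^+ p * (2 * lam)).
  by rewrite !mulr_ge0 ?exprn_ge0// ltW.
pose f1 y : R := if (0 <= y) && (y <= 2 * lam) then 2 ^+ p * (L ^+ p * (2 * lam)) else 0.
pose f2 y : R := if (lam - eps <= y) && (y <= lam + eps) then 2 ^+ p * (B ^+ p * (2 * lam)) else 0.
have f10 y : 0 <= f1 y by rewrite /f1; case: ifP.
have f20 y : 0 <= f2 y by rewrite /f2; case: ifP.
have mf1 : measurable_fun setT f1 by rewrite /f1; mfun.
have mf2 : measurable_fun setT f2 by rewrite /f2; mfun.
have -> : ((2 ^+ p * (4 * L ^+ p * lam ^+ 2 + 4 * B ^+ p * lam * eps))%:E = \int[mu]_y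
  ((f1 y)%:E + (f2 y)%:E))%E.
  rewrite ge0_integralD; last 5 first.
  - exact: measurableT.
  - by move=> y _; rewrite lee_fin.
  - by mfun.
  - by move=> y _; rewrite lee_fin.
  - by mfun.
  have [? ? ? ?] := params.
  rewrite /f1 /f2 !integral_if_cst; [|lra|by rewrite mulr_ge0// ltW].
  by rewrite -EFinD; congr EFin; ring.
rewrite /mass; apply: ge0_le_integral => //.
- move=> y _; rewrite lee_fin; case: ifP => // y0.
  by rewrite mulr_ge0// exprn_ge0// divr_ge0// profile_ge0.
- by mfun.
- by apply: emeasurable_funD; mfun.
move=> y _; rewrite -EFinD lee_fin; case: ifPn => [y0|_]; last by rewrite addr_ge0.
have [->|yn] := eqVneq y 0; first by rewrite mul0r addr_ge0.
have yp : 0 < y by rewrite lt_neqAle eq_sym yn.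
rewrite /profile mulrDl.
have t0 d c : 0 <= c -> 0 <= c * tent lam d y / y
  by move=> c0; rewrite divr_ge0// mulr_ge0 ?tent_ge0.
apply: le_trans (ler_wpM2l y0 (exprD_le _ _ _)) _; [by apply: t0; exact: ltW|exact: t0|].
have b1 : y * (L * tent lam lam y / y) ^+ p <=
  (if (0 <= y) && (y <= 2 * lam) then L ^+ p * (2 * lam) else 0).
  case: ifPn => [/andP[_ y2]|yc].
    rewrite mulrC; apply: ler_pM => //; first by rewrite exprn_ge0// t0// ltW.
    rewrite lerXn2r ?nnegrE ?t0 ?(ltW L_gt0)// ler_pdivrMr// ler_wpM2l ?(ltW L_gt0)//.
    by apply: le_trans (tent_le2 y) _; case: ifP.
  have -> : tent lam lam y = 0.
    by apply/le_anti; rewrite tent_ge0 andbT; apply: le_trans (tent_le2 y) _; rewrite (negbTE yc).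
  by rewrite mulr0 mul0r expr0n; case: (p) p0 => // ? _; rewrite mulr0.
have b2 : y * (K / eps * tent lam eps y / y) ^+ p <=
  (if (lam - eps <= y) && (y <= lam + eps) then B ^+ p * (2 * lam) else 0).
  have := bump_le y; case: ifPn => [/andP[y1 y2]|yc] by1.
    rewrite mulrC; apply: ler_pM => //; first by rewrite exprn_ge0// t0.
      by rewrite lerXn2r ?nnegrE ?t0// ler_pdivrMr.
    by have [? ? ? ?] := params; lra.
  have -> : K / eps * tent lam eps y = 0 by apply/le_anti; rewrite by1 mulr_ge0 ?tent_ge0.
  by rewrite mul0r expr0n; case: (p) p0 => // ? _; rewrite mulr0.
have -> : f1 y + f2 y = 2 ^+ p * ((if (0 <= y) && (y <= 2 * lam) then L ^+ p * (2 * lam) else 0) +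
  (if (lam - eps <= y) && (y <= lam + eps) then B ^+ p * (2 * lam) else 0)).
  by rewrite /f1 /f2 mulrDr; congr (_ + _); case: ifP; rewrite ?mulr0.
by rewrite mulrCA ler_wpM2l ?exprn_ge0// mulrDr lerD.
Qed.

Lemma profile_ge_linear y : 0 <= y -> y <= lam -> L * y <= profile y.
Proof.
move=> y0 yl; rewrite -[leLHS]addr0 lerD//; last by rewrite mulr_ge0 ?tent_ge0.
rewrite ler_wpM2l ?(ltW L_gt0)// /tent ler0_norm ?subr_le0//.
by rewrite le_max; apply/orP; right; lra.
Qed.

Lemma profile_ge_bump y : lam - eps / 2 <= y -> y <= lam + eps / 2 -> K / 2 <= profile y.
Proof.
move=> y1 y2; rewrite -[leLHS]add0r lerD//; first by rewrite mulr_ge0 ?tent_ge0// ltW.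
apply: (@le_trans _ _ (K / eps * (eps / 2))); first by rewrite mulrA divfK// gt_eqF.
apply: ler_wpM2l => //; rewrite /tent le_max; apply/orP; right.
have : `|y - lam| <= eps / 2 by rewrite ler_norml; apply/andP; split; lra.
by lra.
Qed.

(** Only the interval of length eps about lam is kept. There the profile is at least K / 2 and r <=
    3 lam / 2, so the quotient is at least K / (3 lam) = B / 6; r >= lam / 2 turns 4 A r^2 into A
    lam^2. *)
Lemma integral_profile_ge (q : nat) :
  ((@unit_disc_area R * lam ^+ 2 * (B / 6) ^+ q * eps)%:E <=
   \int[leb3 R]_x (`|profile (enorm x) / enorm x| ^+ q)%:E)%E.
Proof.
have mp := measurable_profile; have [? ? ? ?] := params.
have A0 := ltW (@unit_disc_area_gt0 R).
rewrite (@ge0_integral_radial R (fun r => `|profile r / r| ^+ q)); last 2 first.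
- by mfun.
- by move=> r; rewrite exprn_ge0.
have c0 : 0 <= @unit_disc_area R * lam ^+ 2 * (B / 6) ^+ q.
  by apply: mulr_ge0; [apply: mulr_ge0; rewrite ?sqr_ge0|rewrite exprn_ge0// divr_ge0].
have := @integral_if_cst R (lam - eps / 2) (lam + eps / 2)
  (@unit_disc_area R * lam ^+ 2 * (B / 6) ^+ q).
rewrite (_ : lam + eps / 2 - (lam - eps / 2) = eps); last by field.
move=> <-; last by lra.
apply: ge0_le_integral => //.
- by move=> r _; rewrite lee_fin; case: ifP.
- by mfun.
- by mfun.
move=> r _; rewrite lee_fin; case: ifPn => [/andP[r1 r2]|_]; last first.
  case: ifP => // _; apply: mulr_ge0; first exact: mulr_ge0.
  by apply: mulr_ge0; rewrite ?sqr_ge0 ?exprn_ge0.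
have r0 : 0 < r by lra.
rewrite (ltW r0).
have q1 : B / 6 <= profile r / r.
  rewrite ler_pdivlMr//; apply: le_trans (profile_ge_bump r1 r2).
  have -> : B / 6 * r = K / 3 * (r / lam) by rewrite /B; field; rewrite gt_eqF.
  have : K / 3 * (r / lam) <= K / 3 * (3 / 2).
    by rewrite ler_wpM2l ?divr_ge0 ?(ltW K_gt0)// ler_pdivrMr//; lra.
  by lra.
have l2 : lam ^+ 2 <= 4 * r ^+ 2.
  have : 0 <= (2 * r - lam) * (2 * r + lam) by rewrite mulr_ge0//; lra.
  by lra.
have B6 : 0 <= B / 6 by rewrite divr_ge0.
rewrite [leRHS]mulrA; apply: ler_pM; [by apply: mulr_ge0; rewrite ?sqr_ge0|exact: exprn_ge0| |].
  by rewrite [4 * _]mulrC -mulrA ler_wpM2l.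
rewrite lerXn2r ?nnegrE//.
by apply: le_trans q1 _; exact: ler_norm.
Qed.

End profile.

(** * Norms and brackets *)

Section norms.
Context (R : realType).
Notation mu := (@lebesgue_measure R).

Lemma Lnorm_infty_le d (T : measurableType d) (m : {measure set T -> \bar R})
    (f : T -> \bar R) (C : R) : 0 <= C -> (forall x, `|f x| <= C%:E)%E ->
  ('N[m]_+oo [f] <= C%:E)%E.
Proof.
move=> C0 fC; rewrite unlock; case: ifP => // _.
apply/ess_sup_inf.ess_supP; exists set0; split=> // x /= H; exfalso; exact: H.
Qed.

(** A single instant is invisible to the essential supremum. If it were below C, the interval [a, b]
    of positive length would lie in a null set. *)
Lemma le_ess_sup_time (f : R -> R) (C a b : R) : 0 <= a -> a < b ->
  (forall t, a <= t -> t <= b -> C <= f t) ->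
  (C%:E <= ess_sup_inf.ess_sup (leb_time R) (fun t => (f t)%:E))%E.
Proof.
move=> a0 ab fC; rewrite leNgt; apply/negP => lt.
have [Z [mZ Z0 sub]] := ess_sup_inf.ess_sup_ge (leb_time R) (fun t => (f t)%:E).
suff H : ((b - a)%:E <= leb_time R Z)%E.
  have : ((b - a)%:E <= 0)%E by apply: le_trans H _; rewrite le_eqVlt; apply/orP; left; exact/eqP.
  by rewrite lee_fin subr_le0 leNgt ab.
have -> : (b - a)%:E = mu `[a, b]%classic.
  by rewrite lebesgue_measure_itv/= lte_fin ab EFinB.
rewrite /leb_time /mrestr; apply: le_measure; rewrite ?inE//.
  by apply: measurableI => //; exact: measurable_itv.
move=> t /=; rewrite in_itv/= => /andP[at_ tb]; split.
  apply: sub => /= ft.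
  by have := le_lt_trans ft lt; rewrite lte_fin ltNge fC.
by rewrite in_itv/= (le_trans a0).
Qed.

Lemma japanese_gt0 (x : R * R * R) : 0 < japanese x.
Proof. by rewrite sqrtr_gt0 ltr_pwDl// sqr_ge0. Qed.

Lemma japanese_weight_le1 (x : R * R * R) : japanese x * weight (enorm x) <= 1.
Proof.
have r0 := enorm_ge0 x.
rewrite /weight ger0_norm// ler_pdivrMr ?ltr_pwDl// mul1r.
rewrite -[leRHS]ger0_norm ?addr_ge0// -sqrtr_sqr ler_wsqrtr//.
by rewrite sqrrD expr1n; lra.
Qed.

Lemma japanese_inv_le (x : R * R * R) : (japanese x)^-1 <= 2 * weight (enorm x).
Proof.
have r0 := enorm_ge0 x; have j0 := japanese_gt0 x.
rewrite /weight ger0_norm// ler_pdivlMr ?ltr_pwDl// mulrC ler_pdivrMr//.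
have -> : 2 * japanese x = Num.sqrt (4 * (1 + enorm x ^+ 2)).
  rewrite sqrtrM// (_ : 4 = 2 ^+ 2 :> R); last by ring.
  by rewrite sqrtr_sqr ger0_norm.
rewrite -[leLHS]ger0_norm ?addr_ge0// -sqrtr_sqr ler_wsqrtr//.
have : 0 <= (1 - enorm x) ^+ 2 by exact: sqr_ge0.
have := sqr_ge0 (enorm x).
by rewrite sqrrB sqrrD !expr1n; lra.
Qed.

Lemma smallness_gt0 (N : nat) : 0 < @smallness R N.
Proof. by rewrite invr_gt0 mulr_gt0// ?exprn_gt0// ltr0n. Qed.

Lemma smallness_le (N : nat) : @smallness R N <= 4^-1.
Proof.
rewrite lef_pV2 ?posrE ?mulr_gt0 ?exprn_gt0 ?ltr0n//.
rewrite addnC exprD -[leLHS]mul1r; apply: ler_pM => //; first by rewrite ler1n.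
have : 1 <= 2 ^+ N :> R by rewrite exprn_ege1// ler1n.
by rewrite (_ : 2 ^+ 3 = 8 :> R); [lra|ring].
Qed.

End norms.

Section solution.
Context (R : realType).
Notation mu := (@lebesgue_measure R).
Variables (h : R -> R) (A sigma : R) (N : nat) (w : R -> R -> R).
Hypothesis mh : measurable_fun setT h.
Hypothesis h_ge0 : forall y, 0 <= h y.
Hypothesis h_le : forall y, 0 <= y -> h y <= A * y.
Hypothesis h_supp : forall y, ~~ ((0 <= y) && (y <= 1)) -> h y = 0.
Hypothesis sw : small N w.

Let A_ge0 : 0 <= A.
Proof. by have := h_le ler01; have := h_ge0 1; lra. Qed.

(** Both [v] and [w] are bounded by a constant times the weight, pointwise and after integration in
    time, and bracket times weight is at most 1. *)
Lemma norm_solution_lty (C : R) : 0 <= C ->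
  (forall r, \int[mu]_t `|w r t|%:E <= (C * weight r)%:E)%E ->
  (norm_solution_space (solution h w) < +oo)%E.
Proof.
move=> C0 wC; have d0 := ltW (smallness_gt0 R N).
have w0 r : 0 <= weight r :> R by exact/ltW/weight_gt0.
have mv := measurable_outgoing mh.
rewrite /norm_solution_space gt_max; apply/andP; split.
  apply: (@le_lt_trans _ _ (2 * A + @smallness R N)%:E); last by rewrite ltry.
  apply: Lnorm_infty_le => [|[x t]/=]; first by rewrite addr_ge0// mulr_ge0.
  rewrite lee_fin invrK normrM (gtr0_norm (japanese_gt0 x)).
  apply: (@le_trans _ _ (japanese x * ((2 * A + @smallness R N) * weight (enorm x)))).
    apply: ler_wpM2l; first exact/ltW/japanese_gt0.
    apply: le_trans (ler_normD _ _) _; rewrite mulrDl lerD//; last exact: sw.2.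
    rewrite ger0_norm; last exact: outgoing_ge0.
    exact: outgoing_le.
  by rewrite mulrCA ler_piMr ?japanese_weight_le1// addr_ge0// mulr_ge0.
apply: (@le_lt_trans _ _ (2 * A + C)%:E); last by rewrite ltry.
apply: Lnorm_infty_le => [|x]; first by rewrite addr_ge0// mulr_ge0.
have mv1 : measurable_fun setT (outgoing h (enorm x))
  by exact: (measurableT_comp mv (pair1_measurable (enorm x))).
have mw1 : measurable_fun setT (w (enorm x))
  by exact: (measurableT_comp sw.1 (pair1_measurable (enorm x))).
have mu1 : measurable_fun setT (fun t => `|((japanese x)^-1^-1 * solution h w x t)%:E|%E)
  by rewrite /solution; mfun.
have j0 := ltW (japanese_gt0 x).
rewrite gee0_abs; last by apply: integral_ge0.
apply: (@le_trans _ _ (\int[mu]_t `|((japanese x)^-1^-1 * solution h w x t)%:E|)%E).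
  by apply: ge0_subset_integral => //; exact: measurable_itv.
apply: (@le_trans _ _ (\int[mu]_t ((japanese x)%:E *
  ((outgoing h (enorm x) t ^+ 1)%:E + `|w (enorm x) t|%:E)))%E).
  apply: ge0_le_integral => //.
  - by apply: emeasurable_funM; [mfun|apply: emeasurable_funD; mfun].
  move=> t _; rewrite abse_EFin -EFinD -EFinM lee_fin invrK normrM (ger0_norm j0) expr1.
  apply: ler_wpM2l => //; apply: le_trans (ler_normD _ _) _.
  by rewrite (ger0_norm (outgoing_ge0 h_ge0 _ _)).
rewrite ge0_integral_cstM; [|exact: j0|by apply: emeasurable_funD; mfun|].
  2: by move=> t; rewrite adde_ge0// lee_fin expr1 outgoing_ge0.
rewrite ge0_integralD; last 5 first.
- exact: measurableT.
- by move=> t _; rewrite lee_fin expr1 outgoing_ge0.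
- by mfun.
- by move=> t _; rewrite lee_fin.
- by mfun.
apply: (@le_trans _ _ ((japanese x)%:E *
  (((2 * A * weight (enorm x)) ^+ 1)%:E + (C * weight (enorm x))%:E))%E).
  apply: lee_wpmul2l => //; apply: leeD; last exact: wC.
  exact: integral_outgoing_le.
rewrite -EFinD -EFinM lee_fin expr1 -mulrDl mulrCA ler_piMr ?japanese_weight_le1//.
by rewrite addr_ge0// mulr_ge0.
Qed.

End solution.

Section parameters.
Context (R : realType).

(** The order of choice is [lam], then B, then [eps], with K recovered as B lam / 2. [lam] makes the
    tent's mass small, [eps] makes the bump's mass small for any B, and B is taken large enough for
    everything else. *)
Lemma exists_profile_parameters (m : nat) (a L : R) : (2 <= m)%N -> 0 < a -> 1 <= L ->
  let N := (2 * m)%N in let delta := @smallness R N in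
  exists K lam eps : R,
  [/\ [/\ L <= K, 0 < lam, lam <= 2^-1, 0 < eps & eps <= lam / 2],
      (forall p, (p <= N.+1)%N ->
        2 ^+ p * (4 * L ^+ p * lam ^+ 2 + 4 * (2 * K / lam) ^+ p * lam * eps) <= delta / 2) &
      L ^+ (3 * m) <= a * lam ^+ 2 * (2 * K / lam / 6) ^+ (3 * m) * eps].
Proof.
move=> m2 a0 L1 N delta.
have L0 : 0 < L by apply: lt_le_trans L1.
have d0 : 0 < delta by exact: smallness_gt0.
have d1 : delta <= 4^-1 by exact: smallness_le.
(* Equal to 16 times 2^(N+1), so that the prefactor 2^(N+1) times 4 in the mass bound is E / 4 and
   each of the two parts stays below delta / 4. *)
pose E : R := 2 ^+ (N + 5).
have E0 : 0 < E by rewrite exprn_gt0.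
have E1 : 1 <= E by rewrite exprn_ege1// ler1n.
have EE : E = 16 * 2 ^+ N.+1.
  by rewrite /E -(addn1 N) !exprD; ring.
have LN1 : 1 <= L ^+ N.+1 by rewrite exprn_ege1.
have LN0 : 0 < L ^+ N.+1 by rewrite exprn_gt0.
pose lam := delta / (E * L ^+ N.+1).
have lam0 : 0 < lam by rewrite divr_gt0// mulr_gt0.
have lamd : lam <= delta.
  by rewrite /lam ler_pdivrMr ?mulr_gt0// ler_peMr ?(ltW d0)// mulr_ege1.
have lamE : E * L ^+ N.+1 * lam = delta by rewrite /lam mulrC divfK// gt_eqF// mulr_gt0.
clearbody lam E delta.
have lam2 : lam <= 2^-1 by lra.
have lam20 : 0 < lam ^+ 2 by rewrite exprn_gt0.
pose c0 := a * lam * delta / (E * 6 ^+ (3 * m)).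
have c00 : 0 < c0.
  by apply: divr_gt0; apply: mulr_gt0 => //; exact: mulr_gt0.
(* One summand per requirement: 1 makes powers of B nondecreasing, the second gives K >= L, the
   third eps <= lam / 2, and the last the lower bound on the critical integral. *)
pose B := 1 + 2 * L / lam + delta / (E * lam ^+ 2) * 2 + L ^+ (3 * m) / c0.
have b1 : 0 <= 2 * L / lam by apply/ltW/divr_gt0 => //; exact: mulr_gt0.
have b2 : 0 <= delta / (E * lam ^+ 2) by apply/ltW/divr_gt0 => //; exact: mulr_gt0.
have b3 : 0 <= L ^+ (3 * m) / c0 by apply/ltW/divr_gt0 => //; exact: exprn_gt0.
have B1 : 1 <= B by rewrite /B; lra.
have B0 : 0 < B by apply: lt_le_trans B1.
have BN : B <= B ^+ N.+1 by rewrite exprS ler_peMr ?(ltW B0)// exprn_ege1.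
have BN0 : 0 < B ^+ N.+1 by rewrite exprn_gt0.
pose eps := delta / (E * lam * B ^+ N.+1).
have El0 : 0 < E * lam * B ^+ N.+1 by apply: mulr_gt0 => //; exact: mulr_gt0.
have eps0 : 0 < eps by exact: divr_gt0.
have epsE : E * lam * B ^+ N.+1 * eps = delta by rewrite /eps mulrC divfK// gt_eqF.
clearbody eps.
exists (B * lam / 2), lam, eps.
have KE : 2 * (B * lam / 2) / lam = B by field; rewrite gt_eqF.
rewrite KE; split; first split=> //.
- have : 2 * L / lam * lam <= B * lam by rewrite ler_wpM2r ?(ltW lam0)// /B; lra.
  by rewrite divfK ?gt_eqF//; lra.
- have : delta / (E * lam ^+ 2) * 2 <= B ^+ N.+1 by apply: le_trans BN; rewrite /B; lra.
  move=> H; rewrite -(ler_pM2l El0) epsE.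
  have := ler_wpM2l (ltW (mulr_gt0 (mulr_gt0 E0 lam0) lam0)) H.
  rewrite (_ : E * lam * lam * (delta / (E * lam ^+ 2) * 2) = delta * 2); last first.
    by field; rewrite !gt_eqF.
  by lra.
- move=> p pN.
  have h2 : 2 ^+ p <= 2 ^+ N.+1 :> R by rewrite ler_weXn2l// ler1n.
  have hL : L ^+ p <= L ^+ N.+1 by rewrite ler_weXn2l.
  have hB : B ^+ p <= B ^+ N.+1 by rewrite ler_weXn2l.
  apply: (@le_trans _ _ (2 ^+ N.+1 * (4 * L ^+ N.+1 * lam ^+ 2 + 4 * B ^+ N.+1 * lam * eps))).
    have x0 : 0 <= L ^+ p by rewrite exprn_ge0// ltW.
    have y0 : 0 <= B ^+ p by rewrite exprn_ge0// ltW.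
    apply: ler_pM => //.
      apply: addr_ge0; first by apply: mulr_ge0; [exact: mulr_ge0|exact: sqr_ge0].
      by apply: mulr_ge0; [apply: mulr_ge0; [exact: mulr_ge0|exact: ltW]|exact: ltW].
    apply: lerD; first by rewrite ler_wpM2r ?sqr_ge0// ler_wpM2l.
    by rewrite ler_wpM2r ?(ltW eps0)// ler_wpM2r ?(ltW lam0)// ler_wpM2l.
  have -> : 2 ^+ N.+1 * (4 * L ^+ N.+1 * lam ^+ 2 + 4 * B ^+ N.+1 * lam * eps) =
      4^-1 * (E * L ^+ N.+1 * lam) * lam + 4^-1 * (E * lam * B ^+ N.+1 * eps).
    by rewrite EE; field.
  rewrite epsE lamE; have : delta * lam <= delta * 1 by rewrite ler_wpM2l ?(ltW d0)//; lra.
  by lra.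
- have -> : a * lam ^+ 2 * (B / 6) ^+ (3 * m) * eps = c0 * (B ^+ (3 * m) / B ^+ N.+1).
    by rewrite /c0 -epsE exprMn exprVn; field; rewrite !gt_eqF// exprn_gt0.
  (* With N = 2m the surplus exponent is 3m - (2m + 1) = m - 1. It is at least 1 since m >= 2, so
     this power dominates B. *)
  have -> : B ^+ (3 * m) / B ^+ N.+1 = B ^+ m.-1.
    rewrite (_ : (3 * m)%N = (m.-1 + N.+1)%N);
      last by rewrite addnS -addSn prednK ?(ltnW m2)// -mulSn.
    by rewrite exprD mulfK// gt_eqF.
  rewrite mulrC -ler_pdivrMr//.
  apply: (@le_trans _ _ B); first by rewrite /B; lra.
  by case: (m) m2 => [|[|k]]//= _; rewrite exprS ler_peMr ?(ltW B0)// exprn_ege1.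
Qed.

End parameters.

(** * Pointwise lower bound for the solution *)

Section lower_bound.
Context (R : realType).
Variables (L K lam eps : R) (N : nat) (w : R -> R -> R).
Hypothesis L_ge1 : 1 <= L.
Hypothesis LK : L <= K.
Hypothesis lam_gt0 : 0 < lam.
Hypothesis eps_gt0 : 0 < eps.
Hypothesis eps_le : eps <= lam / 2.
Hypothesis sw : small N w.

(* Inside the support of the wide tent the solution is large at early times,
   outside when the narrow bump passes by. *)
Lemma solution_ge (x : R * R * R) : 0 < enorm x ->
  exists a b, [/\ 0 <= a, a < b & forall t, a <= t -> t <= b ->
    L / 4 * weight (enorm x) <= solution (profile L K lam eps) w x t].
Proof.
move=> r0; set r := enorm x in r0 *.
have L0 : 0 < L by apply: lt_le_trans L_ge1.
have K0 : 0 < K by apply: lt_le_trans LK.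
have [lam0 [e0 el]] := (lam_gt0, (eps_gt0, eps_le)).
have w0 := weight_gt0 r; have w1 := weight_le1 r.
have rw : r * weight r <= 1.
  by rewrite /weight gtr0_norm// ler_pdivrMr ?ltr_pwDl//; lra.
(* The correction is at most weight / 4, hence at most L weight / 4 as L >= 1. A bound L / 2 for the
   free wave thus leaves L / 4. *)
suff [a [b [a0 ab vab]]] : exists a b, [/\ 0 <= a, a < b & forall t, a <= t -> t <= b ->
    L / 2 * weight r <= outgoing (profile L K lam eps) r t].
  exists a, b; split=> // t at_ tb; rewrite /solution.
  have := vab t at_ tb; have := sw.2 r t; rewrite ler_norml => /andP[+ _].
  have := ler_wpM2r (ltW w0) (smallness_le R N).
  have := ler_wpM2r (ltW w0) L_ge1.
  by lra.
have vE t : 0 <= t -> outgoing (profile L K lam eps) r t = profile L K lam eps (r - t) / r.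
  by move=> t0; rewrite /outgoing (ltW r0) t0.
have [rl|lr] := leP r lam.
  exists 0, (r / 2); split=> //; first exact: divr_gt0.
  move=> t t0 tr; rewrite vE// ler_pdivlMr//.
  apply: (@le_trans _ _ (L * (r - t))).
    have : L * (r * weight r) <= L * r by rewrite ler_wpM2l ?(ltW L0)// ler_piMr// ltW.
    have : L * t <= L * (r / 2) by rewrite ler_wpM2l// ltW.
    by lra.
  by apply: profile_ge_linear => //; lra.
exists (r - lam), (r - lam + eps / 2); split; [lra|lra|move=> t t0 tr].
rewrite vE; last by lra.
rewrite ler_pdivlMr//.
apply: (@le_trans _ _ (K / 2)); last by apply: profile_ge_bump => //; lra.
have LK' := LK; have : L * (r * weight r) <= L * 1 by rewrite ler_wpM2l// ltW.
by lra.
Qed.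

End lower_bound.

Theorem theorem1p6 (R : realType) (N : nat) (N_gt2 : (2 < N)%N)
    (N_even : ~~ odd N) (sigma : R) (sigma_sign : sigma = 1 \/ sigma = -1) :
  let p_c : R := 3 * N%:R / 2 in
  exists c : R, 0 < c /\
    forall L : R, 0 < L ->
    exists u0 u1 : R * R * R -> R,
      [/\ radial u0, radial u1,
          (L%:E <= 'N[leb3 R]_(p_c%:E) [EFin \o u0])%E &
          exists u : R * R * R -> R -> R,
            [/\ mild_solution N sigma u0 u1 u,
                (norm_solution_space u < +oo)%E &
                {ae leb3 R, forall x,
                  ((c * L * (japanese x)^-1)%:E <=
                     ess_sup (leb_time R) (fun t => (u x t)%:E))%E}]].
Proof.
(* The constant 1/8 is the 1/4 of [solution_ge], halved once more in passing from the weight to the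
   inverse bracket. *)
move=> p_c; exists 8^-1; split=> // L0 L0_gt0.
have sigma1 : `|sigma| = 1 by case: sigma_sign => ->; rewrite ?normrN1 ?normr1.
pose m := N./2.
have NE : N = (2 * m)%N by rewrite -[LHS]odd_double_half (negbTE N_even) add0n mul2n.
have m2 : (2 <= m)%N by move: N_gt2; rewrite NE -[X in (X < _)%N]muln1 ltn_mul2l.
have N4 : (4 <= N)%N by rewrite NE -[4%N]/(2 * 2)%N leq_mul2l.
(* Raising the size to at least 1 only strengthens the conclusion, and lets the correction be
   absorbed into the lower bound. *)
pose L := Num.max L0 1.
have L1 : 1 <= L by rewrite /L le_max lexx orbT.
have L0L : L0 <= L by rewrite /L le_max lexx.
have Lgt0 : 0 < L by apply: lt_le_trans L1.
have := exists_profile_parameters m2 (@unit_disc_area_gt0 R) L1.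
rewrite -NE => -[K [lam [eps [[LK lam0 lam2 eps0 epsl] massp nrm]]]].
have K0 : 0 < K by apply: lt_le_trans LK.
pose h := profile L K lam eps; pose g := profile_slope L K lam eps.
pose A := L + 2 * K / lam.
have mh : measurable_fun setT h by exact: measurable_profile.
have h_ge0 y : 0 <= h y by exact: profile_ge0.
have h_le y : 0 <= y -> h y <= A * y by exact: profile_le.
have h_supp y : ~~ ((0 <= y) && (y <= 1)) -> h y = 0 by exact: profile_supp.
have mass_le p : (0 < p)%N -> (p <= N.+1)%N -> (mass h p <= (smallness R N / 2)%:E)%E.
  move=> p0 pN; apply: (@le_trans _ _
    (2 ^+ p * (4 * L ^+ p * lam ^+ 2 + 4 * (2 * K / lam) ^+ p * lam * eps))%:E).
    exact: mass_profile_le.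
  by rewrite lee_fin massp.
have massN : (mass h N <= (smallness R N)%:E)%E.
  apply: le_trans (mass_le N _ _) _ => //; first by case: (N) N4.
  by rewrite lee_fin; have := smallness_gt0 R N; lra.
have [w [sw wE wC]] := response_fixpoint mh h_ge0 h_le h_supp N4 sigma1 massN
  (mass_le N.+1 isT (leqnn _)).
exists (u0 h), (u1 g); split.
- by move=> x y xy; rewrite /u0 xy.
- by move=> x y xy; rewrite /u1 xy.
(* The critical exponent is an integer because N is even, so real powers reduce to natural ones and
   [integral_profile_ge] applies. *)
- have pcE : p_c = (3 * m)%:R.
    by rewrite /p_c NE !natrM; field.
  have pc0 : 0 < p_c by rewrite pcE ltr0n muln_gt0 (ltnW m2).
  have -> : L0%:E = ((L0 `^ p_c)%:E `^ p_c^-1)%E.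
    by rewrite poweR_EFin -powRrM divff ?gt_eqF// powRr1// ltW.
  rewrite unlock; apply: gt0_ler_poweR.
  + by rewrite invr_ge0 ltW.
  + by rewrite in_itv/= leey andbT lee_fin powR_ge0.
  + by rewrite in_itv/= leey andbT; apply: integral_ge0 => x _; rewrite lee_fin powR_ge0.
  apply: (@le_trans _ _ (L ^+ (3 * m))%:E).
    by rewrite lee_fin pcE powR_mulrn ?(ltW L0_gt0)// lerXn2r ?nnegrE// ltW.
  apply: (@le_trans _ _ (\int[leb3 R]_x (`|h (enorm x) / enorm x| ^+ (3 * m))%:E)%E).
    apply: (@le_trans _ _ (unit_disc_area R * lam ^+ 2 * (2 * K / lam / 6) ^+ (3 * m) * eps)%:E).
      by rewrite lee_fin.
    exact: integral_profile_ge.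
  rewrite le_eqVlt; apply/orP; left; apply/eqP; apply: eq_integral => x _.
  by rewrite /= pcE powR_mulrn.
exists (solution h w); split.
- apply: (@mild_solution_radial R h g A (L + K / eps)) => //.
  + exact: measurable_profile_slope.
  + by move=> y; exact: profile_slope_le.
  + by move=> y; exact: profile_slope_supp.
  + by move=> a b; exact: Rintegral_profile_slope.
- apply: (norm_solution_lty mh h_ge0 h_le h_supp sw _ wC).
  by apply: mulr_ge0 => //; exact: (time_const_ge0 (h := h)).
have [Z [mZ Z0 sub]] := ae_enorm_gt0 R.
exists Z; split=> // x /=; apply: contra_notP => xZ.
have r0 : 0 < enorm x by apply: contrapT => r0; apply: xZ; exact: sub.
have [a [b [a0 ab uab]]] := solution_ge L1 LK lam0 eps0 epsl sw r0.
apply: le_trans (le_ess_sup_time a0 ab uab); rewrite lee_fin.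
have := ler_wpM2l (ltW L0_gt0) (japanese_inv_le x).
have := ler_wpM2r (ltW (weight_gt0 (enorm x))) L0L.
by lra.
Qed.
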